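(* Suppose that the heavy-tailed Lipschitz condition holds with $p=2$, that $X^*\neq\emptyset$, that $T$ is pseudo-monotone on $X$, and that in Algorithm 1 the samples $\{\xi^k_j\}$ and $\{\eta^k_j\}$ are i.i.d. from $\mathbf P$ and independent of each other. Set $$N_k:=N\left\lceil(k+\mu)(\ln(k+\mu))^{1+b}\right\rceil$$ for any $N\in\mathbb N$, $b>0$ and $\mu>2$ (so that $\sum_kN_k^{-1}<\infty$). Then: (1) either Algorithm 1 stops at iteration $k+1$, in which case $x^k$ is a solution of $\mathrm{VI}(T,X)$, or it generates an infinite sequence $\{x^k\}$ such that a.s. it is bounded, $\lim_{k\to\infty}\mathrm d(x^k,X^* )=0$, and $r(x^k)$ converges to $0$ almost surely and in $\mathcal L^2$ (in particular a.s. every cluster point of $\{x^k\}$ belongs to $X^*$); (2) the sequence $\{x^k\}$ generated by Algorithm 1 is bounded in $\mathcal L^2$; (3) moreover, for any $x^*\in X^*$, if $\mathsf J>0$ is such that $\sup_{k\ge0}\mathbb E\left[\|x^k-x^*\|^2\right]\le\mathsf J$, then for all $k\in\mathbb N\cup\{0\}$, $$\min_{i=0,\dots,k}\mathbb E\left[r(x^i)^2\right]\le\frac{1}{k+1}\cdot\frac{2\|\mathsf L(\xi)\|_{\mathcal L^2}^2}{(1-6\lambda^2)[(\lambda\theta)\wedge\hat\alpha]^2}\left\{\|x^0-x^*\|^2+\frac{\mathsf C_2[\hat\alpha\sigma_{2\mathsf a}(x^* )]^2+\overline{\mathsf C}_2(\hat\alpha\widetilde L_2)^2\mathsf J}{N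b[\ln(\mu-1)]^b}\right\}.$$
   Context: Setting. $X\subset\mathbb R^d$ is a nonempty closed convex set, $\mathbf P$ is a probability distribution on $\Xi$, $F:\Xi\times X\to\mathbb R^d$ is a measurable random operator, and $\xi$ is a random variable with distribution $\mathbf P$. $T(x):=\mathbb E[F(\xi,x)]$. $\mathrm{VI}(T,X)$: find $x^*\in X$ with $\langle T(x^* ),x-x^*\rangle\ge0$ for all $x\in X$; $X^*$ is its solution set. $\|\cdot\|$ is the Euclidean norm, $\Pi$ the Euclidean projection onto $X$, $\mathrm d(\cdot,X^* )$ the Euclidean distance to $X^*$, $\mathrm{diam}(X)$ the diameter of $X$, $a\wedge b=\min\{a,b\}$, $a\vee b=\max\{a,b\}$, $r(x):=\|x-\Pi[x-T(x)]\|$, $\|Y\|_{\mathcal L^q}:=(\mathbb E|Y|^q)^{1/q}$. $\lceil x\rceil$ is the smallest integer greater than $x$. Put $\epsilon(\xi,x):=F(\xi,x)-T(x)$, $\sigma_q(x):=(\mathbb E\|\epsilon(\xi,x)\|^q)^{1/q}$, and for a sample $\xi^N=\{\xi_j\}_{j=1}^N$: $\widehat F(\xi^N,x):=\frac1N\sum_jF(\xi_j,x)$, $\widehat\epsilon(\xi^N,x):=\frac1N\sum_j\epsilon(\xi_j,x)$. Heavy-tailed Lipschitz condition with $p=2$: there is a random variable $\mathsf L:\Xi\to\mathbb R_+$ such that for almost every $\xi$, $\mathsf L(\xi)\ge1$ and $\|F(\xi,x)-F(\xi,y)\|\le\mathsf L(\xi)\|x-y\|$ for all $x,y\in X$; and,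 with $\mathsf a:=1$ if $X$ is compact and $\mathsf a:=2$ for a general $X$, there is $x_*\in X$ with $\mathbb E\|F(\xi,x_* )\|^{2\mathsf a}<\infty$, $\mathbb E[\mathsf L(\xi)^{2\mathsf a}]<\infty$. $L:=\mathbb E[\mathsf L(\xi)]$, $L_q:=\|\mathsf L(\xi)\|_{\mathcal L^q}+L$. Pseudo-monotonicity: for all $x,z\in X$, $\langle T(x),z-x\rangle\ge0$ implies $\langle T(z),z-x\rangle\ge0$. Algorithm 1. Choose an initial iterate $x^0\in X$, parameters $\hat\alpha\in(0,1]$, $\theta\in(0,1)$, $\lambda\in(0,1/\sqrt6)$, and sample sizes $N_k$. Given $x^k$, draw $\xi^k=\{\xi^k_j\}_{j=1}^{N_k}$ from $\mathbf P$. If $x^k=\Pi[x^k-\hat\alpha\widehat F(\xi^k,x^k)]$, stop (''stops at iteration $k+1$''). Otherwise put $z^k(\alpha):=\Pi[x^k-\alpha\widehat F(\xi^k,x^k)]$ and let $\alpha_k$ be the maximum $\alpha\in\{\theta^\ell\hat\alpha:\ell\in\mathbb N\cup\{0\}\}$ with $\alpha\|\widehat F(\xi^k,z^k(\alpha))-\widehat F(\xi^k,x^k)\|\le\lambda\|z^k(\alpha)-x^k\|$. Draw $\eta^k=\{\eta^k_j\}_{j=1}^{N_k}$ from $\mathbf P$ and set $z^k:=\Pi[x^k-\alpha_k\widehat F(\xi^k,x^k)]$, $x^{k+1}:=\Pi[x^k-\alpha_k\widehat F(\eta^k,z^k)]$. Constants ($p=2$). $C_4$ is a constant of the Burkholder–Davis–Gundy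 inequality in $\mathbb R^d$ with exponent 4: $\|\sup_{j\le N}\|y_j\|\|_{\mathcal L^4}\le C_4\|(\sum_{j=1}^N\|y_j-y_{j-1}\|^2)^{1/2}\|_{\mathcal L^4}$ for all $\mathbb R^d$-valued martingales with $y_0=0$; and $C_2:=1$. General $X$ ($\mathsf a=2$): let $\Gamma:=1+2L\hat\alpha+\|\mathsf L(\xi)\|_{\mathcal L^4}\hat\alpha$, $\mathsf c_1:=2+C_4\Gamma$, $\mathsf c_4:=C_4\Gamma$, and let $\mathsf c_2,\mathsf c_3>0$ be constants, at most a universal constant times $\big[\frac{3\sqrt d}{\sqrt2-1}+\sqrt2\big]\Gamma$ and $2\Gamma$ respectively, such that with $\overline L_4:=\mathsf c_2L_2+\mathsf c_3L_2+\mathsf c_4L_4$ one has $\big\|\|\widehat\epsilon(\xi^M,\Pi[x-\alpha_M\widehat F(\xi^M,x)])\|\big\|_{\mathcal L^2}\le(\mathsf c_1\sigma_4(x^* )+\overline L_4\|x-x^*\|)/\sqrt M$ for all $M\in\mathbb N$, $x\in X$, $x^*\in X^*$, i.i.d. samples $\xi^M$ of size $M$ from $\mathbf P$ and random $\alpha_M\in[0,\hat\alpha]$. Then $\widetilde L_2:=\overline L_4$ and, with $\mathsf G_2:=\sup_kL_2\hat\alpha/\sqrt{N_k}$, $\mathsf C_2:=2\mathsf c_1^2[6(1+\mathsf G_2)^2+7-6\lambda^2]$ and $\overline{\mathsf C}_2:=2[6(1+L\hat\alpha+\mathsf G_2)^2+7-6\lambda^2]$. Compact $X$ ($\mathsf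 a=1$): let $\mathsf d_2>0$ be a constant, at most a universal constant times $\frac{3\sqrt d}{\sqrt2-1}+\sqrt2$, such that with $L_2^*:=\mathsf d_2L_2+2L_2$ the left-hand side above is at most $(\sigma_2(x^* )+L_2^*\mathrm{diam}(X))/\sqrt M$. Then $\widetilde L_2:=L_2\vee L_2^*$, $\mathsf C_2:=26-12\lambda^2$ and $\overline{\mathsf C}_2:=26-12\lambda^2$.
   Formalization: ''Stops at k+1, so x^k is a solution'' is proved only a.s. on events of the past where stopping is almost sure (a chance stop can occur at a non-solution); in (3) for compact X with a=1, J is also required to be at least diam(X)^2, since the bound can fail for smaller J. *)

(* Defs.v *)
From HB Require Import structures.
From mathcomp Require Import all_boot all_order all_algebra.
From mathcomp Require Import all_classical all_reals all_analysis.
Import Order.TTheory GRing.Theory Num.Theory.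
Import numFieldNormedType.Exports.

Set Implicit Arguments.
Unset Strict Implicit.
Unset Printing Implicit Defensive.

Local Open Scope classical_set_scope.
Local Open Scope ring_scope.

Section Euclid.
Context {R : realType} {d : nat}.
Implicit Types (x y : 'rV[R]_d) (A : set 'rV[R]_d).

Definition dot x y : R := \sum_i x 0 i * y 0 i.

(* The library norm of a matrix is the sup norm; it induces the same topology
   (used below for open, closed and compact) but not the same metric. *)
Definition enorm x : R := Num.sqrt (dot x x).

Definition dist_to x A : R := inf [set enorm (x - y) | y in A].

Definition diameter A : R := sup [set enorm (p.1 - p.2) | p in A `*` A].

Definition proj A x : 'rV[R]_d :=
  xget 0 [set y | A y /\ forall u, A u -> enorm (x - y) <= enorm (x - u)].

End Euclid.

(* R^d with its Borel sigma-algebra. *)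
Definition borelV (R : realType) (d : nat) :=
  g_sigma_algebraType (@open 'rV[R]_d).

Section Probability.
Context {R : realType} {dW dXi : measure_display}.
Context {W : measurableType dW} {Xi : measurableType dXi}.

Definition Lnm (Q : probability W R) (q : nat) (Y : W -> R) : \bar R :=
  'N[Q]_(q%:R%:E)[EFin \o Y]%E.

Definition independent_family (Q : probability W R) (I : eqType)
    (Y : I -> W -> Xi) : Prop :=
  forall (s : seq I) (A : I -> set Xi), uniq s ->
    (forall i, measurable (A i)) ->
    Q (\bigcap_(i in [set i | i \in s]) (Y i @^-1` A i)) =
    (\prod_(i <- s) Q (Y i @^-1` A i))%E.

Definition iid_sample (P : probability Xi R) (Q : probability W R) (I : eqType)
    (Y : I -> W -> Xi) : Prop :=
  [/\ forall i, measurable_fun setT (Y i),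
      forall i (B : set Xi), measurable B -> Q (Y i @^-1` B) = P B
    & independent_family Q Y].

(* The martingale property is E[y_(n+1) ; A] = E[y_n ; A] for A in G_n,
   coordinate by coordinate. *)
Definition martingale (d : nat) (Q : probability W R)
    (y : nat -> W -> 'rV[R]_d) : Prop :=
  exists G : nat -> set (set W),
    [/\ forall n, sigma_algebra setT (G n),
        forall n, G n `<=` measurable,
        forall n, G n `<=` G n.+1,
        forall n i (B : set R), measurable B ->
          G n ((fun w => y n w 0 i) @^-1` B)
      & forall n i, Q.-integrable setT (fun w => (y n w 0 i)%:E) /\
          forall A, G n A ->
            (\int[Q]_(w in A) (y n.+1 w 0 i)%:E =
             \int[Q]_(w in A) (y n w 0 i)%:E)%E].

End Probability.

(* C is a constant of the Burkholder-Davis-Gundy inequality in R^d with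
   exponent q. *)
Definition BDG_constant (R : realType) (d q : nat) (C : R) : Prop :=
  forall (dW : measure_display) (W : measurableType dW) (Q : probability W R)
    (y : nat -> W -> 'rV[R]_d) (N : nat),
    martingale Q y -> (forall w, y 0%N w = 0) ->
    (Lnm Q q (fun w => \big[Num.max/0%R]_(j < N.+1) enorm (y j w)) <=
     C%:E * Lnm Q q (fun w =>
       Num.sqrt (\sum_(j < N) enorm (y j.+1 w - y j w) ^+ 2)))%E.

Section VariationalInequality.
Context {R : realType} {d : nat} (X : set 'rV[R]_d).
Implicit Types (T : 'rV[R]_d -> 'rV[R]_d) (x : 'rV[R]_d).

Definition solutions T : set 'rV[R]_d :=
  [set x | X x /\ forall y, X y -> 0 <= dot (T x) (y - x)].

Definition pseudo_monotone T : Prop :=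
  forall x z, X x -> X z ->
    0 <= dot (T x) (z - x) -> 0 <= dot (T z) (z - x).

Definition residual T x : R := enorm (x - proj X (x - T x)).

End VariationalInequality.

Section Operator.
Context {R : realType} {d : nat} {dXi : measure_display}.
Context {Xi : measurableType dXi}.
Variables (P : probability Xi R) (X : set 'rV[R]_d).
Variables (F : Xi -> 'rV[R]_d -> 'rV[R]_d).

Definition random_operator : Prop :=
  measurable_fun (setT `*` X : set (Xi * borelV R d)%type)
    (fun p : Xi * borelV R d => F p.1 p.2 : borelV R d).

Definition mean_op (x : 'rV[R]_d) : 'rV[R]_d := \row_i \int[P]_s F s x 0 i.

Definition sigma (q : nat) (x : 'rV[R]_d) : R :=
  fine (Lnm P q (fun s => enorm (F s x - mean_op x))).

Definition heavy_tailed_lipschitz (a : nat) (Lip : Xi -> R) : Prop :=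
  [/\ measurable_fun setT Lip /\ (forall s, 0 <= Lip s),
      \forall s \ae P, 1 <= Lip s /\
        forall x y, X x -> X y ->
          enorm (F s x - F s y) <= Lip s * enorm (x - y),
      exists2 x, X x & (\int[P]_s (enorm (F s x) ^+ (2 * a))%:E < +oo)%E
    & (\int[P]_s (Lip s ^+ (2 * a))%:E < +oo)%E].

Definition emp_op (M : nat) (s : 'I_M -> Xi) (x : 'rV[R]_d) : 'rV[R]_d :=
  M%:R^-1 *: \sum_j F (s j) x.

Definition emp_err (M : nat) (s : 'I_M -> Xi) (x : 'rV[R]_d) : 'rV[R]_d :=
  emp_op s x - mean_op x.

Definition trial_point (M : nat) (s : 'I_M -> Xi) (x : 'rV[R]_d) (al : R) :
  'rV[R]_d := proj X (x - al *: emp_op s x).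

(* [bound x xs / sqrt M] bounds the L^2 norm of the empirical error at the
   trial point, for a step that may depend on the sample. *)
Definition trial_error_bound (ah : R)
    (bound : 'rV[R]_d -> 'rV[R]_d -> R) : Prop :=
  forall (dW : measure_display) (W : measurableType dW) (Q : probability W R)
    (M : nat) (s : 'I_M -> W -> Xi) (al : W -> R) (x xs : 'rV[R]_d),
    (0 < M)%N -> iid_sample P Q s ->
    measurable_fun setT al -> (forall w, 0 <= al w <= ah) ->
    X x -> solutions X mean_op xs ->
    (Lnm Q 2 (fun w =>
       enorm (emp_err (fun j => s j w)
                (trial_point (fun j => s j w) x (al w)))) <=
     (bound x xs / Num.sqrt M%:R)%:E)%E.

End Operator.

(* The smallest integer strictly greater than x, for x >= 0. *)
Definition next_int (R : realType) (x : R) : nat := (Num.truncn x).+1.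

Definition sample_size (R : realType) (N : nat) (b mu : R) (k : nat) : nat :=
  (N * next_int ((k%:R + mu) * ln (k%:R + mu) `^ (1 + b)))%N.

Section Algorithm.
Context {R : realType} {d : nat} {dXi dW : measure_display}.
Context {Xi : measurableType dXi} {W : measurableType dW}.
Variables (X : set 'rV[R]_d) (F : Xi -> 'rV[R]_d -> 'rV[R]_d).
Variables (ah theta lam : R) (x0 : 'rV[R]_d).

(* The set of accepted steps is bounded and accumulates only at 0, so the
   supremum is the maximum whenever the set is nonempty; it is nonempty as soon
   as the empirical operator is Lipschitz on X. *)
Definition line_search (M : nat) (s : 'I_M -> Xi) (x : 'rV[R]_d) : R :=
  sup [set al | exists2 l : nat, al = theta ^+ l * ah &
    al * enorm (emp_op F s (trial_point X F s x al) - emp_op F s x) <=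
    lam * enorm (trial_point X F s x al - x)].

Variables (Nk : nat -> nat) (xi eta : forall k, 'I_(Nk k) -> W -> Xi).

(* The update is written for every k and w; [iterate k w] is an iterate of the
   algorithm only for w in [generated k], that is when the stopping test has
   failed at all previous iterations. *)
Fixpoint iterate (k : nat) (w : W) : 'rV[R]_d :=
  if k is n.+1 then
    let x := iterate n w in
    let xin := fun j => @xi n j w in
    let al := line_search xin x in
    let z := trial_point X F xin x al in
    proj X (x - al *: emp_op F (fun j => @eta n j w) z)
  else x0.

Definition stop_test (k : nat) : set W :=
  [set w | iterate k w =
           trial_point X F (fun j => @xi k j w) (iterate k w) ah].

Definition generated (k : nat) : set W :=
  [set w | forall i, (i < k)%N -> ~ stop_test i w].

(* The event that the algorithm stops at iteration k+1. *)
Definition stops (k : nat) : set W := generated k `&` stop_test k.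

End Algorithm.

Section Samples.
Context {dXi dW : measure_display}.
Context {Xi : measurableType dXi} {W : measurableType dW}.
Variables (Nk : nat -> nat) (xi eta : forall k, 'I_(Nk k) -> W -> Xi).

Definition all_draws (i : {k & 'I_(Nk k)} + {k & 'I_(Nk k)}) : W -> Xi :=
  match i with inl u => @xi (tag u) (tagged u) | inr u => @eta (tag u) (tagged u) end.

(* The sigma-algebra of the events known when x^k has been computed. *)
Definition history (k : nat) : set (set W) :=
  <<s [set A | exists (i : nat) (j : 'I_(Nk i)) (B : set Xi),
         [/\ (i < k)%N, measurable B &
             A = @xi i j @^-1` B \/ A = @eta i j @^-1` B] ]>>.

End Samples.

Section Constants.
Context {R : realType} {dXi : measure_display} {Xi : measurableType dXi}.
Variables (P : probability Xi R) (Lip : Xi -> R) (ah theta lam : R).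

Definition Lmean : R := \int[P]_s Lip s.
Definition Lnorm_lip (q : nat) : R := fine (Lnm P q Lip).
Definition Lq (q : nat) : R := Lnorm_lip q + Lmean.

Definition Gam : R := 1 + 2 * Lmean * ah + Lnorm_lip 4 * ah.

Definition dim_const (d : nat) : R :=
  3 * Num.sqrt d%:R / (Num.sqrt 2 - 1) + Num.sqrt 2.

Definition c1 (C4 : R) : R := 2 + C4 * Gam.
Definition c4 (C4 : R) : R := C4 * Gam.
Definition Lbar4 (C4 c2 c3 : R) : R := c2 * Lq 2 + c3 * Lq 2 + c4 C4 * Lq 4.

Definition G2 (Nk : nat -> nat) : R :=
  sup (range (fun k => Lq 2 * ah / Num.sqrt (Nk k)%:R)).

Definition C2_general (C4 : R) (Nk : nat -> nat) : R :=
  2 * c1 C4 ^+ 2 * (6 * (1 + G2 Nk) ^+ 2 + 7 - 6 * lam ^+ 2).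
Definition C2bar_general (Nk : nat -> nat) : R :=
  2 * (6 * (1 + Lmean * ah + G2 Nk) ^+ 2 + 7 - 6 * lam ^+ 2).

Definition Lstar (d2 : R) : R := d2 * Lq 2 + 2 * Lq 2.
Definition C2_compact : R := 26 - 12 * lam ^+ 2.

Definition rate_bound (N : nat) (b mu D0 C Cbar sig Ltil J : R) (k : nat) : R :=
  k.+1%:R^-1 *
  (2 * Lnorm_lip 2 ^+ 2 /
     ((1 - 6 * lam ^+ 2) * Num.min (lam * theta) ah ^+ 2)) *
  (D0 ^+ 2 + (C * (ah * sig) ^+ 2 + Cbar * (ah * Ltil) ^+ 2 * J) /
             (N%:R * b * ln (mu - 1) `^ b)).

End Constants.

(* Main.v *)
(** The squared distance of the iterates to a solution is an almost
supermartingale: by the extragradient inequality for a pseudo-monotone operator,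
one step lowers it by a multiple of r(x^k)^2, up to a cross term that vanishes
in mean because the second sample is independent of the first, and up to
alpha^2 times the squared empirical errors at x^k (first sample) and at z^k
(both samples).

The error of the first sample at z^k is delicate, since z^k depends on that
sample.  For part (3) it is the hypothesis [trial_error_bound].  Parts (1) and
(2) have no such hypothesis and only need some bound
C (1 + |x^k - x^*|^2) / N_k, for which no chaining is required: the step is one
of the countably many theta^l ah, the deterministic points
proj (x - theta^l ah T x) have errors of order theta^l relative to the error at
x, so these are summable over l, and the distance of z^k to the corresponding
point is itself controlled by the empirical error at x^k.

Conditioning on the past is replaced by independence of disjoint blocks of
draws: on an event of the past, an integral over the sample space becomes an
iterated one, with a frozen iterate in the inner integral. Ville's inequality
gives boundedness almost surely, and summability of the mean squared residuals
gives convergence. *)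
From HB Require Import structures.
Require Import Defs.
From mathcomp Require Import all_boot all_order all_algebra.
From mathcomp Require Import all_classical all_reals all_analysis.
From mathcomp Require Import measurable_realfun ring lra.
Import Order.TTheory GRing.Theory Num.Theory.
Import numFieldNormedType.Exports.

Set Implicit Arguments.
Unset Strict Implicit.
Unset Printing Implicit Defensive.

Local Open Scope classical_set_scope.
Local Open Scope ring_scope.

(* The library also has a [proj]. *)
Local Notation proj := Defs.proj.

(** * Euclidean geometry and the extragradient step *)

(** The recursion defines [iterate] on the whole sample space, also after a stopping test has
    succeeded, and the one-step estimate remains valid there. The limits are therefore proved for
    this unrestricted sequence, and [generated k] enters only when the conclusions are read off. In
    part (3), however, [J] bounds the distances on [generated k] alone, so the recursion for the
    rate carries the indicators of these decreasing events; this is why one step of the algorithm is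
    formulated on an arbitrary event of the past.

    The operator is controlled on [X] only. Global continuity and measurability are recovered by
    composing with the nonexpansive projection, which is the identity on [X].

    The two cases differ in one place of parts (1) and (2): the squared fluctuation of the averaged
    Lipschitz constant multiplies a squared displacement. Either displacements are bounded, or
    fourth moments and Cauchy-Schwarz control the product. *)

Lemma sqr_ler {R : realDomainType} (a b : R) : 0 <= a -> a <= b -> a ^+ 2 <= b ^+ 2.
Proof. by move=> a0 ab; rewrite ler_pXn2r// nnegrE// (le_trans a0). Qed.

Section EuclideanNorm.
Context {R : realType} {d : nat}.
Implicit Types (x y z : 'rV[R]_d) (a : R).

Lemma dotC x y : dot x y = dot y x.
Proof. by apply: eq_bigr => i _; rewrite mulrC. Qed.

Lemma dotDl x y z : dot (x + y) z = dot x z + dot y z.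
Proof.
by rewrite /dot -big_split; apply: eq_bigr => i _ /=; rewrite mxE mulrDl.
Qed.

Lemma dotZl a x y : dot (a *: x) y = a * dot x y.
Proof.
by rewrite /dot mulr_sumr; apply: eq_bigr => i _; rewrite mxE mulrA.
Qed.

Lemma dotNl x y : dot (- x) y = - dot x y.
Proof. by rewrite -scaleN1r dotZl mulN1r. Qed.

Lemma dotDr x y z : dot x (y + z) = dot x y + dot x z.
Proof. by rewrite dotC dotDl !(dotC x). Qed.

Lemma dotNr x y : dot x (- y) = - dot x y.
Proof. by rewrite dotC dotNl dotC. Qed.

Lemma dotZr a x y : dot x (a *: y) = a * dot x y.
Proof. by rewrite dotC dotZl dotC. Qed.

Definition dotE := (dotDl, dotDr, dotNl, dotNr, dotZl, dotZr).

Lemma dot_ge0 x : 0 <= dot x x.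
Proof. by apply: sumr_ge0 => i _; rewrite -expr2 sqr_ge0. Qed.

Lemma enorm_ge0 x : 0 <= enorm x.
Proof. exact: sqrtr_ge0. Qed.

Lemma enorm_sqr x : enorm x ^+ 2 = dot x x.
Proof. by rewrite sqr_sqrtr// dot_ge0. Qed.

Lemma ler_enorm x y : (enorm x <= enorm y) = (enorm x ^+ 2 <= enorm y ^+ 2).
Proof. by rewrite ler_pXn2r// nnegrE enorm_ge0. Qed.

Lemma coord_le_enorm x i : `|x 0 i| <= enorm x.
Proof.
rewrite -(@ler_pXn2r _ 2)// ?nnegrE ?enorm_ge0// enorm_sqr real_normK ?num_real//.
by rewrite /dot (bigD1 i)//= -expr2 lerDl sumr_ge0// => j _; rewrite -expr2 sqr_ge0.
Qed.

Lemma enorm0 : enorm (0 : 'rV[R]_d) = 0.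
Proof. by rewrite /enorm -[X in dot X _](scale0r 0) dotZl mul0r sqrtr0. Qed.

Lemma enorm_eq0 x : enorm x = 0 -> x = 0.
Proof.
move=> x0; apply/rowP => i; rewrite mxE; apply/normr0_eq0/le_anti.
by rewrite normr_ge0 andbT -x0 coord_le_enorm.
Qed.

Lemma enormN x : enorm (- x) = enorm x.
Proof. by rewrite /enorm dotNl dotNr opprK. Qed.

Lemma enorm_sym x y : enorm (x - y) = enorm (y - x).
Proof. by rewrite -enormN opprB. Qed.

Lemma enormZ a x : enorm (a *: x) = `|a| * enorm x.
Proof.
by rewrite /enorm dotZl dotZr mulrA -expr2 sqrtrM ?sqr_ge0// sqrtr_sqr.
Qed.

Lemma dot_le_enorm x y : dot x y <= enorm x * enorm y.
Proof.
have [x0|x0] := eqVneq (enorm x) 0.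
  by rewrite x0 (enorm_eq0 x0) mul0r -[X in dot X _](scale0r 0) dotZl mul0r.
have [y0|y0] := eqVneq (enorm y) 0.
  by rewrite y0 (enorm_eq0 y0) mulr0 -[X in dot _ X](scale0r 0) dotZr mul0r.
have xy0 : 0 < enorm x * enorm y by rewrite mulr_gt0// lt0r ?x0 ?y0 enorm_ge0.
(* Expanding this square gives twice [enorm x * enorm y] times the defect in Cauchy-Schwarz, and
   that factor is positive here. *)
have := dot_ge0 (enorm y *: x - enorm x *: y).
rewrite !dotE -!enorm_sqr (dotC y x) => h.
have : 0 <= (enorm x * enorm y) * (enorm x * enorm y - dot x y) by nra.
by rewrite pmulr_rge0// subr_ge0.
Qed.

Lemma ler_enormD x y : enorm (x + y) <= enorm x + enorm y.
Proof.
rewrite -(@ler_pXn2r _ 2)// ?nnegrE ?addr_ge0 ?enorm_ge0//.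
rewrite enorm_sqr !dotE (dotC y x) -!enorm_sqr.
have := dot_le_enorm x y; nra.
Qed.

Lemma ler_enorm_dist z x y : enorm (x - y) <= enorm (x - z) + enorm (z - y).
Proof. by rewrite -[x - y](subrKA z) ler_enormD. Qed.

Lemma enormD_sqr x y : enorm (x + y) ^+ 2 <= 2 * enorm x ^+ 2 + 2 * enorm y ^+ 2.
Proof.
have := sqr_ge0 (enorm (x - y)).
rewrite !enorm_sqr !dotE (dotC y x); lra.
Qed.

Lemma enormD3_sqr x y z :
  enorm (x + y + z) ^+ 2 <= 3 * enorm x ^+ 2 + 3 * enorm y ^+ 2 + 3 * enorm z ^+ 2.
Proof.
have := sqr_ge0 (enorm (x - y)); have := sqr_ge0 (enorm (x - z)).
have := sqr_ge0 (enorm (y - z)).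
rewrite !enorm_sqr !dotE (dotC y x) (dotC z x) (dotC z y); lra.
Qed.

Lemma enorm_sum (I : Type) (s : seq I) (p : pred I) (f : I -> 'rV[R]_d) :
  enorm (\sum_(i <- s | p i) f i) <= \sum_(i <- s | p i) enorm (f i).
Proof.
elim/big_rec2: _ => [|i y x _ h]; first by rewrite enorm0.
by apply: le_trans (ler_enormD _ _) _; rewrite lerD2l.
Qed.

Lemma enorm_le_mx_norm x : enorm x <= Num.sqrt d%:R * `|x|.
Proof.
rewrite -(@ler_pXn2r _ 2)// ?nnegrE ?enorm_ge0// ?mulr_ge0 ?sqrtr_ge0//.
rewrite enorm_sqr exprMn sqr_sqrtr// /dot.
have -> : d%:R * `|x| ^+ 2 = \sum_(i < d) `|x| ^+ 2.
  by rewrite sumr_const card_ord mulr_natl.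
apply: ler_sum => i _; rewrite -expr2 -real_normK ?num_real//.
rewrite ler_pXn2r// ?nnegrE//.
rewrite /Num.norm/= mx_normrE.
by apply: (le_bigmax _ (fun ij => `|x ij.1 ij.2|) (0, i)).
Qed.

Lemma mx_norm_le_enorm x : `|x| <= enorm x.
Proof.
rewrite /Num.norm/= mx_normrE; apply: bigmax_le; first exact: enorm_ge0.
by move=> [i j] _ /=; rewrite ord1 coord_le_enorm.
Qed.

Lemma lipschitz_enorm_continuous (f : 'rV[R]_d -> R) (K : R) :
  (forall x y, `|f x - f y| <= K * enorm (x - y)) -> continuous f.
Proof.
move=> fK x; have Fx : Filter (nbhs x) := nbhs_filter x.
apply/cvgrPdist_lt => e e0.
(* The added ones keep [K'] positive when [K] is zero or negative and when [d] is zero. *)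
pose K' := (`|K| + 1) * (Num.sqrt d%:R + 1).
have K0 : 0 < K' by rewrite mulr_gt0// ltr_wpDl ?sqrtr_ge0.
have e'0 : 0 < e / K' by rewrite divr_gt0.
suff : nbhs x [set y | `|f x - f y| < e] by [].
apply/nbhs_ballP; exists (e / K') => // y; rewrite -ball_normE /= => yx.
apply: le_lt_trans (fK _ _) _.
have h1 := enorm_le_mx_norm (x - y).
have h0 := enorm_ge0 (x - y).
have h2 : K * enorm (x - y) <= (`|K| + 1) * enorm (x - y).
  by rewrite ler_wpM2r// (le_trans (ler_norm K))// lerDl.
apply: le_lt_trans h2 _.
have h3 : (`|K| + 1) * enorm (x - y) <= K' * `|x - y|.
  rewrite /K' -mulrA ler_wpM2l ?addr_ge0//.
  by apply: le_trans h1 _; rewrite ler_wpM2r// lerDl.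
by apply: le_lt_trans h3 _; rewrite mulrC -ltr_pdivlMr.
Qed.

Lemma lipschitz_continuous d' (f : 'rV[R]_d -> 'rV[R]_d') (K : R) :
  (forall x y, enorm (f x - f y) <= K * enorm (x - y)) ->
  forall i, continuous (fun x => f x 0 i).
Proof.
move=> fK i; apply: (@lipschitz_enorm_continuous _ K) => x y.
apply: le_trans (fK x y); have -> : f x 0 i - f y 0 i = (f x - f y) 0 i by rewrite !mxE.
rewrite -(@ler_pXn2r _ 2)// ?nnegrE ?sqrtr_ge0//.
rewrite sqr_sqrtr; last by apply: sumr_ge0 => j _; rewrite -expr2 sqr_ge0.
rewrite real_normK ?num_real// /dot (bigD1 i)//= -expr2 lerDl.
by rewrite sumr_ge0// => j _; rewrite -expr2 sqr_ge0.
Qed.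

Lemma enorm_dist_continuous x : continuous (fun y => enorm (x - y)).
Proof.
apply: (@lipschitz_enorm_continuous _ 1) => y z; rewrite mul1r ler_norml.
have := ler_enorm_dist z x y; have := ler_enorm_dist y x z.
by rewrite (enorm_sym z y); move=> ? ?; apply/andP; split; lra.
Qed.

Lemma enorm_bounded_compact (A : set 'rV[R]_d) (x : 'rV[R]_d) (B : R) :
  closed A -> compact (A `&` [set y | enorm (x - y) <= B]).
Proof.
move=> cA; apply: bounded_closed_compact; last first.
  apply: closedI => //.
  have -> : [set y | enorm (x - y) <= B] = (fun y => enorm (x - y)) @^-1` [set b | b <= B] by [].
  apply: closed_comp; last exact: closed_le.
  by move=> y _; exact: enorm_dist_continuous.
exists (enorm x + B); split; first exact: num_real.
move=> M hM y [_ /= hy]; apply: ltW; apply: le_lt_trans hM.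
apply: le_trans (mx_norm_le_enorm y) _.
have := ler_enorm_dist x y 0; rewrite !subr0 (enorm_sym y x); lra.
Qed.

End EuclideanNorm.

Lemma pow4E {R : pzSemiRingType} (x : R) : x ^+ 4 = (x ^+ 2) ^+ 2.
Proof. exact: exprM x 2 2. Qed.

Lemma sqr_sum_le {R : realDomainType} (n : nat) (f : 'I_n -> R) :
  (\sum_i f i) ^+ 2 <= n%:R * \sum_i f i ^+ 2.
Proof.
elim: n f => [|n IH] f; first by rewrite !big_ord0 expr0n mulr0.
rewrite !big_ord_recl -natr1; set S := \sum_i _; set Q := \sum_i _.
have h : S ^+ 2 <= n%:R * Q by exact: IH.
have h2 : 2 * f ord0 * S <= n%:R * f ord0 ^+ 2 + Q.
  rewrite /S /Q mulr_sumr.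
  have -> : n%:R * f ord0 ^+ 2 = \sum_(i < n) f ord0 ^+ 2.
    by rewrite sumr_const card_ord mulr_natl.
  rewrite -big_split/=; apply: ler_sum => i _.
  by have := sqr_ge0 (f ord0 - f (lift ord0 i)); nra.
nra.
Qed.

Section Projection.
Context {R : realType} {d : nat} (X : set 'rV[R]_d).
Hypotheses (X0 : X !=set0) (Xcl : closed X) (Xcvx : convex_set X).
Implicit Types (x y v : 'rV[R]_d).

(** A minimizer exists on the compact set of points of [X] no farther from [x] than a chosen [u] in
    [X]; every other point of [X] is farther away than [u]. *)
Lemma projP x :
  X (proj X x) /\ forall u, X u -> enorm (x - proj X x) <= enorm (x - u).
Proof.
suff h : exists y, [set y | X y /\ forall u, X u -> enorm (x - y) <= enorm (x - u)] y.
  exact: (xgetPex 0 h).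
case: X0 => u Xu; pose A := X `&` [set y | enorm (x - y) <= enorm (x - u)].
have A0 : A !=set0 by exists u; split => //=.
have cA : compact A by exact: enorm_bounded_compact.
have [] := @EVT_min_rV _ _ (fun y => enorm (x - y)) A A0 cA.
  by apply: continuous_subspaceT; exact: enorm_dist_continuous.
move=> c; rewrite inE => -[Xc hc] cmin; exists c; split=> // v Xv.
have [hv|hv] := leP (enorm (x - v)) (enorm (x - u)).
  by apply: cmin; rewrite inE.
exact: le_trans hc (ltW hv).
Qed.

Lemma projX x : X (proj X x). Proof. by have [] := projP x. Qed.

Lemma convex_segment x y (t : R) : X x -> X y -> 0 <= t <= 1 ->
  X (x + t *: (y - x)).
Proof.
move=> Xx Xy /andP[t0 t1].
have t01 : Itv.spec (@Itv.num_sem R) (Itv.Real `[0%Z, 1%Z]) t.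
  by rewrite /= /Itv.num_sem/= num_real/= in_itv/= t0 t1.
pose l := Itv.mk t01 : {i01 R}.
have := Xcvx l (mem_set Xy) (mem_set Xx); rewrite inE.
congr (X _); change (t *: y + (1 - t) *: x = x + t *: (y - x)).
by rewrite scalerBl scale1r scalerBr addrC -addrA (addrC (- _)).
Qed.

Lemma proj_vi x y : X y -> dot (x - proj X x) (y - proj X x) <= 0.
Proof.
move=> Xy; have [Xp pmin] := projP x; set p := proj X x in Xp pmin *.
rewrite leNgt; apply/negP => c0.
set c := dot _ _ in c0; pose D := enorm (y - p) ^+ 2.
have D0 : 0 <= D by rewrite sqr_ge0.
(* Minimality along the segment gives [2 * c <= t * D] for every [t] with [0 < t <= 1]. This choice
   has [t * D <= c], which contradicts [0 < c]; the summand [c] in the denominator keeps [t] at most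
   1 and covers [D = 0]. *)
pose t := c / (c + D).
have cD : 0 < c + D by rewrite ltr_wpDr.
have t0 : 0 < t by rewrite divr_gt0.
have t1 : t <= 1 by rewrite ler_pdivrMr// mul1r lerDl.
have := pmin _ (convex_segment Xp Xy (introT andP (conj (ltW t0) t1))).
rewrite ler_enorm [leRHS]enorm_sqr opprD addrA !dotE.
rewrite -/p => h.
have {h} : 2 * t * c <= t * t * D.
  move: h; rewrite /D !enorm_sqr !dotE /c !dotE !(dotC y) !(dotC p x); lra.
rewrite -mulrA mulrCA -mulrA ler_pM2l// => h.
have : t * D <= c by rewrite /t mulrAC ler_pdivrMr// ler_pM2l// lerDr ltW.
lra.
Qed.

Lemma proj_charac x p : X p -> (forall y, X y -> dot (x - p) (y - p) <= 0) ->
  proj X x = p.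
Proof.
move=> Xp hp; have := hp _ (projX x); have := proj_vi x Xp.
set q := proj X x => h1 h2; apply/eqP; rewrite -subr_eq0; apply/eqP/enorm_eq0.
apply/eqP; rewrite -sqrf_eq0 eq_le sqr_ge0 andbT enorm_sqr.
move: h1 h2; rewrite !dotE; have := dotC p q; lra.
Qed.

Lemma proj_id x : X x -> proj X x = x.
Proof. by move=> Xx; apply: proj_charac => // y _; rewrite subrr -(scale0r 0) dotZl mul0r. Qed.

Lemma proj_nonexpansive x y : enorm (proj X x - proj X y) <= enorm (x - y).
Proof.
have h1 := proj_vi x (projX y); have h2 := proj_vi y (projX x).
set p := proj X x in h1 h2 *; set q := proj X y in h1 h2 *.
have h3 : enorm (p - q) ^+ 2 <= dot (x - y) (p - q).
  move: h1 h2; rewrite enorm_sqr !dotE; have := dotC p q; lra.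
have h4 := le_trans h3 (dot_le_enorm _ _).
have [->|n0] := eqVneq (enorm (p - q)) 0; first exact: enorm_ge0.
by move: h4; rewrite expr2 ler_pM2r// lt0r n0 enorm_ge0.
Qed.

(** Testing each projection at the other one eliminates [v] and gives, for the two displacements [a]
    and [b], [al a^2 + b^2 <= (1 + al) a b], that is [(al a - b) (a - b) <= 0]. If [b < al a], both
    factors would be positive because [al <= 1]. This transfers estimates at the accepted step to
    the residual, whose step is 1. *)
Lemma residual_step x v (al : R) : X x -> 0 < al <= 1 ->
  al * enorm (x - proj X (x - v)) <= enorm (x - proj X (x - al *: v)).
Proof.
move=> Xx /andP[al0 al1].
have h1 := proj_vi (x - v) (projX (x - al *: v)).
have h2 := proj_vi (x - al *: v) (projX (x - v)).
set p := proj X (x - v) in h1 h2 *; set q := proj X (x - al *: v) in h1 h2 *.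
clearbody p q.
have h3 := dot_le_enorm (x - p) (x - q).
have h4 : al * enorm (x - p) ^+ 2 + enorm (x - q) ^+ 2 <= (1 + al) * dot (x - p) (x - q).
  move: h1; rewrite -(ler_pM2l al0) mulr0; move: h2.
  rewrite !enorm_sqr !dotE; have := (dotC p q, dotC p x, dotC q x); case=> [[-> ->] ->].
  lra.
have a0 := enorm_ge0 (x - p); have b0 := enorm_ge0 (x - q).
rewrite leNgt; apply/negP => hlt.
set a := enorm (x - p) in h3 h4 a0 hlt *; set b := enorm (x - q) in h3 h4 b0 hlt *.
have h5 : (al * a - b) * (a - b) <= 0 by nra.
have h6 : b < a by apply: lt_le_trans hlt _; rewrite ler_piMl.
have : 0 < (al * a - b) * (a - b) by rewrite mulr_gt0// subr_gt0.
by rewrite ltNge h5.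
Qed.

Lemma residual0_solution (T : 'rV[R]_d -> 'rV[R]_d) x (al : R) :
  X x -> 0 < al -> x = proj X (x - al *: T x) -> solutions X T x.
Proof.
move=> Xx al0 xE; split=> // y Xy.
have := proj_vi (x - al *: T x) Xy; rewrite -xE addrAC subrr add0r dotNl dotZl.
by rewrite oppr_le0 pmulr_rge0.
Qed.

Lemma solution_residual0 (T : 'rV[R]_d -> 'rV[R]_d) x (al : R) :
  0 <= al -> solutions X T x -> proj X (x - al *: T x) = x.
Proof.
move=> al0 [Xx xT]; apply: proj_charac => // y Xy.
by rewrite addrAC subrr add0r dotNl dotZl oppr_le0 mulr_ge0// xT.
Qed.

(** The projection inequality for the new point is tested at [xs], and the one for [z] at the new
    point; the leftover terms complete the square in [h3]. No operator is involved yet: [g1] and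
    [g2] are arbitrary vectors. *)
Lemma extragradient_step x xs g1 g2 (al : R) : X xs ->
  let z := proj X (x - al *: g1) in
  enorm (proj X (x - al *: g2) - xs) ^+ 2 <=
  enorm (x - xs) ^+ 2 - enorm (x - z) ^+ 2 + al ^+ 2 * enorm (g1 - g2) ^+ 2
  - 2 * al * dot g2 (z - xs).
Proof.
move=> Xxs /=; set z := proj X (x - al *: g1); set y := proj X (x - al *: g2).
have h1 := proj_vi (x - al *: g2) Xxs.
have h2 := proj_vi (x - al *: g1) (projX (x - al *: g2)).
rewrite -/y -/z in h1 h2.
clearbody y z.
have h3 := sqr_ge0 (enorm (y - z - al *: (g1 - g2))).
move: h1 h2 h3; rewrite !enorm_sqr !dotE.
have [[[e1 e2] e3] e4] := (dotC xs x, dotC y x, dotC z x, dotC z y).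
have [[e5 e6] e7] := (dotC y xs, dotC y g1, dotC y g2).
have [[e8 e9] e10] := (dotC z g1, dotC z g2, dotC g2 g1).
rewrite ?e1 ?e2 ?e3 ?e4 ?e5 ?e6 ?e7 ?e8 ?e9 ?e10; lra.
Qed.

(** Pseudo-monotonicity makes [dot (T z) (z - xs)] nonnegative, so only the noise part of [g2] stays
    in the cross term. In the application [g1] and [gz] are the first sample's operator at [x] and
    [z], which the line search compares, and [g2] is the second sample's operator at [z]. *)
Lemma extragradient_descent (T : 'rV[R]_d -> 'rV[R]_d) x xs g1 gz g2 (al lam : R) :
  pseudo_monotone X T -> X x -> solutions X T xs ->
  0 < al <= 1 -> 0 < lam -> 6 * lam ^+ 2 <= 1 ->
  let z := proj X (x - al *: g1) in
  al * enorm (gz - g1) <= lam * enorm (z - x) ->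
  enorm (proj X (x - al *: g2) - xs) ^+ 2
    + (1 - 6 * lam ^+ 2) / 2 * (al ^+ 2 * residual X T x ^+ 2) <=
  enorm (x - xs) ^+ 2
    + al ^+ 2 * ((1 - 6 * lam ^+ 2) * enorm (g1 - T x) ^+ 2
                 + 6 * enorm (gz - T z) ^+ 2 + 6 * enorm (g2 - T z) ^+ 2)
    - 2 * al * dot (g2 - T z) (z - xs).
Proof.
move=> Tpm Xx [Xxs xsT] /andP[al0 al1] lam0 lam6 z ls.
have Xz : X z by exact: projX.
have al0' := ltW al0; have lam0' := ltW lam0.
have Tz : 0 <= dot (T z) (z - xs) by apply: Tpm => //; exact: xsT.
have h3 : al ^+ 2 * residual X T x ^+ 2 <=
    2 * enorm (x - z) ^+ 2 + 2 * (al ^+ 2 * enorm (g1 - T x) ^+ 2).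
  have hr := residual_step (T x) Xx (introT andP (conj al0 al1)).
  rewrite -exprMn; apply: (@le_trans _ _ (enorm (x - proj X (x - al *: T x)) ^+ 2)).
    apply: sqr_ler; last exact: hr.
    apply: mulr_ge0; first exact: al0'.
    exact: enorm_ge0.
  have := enormD_sqr (x - z) (z - proj X (x - al *: T x)).
  rewrite subrKA => /le_trans; apply; rewrite lerD2l ler_pM2l//.
  rewrite -exprMn sqr_ler ?enorm_ge0//.
  apply: le_trans (proj_nonexpansive _ _) _.
  rewrite opprB addrC addrA subrK -scalerBr enormZ ger0_norm//.
  by rewrite enorm_sym.
have /= h1 := @extragradient_step x xs g1 g2 al Xxs; rewrite -/z in h1.
(* The split into three costs a factor 3 and leaves [1 - 3 * lam ^+ 2] times [enorm (x - z) ^+ 2].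
   The share [1 - 6 * lam ^+ 2] of it is exchanged for the residual by [h3]; the constants 6 of the
   statement are weaker than the 3 obtained here. *)
have h2 : al ^+ 2 * enorm (g1 - g2) ^+ 2 <= 3 * (lam ^+ 2 * enorm (x - z) ^+ 2)
    + al ^+ 2 * (3 * enorm (gz - T z) ^+ 2 + 3 * enorm (g2 - T z) ^+ 2).
  have := enormD3_sqr (g1 - gz) (gz - T z) (T z - g2).
  rewrite (_ : g1 - gz + (gz - T z) + (T z - g2) = g1 - g2); last first.
    by rewrite !addrA subrK subrK.
  rewrite (enorm_sym (T z) g2) (enorm_sym g1 gz) => h.
  have ls2 : al ^+ 2 * enorm (gz - g1) ^+ 2 <= lam ^+ 2 * enorm (x - z) ^+ 2.
    by rewrite -!exprMn (enorm_sym x z) sqr_ler// mulr_ge0// enorm_ge0.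
  have := ler_wpM2l (sqr_ge0 al) h; lra.
have h4 : 0 <= lam ^+ 2 * enorm (x - z) ^+ 2 by rewrite mulr_ge0 ?sqr_ge0.
have h5 : 0 <= al ^+ 2 * enorm (gz - T z) ^+ 2 by rewrite mulr_ge0 ?sqr_ge0.
have h6 : 0 <= al ^+ 2 * enorm (g2 - T z) ^+ 2 by rewrite mulr_ge0 ?sqr_ge0.
have c0 : 0 <= 1 - 6 * lam ^+ 2 by lra.
have h7 := ler_wpM2l c0 h3.
have h8 : 0 <= al * dot (T z) (z - xs) by rewrite mulr_ge0.
move: h1; have -> : dot g2 (z - xs) = dot (g2 - T z) (z - xs) + dot (T z) (z - xs).
  by rewrite -dotDl subrK.
clearbody z; lra.
Qed.

End Projection.

(** * Backtracking line search *)

Section LineSearch.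
Context {R : realType} {d : nat} {dXi : measure_display} {Xi : measurableType dXi}.
Variables (X : set 'rV[R]_d) (F : Xi -> 'rV[R]_d -> 'rV[R]_d).
Hypotheses (X0 : X !=set0) (Xcl : closed X).
Variables (ah theta lam : R).
Hypotheses (ah0 : 0 < ah) (theta01 : 0 < theta < 1) (lam0 : 0 < lam).

Definition accepts (M : nat) (s : 'I_M -> Xi) (x : 'rV[R]_d) (al : R) : Prop :=
  al * enorm (emp_op F s (trial_point X F s x al) - emp_op F s x) <=
  lam * enorm (trial_point X F s x al - x).

(** Any step with [al * L <= lam] is accepted, so the search ends, and the smallest accepted
    exponent gives the supremum. If it is 0, the step is [ah] and [1 <= L] gives the bound;
    otherwise the preceding larger step was rejected and hence exceeds [lam / L], and shrinking it
    costs the factor [theta]. *)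
Lemma line_searchP (M : nat) (s : 'I_M -> Xi) (x : 'rV[R]_d) (L : R) :
  X x -> 1 <= L ->
  (forall y y', X y -> X y' ->
     enorm (emp_op F s y - emp_op F s y') <= L * enorm (y - y')) ->
  let al := line_search X F ah theta lam s x in
  [/\ exists l, al = theta ^+ l * ah, accepts s x al &
      Num.min (lam * theta) ah <= al * L].
Proof.
move=> Xx L1 FL al; have /andP[th0 th1] := theta01.
have L0 : 0 < L by exact: lt_le_trans L1.
pose acc l := `[< accepts s x (theta ^+ l * ah) >].
have accL l : theta ^+ l * ah * L <= lam -> acc l.
  move=> h; apply/asboolP; rewrite /accepts.
  set z := trial_point _ _ _ _ _.
  apply: (@le_trans _ _ (theta ^+ l * ah * L * enorm (z - x))).
    rewrite -[leRHS]mulrA ler_pM2l ?mulr_gt0 ?exprn_gt0//.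
    by apply: FL => //; exact: projX.
  by rewrite ler_wpM2r// enorm_ge0.
have exacc : exists l, acc l.
  have : theta ^+ n @[n --> \oo] --> 0.
    by apply: cvg_expr; rewrite gtr0_norm.
  move=> /cvgrPdist_lt/(_ (lam / (ah * L))).
  rewrite divr_gt0 ?mulr_gt0// => /(_ isT) [l _ /(_ l (leqnn l))] /=.
  rewrite sub0r normrN gtr0_norm ?exprn_gt0// ltr_pdivlMr ?mulr_gt0// mulrA.
  by move=> /ltW h; exists l; exact: accL.
have [l accl lmin] := ex_minnP exacc.
have alE : al = theta ^+ l * ah.
  rewrite /al /line_search; set S := [set _ | _].
  have Sl : S (theta ^+ l * ah) by exists l => //; exact/asboolP.
  have ub : ubound S (theta ^+ l * ah).
    move=> _ [k -> /asboolP hk]; rewrite ler_pM2r//.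
    by rewrite ler_wiXn2l ?lmin// ltW.
  apply/le_anti/andP; split; first by apply: ge_sup => //; exists (theta ^+ l * ah).
  by apply: ub_le_sup => //; exists (theta ^+ l * ah).
split; [by exists l | by rewrite alE; apply/asboolP |].
rewrite alE; case: l accl lmin {alE} => [|l] _ lmin.
  rewrite expr0 mul1r ge_min; apply/orP; right.
  by rewrite ler_peMr// ltW.
rewrite ge_min; apply/orP; left.
have : ~~ acc l by apply/negP => /lmin; rewrite ltnn.
move=> nacc; have : lam < theta ^+ l * ah * L.
  by rewrite ltNge; apply: contra nacc; exact: accL.
by move=> /ltW h; rewrite exprS; have := ler_wpM2l (ltW th0) h; lra.
Qed.

End LineSearch.

(** * Measurability *)

Section VectorMeasurability.
Context {R : realType} {dT : measure_display} {T : measurableType dT}.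

Definition vmeas {d : nat} (f : T -> 'rV[R]_d) : Prop :=
  forall i, measurable_fun setT (fun t => f t 0 i).

Lemma measurable_borel_continuous {d : nat} (g : 'rV[R]_d -> R) :
  continuous g -> measurable_fun setT (g : borelV R d -> R).
Proof.
move=> cg; apply: (measurability _ (RGenOInfty.measurableE R)).
move=> _ [_ [a ->] <-]; rewrite setTI; apply: sub_sigma_algebra.
by apply: open_comp; [move=> x _; exact: cg | exact: interval_open].
Qed.

(** An open set is the countable union of the boxes inside it that have a rational centre and the
    inverse of a positive integer as radius; the preimage of a box is a finite intersection of
    coordinate preimages. *)
Lemma vmeas_borel {d : nat} (f : T -> 'rV[R]_d) :
  vmeas f -> measurable_fun setT (f : T -> borelV R d).
Proof.
move=> mf; apply: (@measurability _ _ _ (borelV R d) _ _ (@open 'rV[R]_d)) => //.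
move=> _ [U oU <-]; rewrite setTI.
pose box (c : 'rV[rat]_d * nat) :=
  [set y : 'rV[R]_d | forall i, `|y 0 i - ratr (c.1 0 i)| < c.2.+1%:R^-1].
pose B n := if @unpickle ('rV[rat]_d * nat)%type n is Some c then
  (if `[< box c `<=` U >] then f @^-1` box c else set0) else set0.
have -> : f @^-1` U = \bigcup_n B n.
  apply/seteqP; split => t /=; last first.
    move=> [n _]; rewrite /B; case: unpickle => // c; case: asboolP => // cU.
    exact: cU.
  move=> Uft; have : nbhs (f t) U by exact: open_nbhs_nbhs.
  move=> /nbhs_ballP[e /= e0 eU].
  have [n hn] : exists n : nat, n.+1%:R^-1 < e / 2.
    have /ltr_add_invr[n] : 0 < e / 2 by rewrite divr_gt0.
    by rewrite add0r => h; exists n.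
  have n0 : 0 < n.+1%:R^-1 :> R by rewrite invr_gt0.
  have hq i : exists q : rat, `|f t 0 i - ratr q| < n.+1%:R^-1.
    have [q] := @rat_in_itvoo R (f t 0 i - n.+1%:R^-1) (f t 0 i + n.+1%:R^-1)
      (ltac:(by rewrite ltrBlDr -addrA ltrDl addr_gt0)).
    rewrite in_itv/= => /andP[]; move: (n.+1%:R^-1 : R) => e1 q1 q2.
    by exists q; rewrite ltr_norml; apply/andP; split; lra.
  pose q : 'rV[rat]_d := \row_i projT1 (cid (hq i)).
  exists (pickle (q, n)) => //; rewrite /B pickleK.
  have qn : box (q, n) (f t).
    by move=> i /=; rewrite /q mxE; exact: projT2 (cid (hq i)).
  case: asboolP => // h; exfalso; apply: h => y hy; apply: eU.
  rewrite -ball_normE /=.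
  apply: (@le_lt_trans _ _ (n.+1%:R^-1 + n.+1%:R^-1)); last first.
    by rewrite [ltRHS]splitr ltrD.
  rewrite /Num.norm/= mx_normrE; apply: bigmax_le; first by rewrite addr_ge0// ltW.
  move=> [i j] _ /=; rewrite ord1 !mxE.
  apply: le_trans (ler_distD (ratr (q 0 j)) _ _) _.
  by apply: lerD; [exact: ltW (qn j) | rewrite distrC; exact: ltW (hy j)].
apply: bigcupT_measurable => n; rewrite /B; case: unpickle => // -[q m].
case: asboolP => // _.
have -> : f @^-1` box (q, m) =
    \bigcap_(i in [set: 'I_d]) ((fun t => f t 0 i) @^-1` ball (ratr (q 0 i) : R) m.+1%:R^-1).
  apply/seteqP; split => t h i => [_|]; rewrite -?ball_normE/=.
    by rewrite distrC; exact: h.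
  by have := h i I; rewrite -ball_normE/= distrC.
apply: fin_bigcap_measurable => // i _.
by rewrite -[X in measurable X]setTI; apply: mf => //; exact: measurable_ball.
Qed.

Lemma vmeas_continuous {d : nat} (g : 'rV[R]_d -> R) (f : T -> 'rV[R]_d) :
  continuous g -> vmeas f -> measurable_fun setT (g \o f).
Proof.
move=> cg mf; apply: (@measurableT_comp _ _ _ _ (borelV R d) _ g).
  exact: measurable_borel_continuous.
exact: vmeas_borel.
Qed.

Lemma vmeas_lipschitz {d d' : nat} (g : 'rV[R]_d -> 'rV[R]_d') (K : R)
    (f : T -> 'rV[R]_d) :
  (forall x y, enorm (g x - g y) <= K * enorm (x - y)) -> vmeas f ->
  vmeas (g \o f).
Proof.
move=> gK mf i; apply: (@vmeas_continuous _ (fun x => g x 0 i)) => //.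
exact: lipschitz_continuous gK i.
Qed.

Context {d : nat}.
Implicit Types (f g : T -> 'rV[R]_d).

Lemma vmeas_cst (x : 'rV[R]_d) : vmeas (fun=> x).
Proof. by move=> i; exact: measurable_cst. Qed.

Lemma vmeasD f g : vmeas f -> vmeas g -> vmeas (fun t => f t + g t).
Proof.
move=> mf mg i; under [X in measurable_fun _ X]funext do rewrite mxE.
exact: measurable_funD.
Qed.

Lemma vmeasZ (a : T -> R) f : measurable_fun setT a -> vmeas f ->
  vmeas (fun t => a t *: f t).
Proof.
move=> ma mf i; under [X in measurable_fun _ X]funext do rewrite mxE.
exact: measurable_funM.
Qed.

Lemma vmeasN f : vmeas f -> vmeas (fun t => - f t).
Proof.
move=> mf i; under [X in measurable_fun _ X]funext do rewrite mxE.
exact: measurable_funN.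
Qed.

Lemma vmeasB f g : vmeas f -> vmeas g -> vmeas (fun t => f t - g t).
Proof. by move=> mf mg; apply: vmeasD => //; exact: vmeasN. Qed.

Lemma vmeas_sum (I : Type) (s : seq I) (f : I -> T -> 'rV[R]_d) :
  (forall i, vmeas (f i)) -> vmeas (fun t => \sum_(i <- s) f i t).
Proof.
move=> mf i; under [X in measurable_fun _ X]funext do rewrite summxE.
by apply: measurable_sum => j; exact: mf.
Qed.

Lemma measurable_dot f g : vmeas f -> vmeas g ->
  measurable_fun setT (fun t => dot (f t) (g t)).
Proof.
by move=> mf mg; apply: measurable_sum => i; exact: measurable_funM.
Qed.

Lemma measurable_enorm f : vmeas f -> measurable_fun setT (fun t => enorm (f t)).
Proof.
move=> mf; have h : measurable_fun setT (Num.sqrt : R -> R).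
  by apply: continuous_measurable_fun; exact: sqrt_continuous.
exact: (measurableT_comp h (measurable_dot mf mf)).
Qed.

End VectorMeasurability.

Section OperatorMeasurability.
Context {R : realType} {d : nat} {dXi : measure_display} {Xi : measurableType dXi}.
Variables (X : set 'rV[R]_d) (F : Xi -> 'rV[R]_d -> 'rV[R]_d).
Hypotheses (X0 : X !=set0) (Xcl : closed X) (Xcvx : convex_set X).
Hypothesis (mF : random_operator X F).

Lemma closed_borel : measurable (X : set (borelV R d)).
Proof.
rewrite -(setCK X); apply: measurableC; apply: sub_sigma_algebra.
exact: closed_openC.
Qed.

Context {dT : measure_display} {T : measurableType dT}.

Lemma vmeas_op (s : T -> Xi) (x : T -> 'rV[R]_d) :
  measurable_fun setT s -> vmeas x -> (forall t, X (x t)) ->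
  vmeas (fun t => F (s t) (x t)).
Proof.
move=> ms mx Xx i.
have h : measurable_fun setT (fun t => F (s t) (x t) : borelV R d).
  pose Fp (p : Xi * borelV R d) : borelV R d := F p.1 p.2.
  pose g t : Xi * borelV R d := (s t, x t).
  change (measurable_fun setT (Fp \o g)).
  apply: (measurable_comp (F := (setT `*` X : set (Xi * borelV R d)%type))) => //.
  - by apply: measurableX => //; exact: closed_borel.
  - by move=> _ [t _ <-]; split => //=.
  - by apply/measurable_fun_pairP; split=> //; exact: vmeas_borel.
apply: (@measurableT_comp _ _ _ _ (borelV R d) _ (fun v => v 0 i)) => //.
apply: measurable_borel_continuous.
by apply: (@lipschitz_continuous _ _ _ id 1 _) => u v; rewrite mul1r.
Qed.

Lemma vmeas_proj (x : T -> 'rV[R]_d) : vmeas x -> vmeas (fun t => proj X (x t)).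
Proof.
move=> mx; apply: (@vmeas_lipschitz _ _ _ _ _ (proj X) 1) => // u v.
by rewrite mul1r; exact: proj_nonexpansive.
Qed.

Lemma vmeas_emp_op M (s : 'I_M -> T -> Xi) (x : T -> 'rV[R]_d) :
  (forall j, measurable_fun setT (s j)) -> vmeas x -> (forall t, X (x t)) ->
  vmeas (fun t => emp_op F (fun j => s j t) (x t)).
Proof.
move=> ms mx Xx; apply: vmeasZ; first exact: measurable_cst.
by apply: vmeas_sum => j; exact: vmeas_op.
Qed.

Lemma vmeas_trial_point M (s : 'I_M -> T -> Xi) (x : T -> 'rV[R]_d) (al : T -> R) :
  (forall j, measurable_fun setT (s j)) -> vmeas x -> (forall t, X (x t)) ->
  measurable_fun setT al ->
  vmeas (fun t => trial_point X F (fun j => s j t) (x t) (al t)).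
Proof.
move=> ms mx Xx mal; apply: vmeas_proj; apply: vmeasB => //.
by apply: vmeasZ => //; exact: vmeas_emp_op.
Qed.

Lemma measurable_line_search M (s : 'I_M -> T -> Xi) (x : T -> 'rV[R]_d)
    (ah theta lam : R) :
  0 < ah -> 0 < theta < 1 ->
  (forall j, measurable_fun setT (s j)) -> vmeas x -> (forall t, X (x t)) ->
  measurable_fun setT (fun t => line_search X F ah theta lam (fun j => s j t) (x t)).
Proof.
move=> ah0 /andP[th0 th1] ms mx Xx.
pose lhs l t := theta ^+ l * ah * enorm (emp_op F (fun j => s j t)
  (trial_point X F (fun j => s j t) (x t) (theta ^+ l * ah)) - emp_op F (fun j => s j t) (x t)).
pose rhs l t := lam * enorm (trial_point X F (fun j => s j t) (x t) (theta ^+ l * ah) - x t).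
have macc l : measurable_fun setT (fun t => lhs l t <= rhs l t).
  have mz : vmeas (fun t => trial_point X F (fun j => s j t) (x t) (theta ^+ l * ah)).
    by apply: vmeas_trial_point => //; exact: measurable_cst.
  apply: measurable_fun_ler; apply: measurable_funM; try exact: measurable_cst.
  - apply: measurable_enorm; apply: vmeasB; last exact: vmeas_emp_op.
    by apply: vmeas_emp_op => // t; exact: projX.
  - by apply: measurable_enorm; exact: vmeasB.
(* A rejected step contributes 0, so the random set of accepted steps becomes a countable family
   over all [l]. Since [sup set0] is 0, the value agrees also where no step is accepted. *)
pose g l t := if lhs l t <= rhs l t then theta ^+ l * ah else 0.
have mg l : measurable_fun setT (g l).
  by apply: measurable_fun_ifT => //; exact: measurable_cst.
have g0 l t : 0 <= g l t.
  by rewrite /g; case: ifP => // _; rewrite mulr_ge0 ?exprn_ge0 ?ltW.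
have gah l t : g l t <= ah.
  rewrite /g; case: ifP => _; last exact: ltW.
  by rewrite ger_pMl// exprn_ile1 ?ltW.
have bg t : has_ubound (range (g ^~ t)) by exists ah => _ [l _ <-].
have -> : (fun t => line_search X F ah theta lam (fun j => s j t) (x t)) =
    (fun t => sups (g ^~ t) 0).
  apply/funext => t; rewrite /line_search /sups /sdrop.
  set S := [set _ | _]; set G := (X in _ = sup X).
  have GE : G = range (g ^~ t) by apply/seteqP; split => y [l _ <-]; exists l.
  have Gub : has_ubound G by rewrite GE.
  have G0 : G !=set0 by exists (g 0 t); exists 0.
  have SG : S `<=` G.
    by move=> _ [l -> h]; exists l => //; rewrite /g ifT.
  case: (eqVneq S set0) => [S0|/set0P Sn]; last first.
    apply/le_anti/andP; split.
      by apply: le_sup => // y Sy; exists y; split => //; exact: SG.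
    apply: ge_sup => // _ [l _ <-]; rewrite /g; case: ifPn => h.
      apply: ub_le_sup; last by exists l.
      case: Gub => M' hM'; exists M' => y /SG; exact: hM'.
    case: Sn => y Sy; apply: (@le_trans _ _ y).
      by case: Sy => l' -> _; rewrite mulr_ge0 ?exprn_ge0 ?ltW.
    apply: ub_le_sup => //.
    case: Gub => M' hM'; exists M' => y' /SG; exact: hM'.
  rewrite S0 sup0; have -> : G = [set 0]; last by rewrite sup1.
  apply/seteqP; split => [_ [l _ <-]|_ ->].
    rewrite /g/=; case: ifPn => // h; exfalso.
    have : S (theta ^+ l * ah) by exists l.
    by rewrite S0.
  exists 0 => //; rewrite /g; case: ifPn => // h; exfalso.
  have : S (theta ^+ 0 * ah) by exists 0.
  by rewrite S0.
by apply: measurable_fun_sups => // t _; exact: bg.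
Qed.

End OperatorMeasurability.

(** * Independence *)

Section Independence.
Context {R : realType} {dW : measure_display} {W : measurableType dW}.
Variable Pr : probability W R.

Definition indep_systems (G1 G2 : set (set W)) : Prop :=
  forall A B, G1 A -> G2 B -> Pr (A `&` B) = (Pr A * Pr B)%E.

Lemma indep_systems_sym G1 G2 : indep_systems G1 G2 -> indep_systems G2 G1.
Proof. by move=> h A B GA GB; rewrite setIC h// muleC. Qed.

(** For a fixed [A] the events satisfying the product formula form a lambda-system, and [G2] is a
    pi-system, so Dynkin's theorem applies. *)
Lemma indep_systems_gen_r (G1 G2 : set (set W)) :
  G1 `<=` measurable -> G2 `<=` measurable -> setI_closed G2 ->
  indep_systems G1 G2 -> indep_systems G1 <<s G2>>.
Proof.
move=> mG1 mG2 IG2 ind A B GA; have mA := mG1 _ GA.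
pose H := [set B : set W | measurable B /\ Pr (A `&` B) = (Pr A * Pr B)%E].
suff : <<s G2>> `<=` H by move=> h GB; have [] := h _ GB.
apply: (@lambda_system_subset _ G2 IG2 setT H) => //; last first.
  by move=> C GC; split; [exact: mG2 | exact: ind].
apply/dynkin_lambda_system; split.
- by split => //; rewrite setIT probability_setT mule1.
- move=> C [mC hC]; split; first exact: measurableC.
  have fA : Pr A \is a fin_num by exact: fin_num_measure.
  have fC : Pr C \is a fin_num by exact: fin_num_measure.
  transitivity (Pr A - Pr (A `&` C))%E.
    by rewrite -setDE; apply: measureD => //; rewrite ltey_eq fin_num_measure.
  rewrite hC -setTD.
  have -> : Pr (setT `\` C) = (1 - Pr C)%E.
    rewrite -(probability_setT Pr) -[in X in (_ - X)%E](setTI C).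
    by apply: measureD => //; rewrite ltey_eq fin_num_measure.
  by rewrite muleBr ?mule1// fin_num_adde_defl.
- move=> F tF hF; split; first by apply: bigcupT_measurable => n; have [] := hF n.
  rewrite setI_bigcupr measure_bigcup//; last 2 first.
  + by move=> n _; apply: measurableI => //; have [] := hF n.
  + exact: trivIset_setIl.
  rewrite measure_bigcup//; last by move=> n _; have [] := hF n.
  have fA : Pr A \is a fin_num by exact: fin_num_measure.
  rewrite -(fineK fA) -nneseriesZl//; apply: eq_eseriesr => n _.
  by rewrite fineK//; have [] := hF n.
Qed.

Lemma indep_systems_gen (G1 G2 : set (set W)) :
  G1 `<=` measurable -> G2 `<=` measurable ->
  setI_closed G1 -> setI_closed G2 ->
  indep_systems G1 G2 -> indep_systems <<s G1>> <<s G2>>.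
Proof.
move=> mG1 mG2 IG1 IG2 ind.
have sG2 : <<s G2>> `<=` measurable.
  by apply: smallest_sub => //; exact: sigma_algebra_measurable.
apply: indep_systems_sym; apply: indep_systems_gen_r => //.
by apply: indep_systems_sym; exact: indep_systems_gen_r.
Qed.

Section Freeze.
Variables (G1 G2 : set (set W)).
Hypotheses (mG1 : G1 `<=` measurable) (mG2 : G2 `<=` measurable).
Hypothesis ind : indep_systems <<s G1>> <<s G2>>.

Let W1 := g_sigma_algebraType G1.
Let W2 := g_sigma_algebraType G2.

Lemma measurable_id_sigma (G : set (set W)) : G `<=` measurable ->
  measurable_fun setT (id : W -> g_sigma_algebraType G).
Proof.
move=> mG _ B mB; rewrite setTI preimage_id.
have : <<s G>> `<=` measurable by apply: smallest_sub => //; exact: sigma_algebra_measurable.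
exact.
Qed.

(** The factors of the product space are two copies of [W] with smaller sigma-algebras, so a
    function of past and present is a function on the product, read on the diagonal. Independence
    says that the diagonal map has as its law the product of the laws of [id1] and [id2]; Tonelli
    then gives the iterated integral. *)
Let id1 : {mfun W >-> W1} :=
  HB.pack (id : W -> W1) (isMeasurableFun.Build _ _ _ _ _ (measurable_id_sigma mG1)).
Let id2 : {mfun W >-> W2} :=
  HB.pack (id : W -> W2) (isMeasurableFun.Build _ _ _ _ _ (measurable_id_sigma mG2)).

Let measurable_diag : measurable_fun setT (fun w : W => (w : W1, w : W2)).
Proof.
by apply/measurable_fun_pairP; split; [exact: measurable_id_sigma mG1 | exact: measurable_id_sigma mG2].
Qed.

Let diag : {mfun W >-> (W1 * W2)%type} :=
  HB.pack (fun w : W => (w : W1, w : W2)) (isMeasurableFun.Build _ _ _ _ _ measurable_diag).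

Variable f : W1 * W2 -> \bar R.
Hypotheses (mf : measurable_fun setT f) (f0 : forall p, (0 <= f p)%E).

Let m1 := distribution Pr id1.
Let m2 := distribution Pr id2.

Let inner_eq w1 : (\int[m2]_w2 f (w1, w2) = \int[Pr]_w2 f (w1, w2))%E.
Proof.
rewrite ge0_integral_distribution//.
by apply: measurableT_comp => //; exact: measurable_pair1.
Qed.

Lemma measurable_indep_section :
  measurable_fun setT (fun w1 : W1 => (\int[Pr]_w2 f (w1, w2))%E).
Proof.
rewrite (_ : (fun _ => _) = fun w1 => (\int[m2]_w2 f (w1, w2))%E).
  exact: measurable_fun_fubini_tonelli_F.
by apply/funext => w1; rewrite inner_eq.
Qed.

Lemma integral_indep :
  (\int[Pr]_w f (w, w) = \int[Pr]_w1 \int[Pr]_w2 f (w1, w2))%E.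
Proof.
transitivity (\int[distribution Pr diag]_p f p)%E.
  by rewrite ge0_integral_distribution.
transitivity (\int[m1 \x m2]_p f p)%E.
  apply: eq_measure_integral => A mA _; apply/esym/product_measure_unique => //.
rewrite fubini_tonelli1// ge0_integral_distribution//.
- by apply: eq_integral => w _; exact: inner_eq.
- exact: measurable_fun_fubini_tonelli_F.
- by move=> w; exact: integral_ge0.
Qed.

End Freeze.

Section Draws.
Context {dXi : measure_display} {Xi : measurableType dXi} {I : eqType}.
Variable Y : I -> W -> Xi.
Hypotheses (mY : forall i, measurable_fun setT (Y i)) (iY : independent_family Pr Y).

Definition draw_events (S : set I) : set (set W) :=
  [set A | exists i B, [/\ S i, measurable B & A = Y i @^-1` B]].

(** The events of single draws are not closed under intersection. Their finite intersections form a
    pi-system, and its sigma-algebra contains theirs. *)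
Let cylinders (S : set I) : set (set W) :=
  [set A | exists s B, [/\ uniq s, forall i, i \in s -> S i,
     forall i, measurable (B i) & A = \bigcap_(i in [set i | i \in s]) Y i @^-1` B i]].

Lemma measurable_draw i B : measurable B -> measurable (Y i @^-1` B).
Proof. by move=> mB; rewrite -[X in measurable X]setTI; exact: mY. Qed.

Lemma draw_events_measurable S : draw_events S `<=` measurable.
Proof. by move=> _ [i [B [_ mB ->]]]; exact: measurable_draw. Qed.

Let cylinders_measurable S : cylinders S `<=` measurable.
Proof.
move=> _ [s [B [_ _ mB ->]]]; apply: fin_bigcap_measurable => //.
by move=> i _; exact: measurable_draw.
Qed.

Let cylinders_setI S : setI_closed (cylinders S).
Proof.
move=> _ _ [s1 [B1 [u1 S1 m1 ->]]] [s2 [B2 [u2 S2 m2 ->]]].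
exists (undup (s1 ++ s2)), (fun i => (if i \in s1 then B1 i else setT) `&`
  (if i \in s2 then B2 i else setT)); split.
- exact: undup_uniq.
- by move=> i; rewrite mem_undup mem_cat => /orP[/S1|/S2].
- by move=> i; apply: measurableI; case: ifP.
- apply/seteqP; split => w.
    move=> [h1 h2] i /=; rewrite mem_undup mem_cat => _; split; case: ifP => // h.
      exact: h1.
    exact: h2.
  move=> h; split => i /= si.
    by have := h i; rewrite /= mem_undup mem_cat si => /(_ isT)[].
  by have := h i; rewrite /= mem_undup mem_cat si orbT => /(_ isT)[].
Qed.

Let draw_sub_cylinders S : draw_events S `<=` cylinders S.
Proof.
move=> _ [i [B [Si mB ->]]]; exists [:: i], (fun=> B); split=> //.
  by move=> j; rewrite inE => /eqP ->.
apply/seteqP; split => [w h j|w h] /=; first by rewrite inE => /eqP ->.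
by apply: (h i); rewrite /= inE.
Qed.

Lemma indep_draws (S1 S2 : set I) : S1 `&` S2 = set0 ->
  indep_systems <<s draw_events S1>> <<s draw_events S2>>.
Proof.
move=> S12.
have sub S : <<s draw_events S>> `<=` <<s cylinders S>>.
  apply: smallest_sub; first exact: smallest_sigma_algebra.
  by move=> A /draw_sub_cylinders; exact: sub_sigma_algebra.
move=> A B /sub hA /sub hB; move: A B hA hB; apply: indep_systems_gen => //.
move=> _ _ [s1 [B1 [u1 h1 m1 ->]]] [s2 [B2 [u2 h2 m2 ->]]].
have dis i : i \in s1 -> i \in s2 -> False.
  move=> /h1 a /h2 b; have : (S1 `&` S2) i by split.
  by rewrite S12.
(* The two cylinders use disjoint draws, so they merge into one family of events; the product
   formula is applied to each of them and to their intersection. *)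
pose B i := if i \in s1 then B1 i else B2 i.
have mB i : measurable (B i) by rewrite /B; case: ifP.
have B1E : \bigcap_(i in [set i | i \in s1]) Y i @^-1` B1 i =
           \bigcap_(i in [set i | i \in s1]) Y i @^-1` B i.
  by apply: eq_bigcapr => i /= si; rewrite /B si.
have B2E : \bigcap_(i in [set i | i \in s2]) Y i @^-1` B2 i =
           \bigcap_(i in [set i | i \in s2]) Y i @^-1` B i.
  apply: eq_bigcapr => i /= si; rewrite /B; case: ifPn => // si1.
  by case: (dis i).
rewrite B1E B2E !iY// -big_cat/= -iY//; last first.
  rewrite cat_uniq u1 u2 andbT; apply/hasPn => i si2; apply/negP => si1.
  exact: dis si1 si2.
congr (Pr _); apply/seteqP; split => w.
  by move=> [a b] i /=; rewrite mem_cat => /orP[/a|/b].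
move=> h; split=> i /= si; apply: h; rewrite /= mem_cat si//.
by rewrite orbT.
Qed.

Lemma measurable_draw_sigma (S : set I) i : S i ->
  measurable_fun setT (Y i : g_sigma_algebraType (draw_events S) -> Xi).
Proof.
by move=> Si _ B mB; rewrite setTI; apply: sub_sigma_algebra; exists i, B.
Qed.

End Draws.

Lemma iid_sample_inj {dXi : measure_display} {Xi : measurableType dXi}
    (P : probability Xi R) (I J : eqType) (g : J -> I) (Y : I -> W -> Xi) :
  injective g -> iid_sample P Pr Y -> iid_sample P Pr (fun j => Y (g j)).
Proof.
move=> ginj [mY lY iY]; split; [by move=> j; exact: mY | by move=> j; exact: lY |].
move=> t A ut mA.
(* [B] transports [A] along [g]. The default [setT] only keeps it measurable, because the product
   runs over values of [g]. *)
pose B i := if pselect (exists j, g j = i) is left e then A (projT1 (cid e)) else setT.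
have Bg j : B (g j) = A j.
  rewrite /B; case: pselect => [e|ne]; last by exfalso; apply: ne; exists j.
  by congr A; apply: ginj; exact: projT2 (cid e).
have mB i : measurable (B i) by rewrite /B; case: pselect.
have := iY (map g t) B; rewrite map_inj_uniq// big_map => /(_ ut mB).
under eq_bigr do rewrite Bg.
move=> <-; congr (Pr _); apply/seteqP; split => w h i /=.
  by move=> /mapP[j jt ->]; rewrite Bg; exact: h.
by move=> it; rewrite -Bg; apply: (h (g i)); exact: map_f.
Qed.

End Independence.

(** * Moment bounds *)

Section MeanBounds.
Context {R : realType} {dW : measure_display} {W : measurableType dW}.
Variable Pr : probability W R.
Implicit Types (f g : W -> R) (a b c k : R).

(** Measurability and nonnegativity belong to the bound, so the integral makes sense in the extended
    reals, and bounds can be added, scaled and compared without separate integrability arguments. *)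
Definition mean_le f c : Prop :=
  [/\ measurable_fun setT f, forall w, 0 <= f w
    & (\int[Pr]_w (f w)%:E <= c%:E)%E].

Lemma mean_le_ge0 f c : mean_le f c -> 0 <= c.
Proof.
case=> _ f0 fc; rewrite -lee_fin; apply: le_trans fc.
by apply: integral_ge0 => w _; rewrite lee_fin.
Qed.

Lemma mean_le_ae f g b c : mean_le g b -> measurable_fun setT f ->
  (forall w, 0 <= f w) -> (\forall w \ae Pr, f w <= g w) -> b <= c ->
  mean_le f c.
Proof.
move=> [mg g0 gb] mf f0 fg bc; split=> //.
apply: (@le_trans _ _ (\int[Pr]_w (g w)%:E)%E); last first.
  by apply: le_trans gb _; rewrite lee_fin.
apply: ae_ge0_le_integral => //; try exact/measurable_EFinP.
- by move=> w _; rewrite lee_fin.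
- by move=> w _; rewrite lee_fin.
- by apply: filterS fg => w h _; rewrite lee_fin.
Qed.

Lemma mean_leW f g b : mean_le g b -> measurable_fun setT f ->
  (forall w, 0 <= f w) -> (forall w, f w <= g w) -> mean_le f b.
Proof. by move=> gb mf f0 fg; apply: mean_le_ae gb mf f0 _ _ => //; exact: aeW. Qed.

Lemma mean_le_le f b c : mean_le f b -> b <= c -> mean_le f c.
Proof. by move=> [mf f0 fb] bc; split=> //; apply: le_trans fb _; rewrite lee_fin. Qed.

Lemma mean_leD f g a b : mean_le f a -> mean_le g b ->
  mean_le (fun w => f w + g w) (a + b).
Proof.
move=> [mf f0 fa] [mg g0 gb]; split.
- exact: measurable_funD.
- by move=> w; rewrite addr_ge0.
- under eq_integral do rewrite EFinD.
  rewrite ge0_integralD//; try exact/measurable_EFinP.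
  + by rewrite EFinD leeD.
  + by move=> w _; rewrite lee_fin.
  + by move=> w _; rewrite lee_fin.
Qed.

Lemma mean_leZ f c k : 0 <= k -> mean_le f c -> mean_le (fun w => k * f w) (k * c).
Proof.
move=> k0 [mf f0 fc]; split.
- by apply: measurable_funM => //; exact: measurable_cst.
- by move=> w; rewrite mulr_ge0.
- under eq_integral do rewrite EFinM.
  rewrite ge0_integralZl_EFin//; last exact/measurable_EFinP.
    by rewrite EFinM; apply: lee_wpmul2l; rewrite ?lee_fin.
  by move=> w _; rewrite lee_fin.
Qed.

Lemma mean_le_cst c : 0 <= c -> mean_le (fun=> c) c.
Proof.
move=> c0; split=> //; try exact: measurable_cst.
by rewrite integral_cst// [X in (_ * X)%E](_ : _ = 1%E) ?mule1//; exact: probability_setT.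
Qed.

Lemma mean_le_sum (I : Type) (s : seq I) (f : I -> W -> R) (c : I -> R) :
  (forall i, mean_le (f i) (c i)) ->
  mean_le (fun w => \sum_(i <- s) f i w) (\sum_(i <- s) c i).
Proof.
move=> h; elim: s => [|i s IH].
  rewrite big_nil (_ : (fun _ => _) = fun=> 0); first exact: mean_le_cst.
  by apply/funext => w; rewrite big_nil.
rewrite big_cons (_ : (fun _ => _) = fun w => f i w + \sum_(j <- s) f j w).
  exact: mean_leD.
by apply/funext => w; rewrite big_cons.
Qed.

(** The index [l] may depend on [w]: one unknown term of a nonnegative series is at most its sum,
    and the sum is integrated term by term. This handles an accepted step of unknown exponent. *)
Lemma mean_le_series f (g : nat -> W -> R) (c : nat -> R) b :
  measurable_fun setT f -> (forall w, 0 <= f w) ->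
  (forall l, mean_le (g l) (c l)) -> (forall n, \sum_(l < n) c l <= b) ->
  (\forall w \ae Pr, exists l, f w <= g l w) -> mean_le f b.
Proof.
move=> mf f0 gc cb fg; split=> //.
have mg l : measurable_fun setT (EFin \o g l) by have [/measurable_EFinP] := gc l.
have g0 l w : (0 <= (g l w)%:E)%E by have [_ + _] := gc l => /(_ w); rewrite lee_fin.
apply: (@le_trans _ _ (\int[Pr]_w (\sum_(0 <= l <oo) (g l w)%:E))%E).
  apply: ae_ge0_le_integral => //.
  - by move=> w _; rewrite lee_fin.
  - exact/measurable_EFinP.
  - by move=> w _; apply: nneseries_ge0 => l _ _.
  - by apply: ge0_emeasurable_sum => // l _; exact: mg.
  - apply: filterS fg => w [l fl] _.
    apply: (@le_trans _ _ (g l w)%:E); first by rewrite lee_fin.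
    apply: le_trans (nneseries_lim_ge l.+1 _) => //.
    by rewrite big_nat_recr//= leeDr// sume_ge0.
rewrite integral_nneseries//.
apply: lime_le => //; first by apply: is_cvg_nneseries => n _ _; exact: integral_ge0.
apply: nearW => n.
apply: (@le_trans _ _ (\sum_(0 <= l < n) (c l)%:E)%E).
  by apply: lee_sum => l _; have [] := gc l.
by rewrite sumEFin lee_fin big_mkord.
Qed.

(** Cauchy-Schwarz, from the weighted inequality [f g <= (t f^2 + g^2 / t) / 2]. *)
Lemma mean_leM f g a b : 0 <= a -> 0 <= b ->
  measurable_fun setT f -> measurable_fun setT g ->
  (forall w, 0 <= f w) -> (forall w, 0 <= g w) ->
  mean_le (fun w => f w ^+ 2) (a ^+ 2) -> mean_le (fun w => g w ^+ 2) (b ^+ 2) ->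
  mean_le (fun w => f w * g w) (a * b).
Proof.
move=> a0 b0 mf mg f0 g0 fa gb.
have mfg : measurable_fun setT (fun w => f w * g w) by exact: measurable_funM.
have fg0 w : 0 <= f w * g w by rewrite mulr_ge0.
(* The shift by [e] keeps the weight [(b + e) / (a + e)] defined and positive when [a] or [b]
   vanishes. *)
have key e : 0 < e -> mean_le (fun w => f w * g w) ((a + e) * (b + e)).
  move=> e0; have ae0 : 0 < a + e by rewrite ltr_wpDl.
  have be0 : 0 < b + e by rewrite ltr_wpDl.
  set t := (b + e) / (a + e); have t0 : 0 < t by rewrite divr_gt0.
  set u := t^-1; have u0 : 0 < u by rewrite invr_gt0.
  have tu : t * u = 1 by rewrite divff// gt_eqF.
  have half0 : 0 <= 2^-1 :> R by rewrite invr_ge0.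
  have h := mean_leZ half0 (mean_leD (mean_leZ (ltW t0) fa) (mean_leZ (ltW u0) gb)).
  apply: (mean_le_ae h mfg fg0).
    apply: aeW => w; have := mulr_ge0 (ltW u0) (sqr_ge0 (t * f w - g w)).
    have -> : u * (t * f w - g w) ^+ 2 =
        (t * u) * (t * f w ^+ 2) + u * g w ^+ 2 - 2 * (t * u) * (f w * g w) by ring.
    rewrite tu; lra.
  have h1 : t * a ^+ 2 <= (a + e) * (b + e).
    rewrite /t mulrAC ler_pdivrMr//.
    have : 0 <= (b + e) * ((a + e) ^+ 2 - a ^+ 2) by rewrite mulr_ge0 ?(ltW be0)//; nra.
    lra.
  have h2 : u * b ^+ 2 <= (a + e) * (b + e).
    rewrite /u /t invf_div mulrAC ler_pdivrMr//.
    have : 0 <= (a + e) * ((b + e) ^+ 2 - b ^+ 2) by rewrite mulr_ge0 ?(ltW ae0)//; nra.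
    lra.
  lra.
split=> //.
have fin : (\int[Pr]_w (f w * g w)%:E)%E \is a fin_num.
  rewrite ge0_fin_numE; last by apply: integral_ge0 => w _; rewrite lee_fin.
  have [_ _ h] := key 1 ltr01; exact: le_lt_trans h (ltry _).
rewrite -(fineK fin) lee_fin; set c := fine _.
have hc e : 0 < e -> c <= (a + e) * (b + e).
  by move=> /key[_ _]; rewrite -(fineK fin) lee_fin.
rewrite leNgt; apply/negP => abc.
(* With [e <= 1], the excess of [(a + e) * (b + e)] over [a * b] is at most [e * (a + b + 1)], hence
   at most half of the assumed gap. *)
pose e := Num.min 1 ((c - a * b) / (2 * (a + b + 1))).
have D0 : 0 < 2 * (a + b + 1) by rewrite mulr_gt0// ltr_wpDl// addr_ge0.
have e0 : 0 < e by rewrite lt_min ltr01 divr_gt0// subr_gt0.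
have e1 : e <= 1 by rewrite ge_min lexx.
have e2 : e * (2 * (a + b + 1)) <= c - a * b by rewrite -ler_pdivlMr// ge_min lexx orbT.
have := hc e e0; nra.
Qed.

Lemma mean_leD_sqr f g a b : 0 <= a -> 0 <= b ->
  measurable_fun setT f -> measurable_fun setT g ->
  (forall w, 0 <= f w) -> (forall w, 0 <= g w) ->
  mean_le (fun w => f w ^+ 2) (a ^+ 2) -> mean_le (fun w => g w ^+ 2) (b ^+ 2) ->
  mean_le (fun w => (f w + g w) ^+ 2) ((a + b) ^+ 2).
Proof.
move=> a0 b0 mf mg f0 g0 fa gb.
have h := mean_leD (mean_leD fa (mean_leZ (ler0n _ 2) (mean_leM a0 b0 mf mg f0 g0 fa gb))) gb.
have -> : (a + b) ^+ 2 = a ^+ 2 + 2 * (a * b) + b ^+ 2 by ring.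
rewrite (_ : (fun _ => _) = fun w => f w ^+ 2 + 2 * (f w * g w) + g w ^+ 2) //.
by apply/funext => w; ring.
Qed.

Lemma mean_le_root f a : 0 <= a -> measurable_fun setT f -> (forall w, 0 <= f w) ->
  mean_le (fun w => f w ^+ 2) (a ^+ 2) -> mean_le f a.
Proof.
move=> a0 mf f0 fa.
have h1 : mean_le (fun=> 1 ^+ 2) (1 ^+ 2) by rewrite expr1n; exact: (mean_le_cst ler01).
have := mean_leM a0 ler01 mf (measurable_cst (1 : R)) f0 (fun=> ler01) fa h1.
by rewrite mulr1; under eq_fun do rewrite mulr1.
Qed.

Lemma mean_le_integrable f c g : measurable_fun setT g ->
  (forall w, `|g w| <= f w) -> mean_le f c -> Pr.-integrable setT (EFin \o g).
Proof.
move=> mg gf [mf f0 fc]; apply/integrableP; split; first exact/measurable_EFinP.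
apply: le_lt_trans (ltry c); apply: le_trans fc.
apply: ge0_le_integral => //=.
- by apply/measurable_EFinP; apply: measurableT_comp.
- exact/measurable_EFinP.
- by move=> w _; rewrite lee_fin.
Qed.

(** The term [k * y w] may have either sign, but its mean is zero and it disappears from the bound.
    Cross terms with centred noise are removed in this way. *)
Lemma mean_le_centered f g y b k : measurable_fun setT f -> (forall w, 0 <= f w) ->
  Pr.-integrable setT (EFin \o y) -> (\int[Pr]_w (y w)%:E = 0)%E ->
  mean_le g b -> (forall w, f w <= k * y w + g w) -> mean_le f b.
Proof.
move=> mf f0 iy y0 gb fyg; split=> //; have [mg g0 gb'] := gb.
have ig : Pr.-integrable setT (EFin \o g).
  by apply: (mean_le_integrable mg _ gb) => w; rewrite ger0_norm.
have iky : Pr.-integrable setT (fun w => (k%:E * (y w)%:E)%E) by exact: integrableZl.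
apply: le_trans gb'; rewrite -[leRHS]add0e -(mule0 k%:E) -y0 -integralZl//.
rewrite -integralD//; apply: ge0_le_integral => //.
- by move=> w _; rewrite lee_fin.
- exact/measurable_EFinP.
- by have /measurable_int := integrableD measurableT iky ig.
- by move=> w _; rewrite /= -EFinM -EFinD lee_fin.
Qed.

Lemma mean_leB_cst g c k : measurable_fun setT g -> (forall w, 0 <= g w) -> 0 <= k ->
  mean_le (fun w => g w + k) (c + k) -> mean_le g c.
Proof.
move=> mg g0 k0 [_ _ h]; split=> //; move: h.
under eq_integral do rewrite EFinD.
rewrite ge0_integralD//; last 2 first.
- by move=> w _; rewrite lee_fin.
- exact/measurable_EFinP.
have -> : (\int[Pr]_w k%:E = k%:E)%E.
  by rewrite integral_cst// [X in (_ * X)%E](_ : _ = 1%E) ?mule1//; exact: probability_setT.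
by rewrite EFinD leeD2rE.
Qed.

End MeanBounds.

Section IndependentMeans.
Context {R : realType} {dW : measure_display} {W : measurableType dW}.
Variable Pr : probability W R.

Lemma mean_le_indep (G1 G2 : set (set W)) :
  G1 `<=` measurable -> G2 `<=` measurable ->
  indep_systems Pr <<s G1>> <<s G2>> ->
  forall (f : g_sigma_algebraType G1 * g_sigma_algebraType G2 -> R) (h : W -> R) (c : R),
  measurable_fun setT f -> (forall p, 0 <= f p) -> mean_le Pr h c ->
  {ae Pr, forall w1 : W, mean_le Pr (fun w2 => f (w1, w2)) (h w1)} ->
  mean_le Pr (fun w => f (w, w)) c.
Proof.
move=> mG1 mG2 ind f h c mf f0 [mh h0 hc] fh.
have mdiag : measurable_fun setT
    (fun w : W => (w : g_sigma_algebraType G1, w : g_sigma_algebraType G2)).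
  by apply/measurable_fun_pairP; split; exact: measurable_id_sigma.
split => //; first exact: (measurableT_comp mf mdiag).
have mEf : measurable_fun setT (EFin \o f) by exact/measurable_EFinP.
rewrite (@integral_indep _ _ _ Pr _ _ mG1 mG2 ind (EFin \o f))//.
apply: le_trans hc; apply: ae_ge0_le_integral => //.
- by move=> w _; apply: integral_ge0 => w2 _; rewrite lee_fin.
- have := @measurable_indep_section _ _ _ Pr _ _ mG2 (EFin \o f) mEf (fun p => f0 p).
  move=> ms; exact: (measurableT_comp ms (measurable_id_sigma mG1)).
- by move=> w _; rewrite lee_fin.
- exact/measurable_EFinP.
- by apply: filterS fh => w [_ _ hw] _.
Qed.

Context {dXi : measure_display} {Xi : measurableType dXi} {I : eqType}.
Variables (P : probability Xi R) (Y : I -> W -> Xi).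
Hypothesis iidY : iid_sample P Pr Y.

Let mY i : measurable_fun setT (Y i). Proof. by have [] := iidY. Qed.
Let lY i B : measurable B -> Pr (Y i @^-1` B) = P B.
Proof. by have [_ + _] := iidY; exact. Qed.

Lemma ae_law (A : Xi -> Prop) i : (\forall s \ae P, A s) -> \forall w \ae Pr, A (Y i w).
Proof.
move=> [N [mN PN AN]]; exists (Y i @^-1` N); split.
- exact: measurable_draw.
- by rewrite lY.
- by move=> w /= h; exact: AN.
Qed.

Lemma mean_le_law (g : Xi -> R) c i : mean_le P g c -> mean_le Pr (fun w => g (Y i w)) c.
Proof.
move=> [mg g0 gc]; split => //; first exact: measurableT_comp.
apply: le_trans gc; rewrite le_eqVlt; apply/orP; left; apply/eqP.
transitivity (\int[pushforward Pr (Y i)]_s (g s)%:E)%E.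
  rewrite ge0_integral_pushforward//; first exact/measurable_EFinP.
  by move=> s _; rewrite lee_fin.
by apply: eq_measure_integral => B mB _; exact: lY.
Qed.

Lemma integral_law (g : Xi -> R) i : P.-integrable setT (EFin \o g) ->
  Pr.-integrable setT (fun w => (g (Y i w))%:E) /\
  (\int[Pr]_w (g (Y i w))%:E = \int[P]_s (g s)%:E)%E.
Proof.
move=> ig; have /integrableP[mEg fg] := ig.
have mg : measurable_fun setT g by exact/measurable_EFinP.
have gP : mean_le P (fun s => `|g s|) (fine (\int[P]_s (`|g s|)%:E)%E).
  split; [exact: measurableT_comp | by move=> s | rewrite fineK//].
  by rewrite ge0_fin_numE//; apply: integral_ge0 => s _; rewrite lee_fin.
have igY : Pr.-integrable setT (fun w => (g (Y i w))%:E).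
  apply: (mean_le_integrable (g := fun w => g (Y i w)) _ _ (mean_le_law i gP)) => //.
  exact: measurableT_comp.
split=> //; transitivity (\int[pushforward Pr (Y i)]_s (g s)%:E)%E.
  by rewrite (integral_pushforward (mY i) mEg).
by apply: eq_measure_integral => B mB _; exact: lY.
Qed.

Let iY : independent_family Pr Y. Proof. by have [] := iidY. Qed.

(* The general induction step: a bound for E[phi(s + g(Y))] at every constant s
   passes to s replaced by a sum of independent copies. *)
Let sum_step (g : Xi -> R) (phi psi : R -> R) (t : seq I) i c :
  i \notin t -> measurable_fun setT g ->
  measurable_fun setT phi -> (forall x, 0 <= phi x) ->
  (forall x, mean_le P (fun s => phi (x + g s)) (psi x)) ->
  mean_le Pr (fun w => psi (\sum_(j <- t) g (Y j w))) c ->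
  mean_le Pr (fun w => phi (\sum_(j <- i :: t) g (Y j w))) c.
Proof.
move=> it mg mphi phi0 hpsi hc.
pose S1 := [set j | j \in t]; pose S2 := [set i].
have S12 : S1 `&` S2 = set0.
  by apply/seteqP; split=> // j [/= jt ji]; move: it; rewrite -ji jt.
(* The test [j \in t] records inside each summand that its draw belongs to [t], so that it is
   measurable for the sigma-algebra of these draws. *)
pose f (p : g_sigma_algebraType (draw_events Y S1) * g_sigma_algebraType (draw_events Y S2)) :=
  phi (\sum_(j <- t) (if j \in t then g (Y j p.1) else 0) + g (Y i p.2)).
have sumE w : \sum_(j <- t) (if j \in t then g (Y j w) else 0) = \sum_(j <- t) g (Y j w).
  by apply: eq_big_seq => j jt; rewrite jt.
have mf : measurable_fun setT f.
  apply: measurableT_comp => //; apply: measurable_funD.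
    apply: measurable_sum => j; have [jt|_] := boolP (j \in t); last exact: measurable_cst.
    apply: measurableT_comp => //.
    exact: (measurableT_comp (@measurable_draw_sigma _ _ _ _ _ Y S1 j jt) measurable_fst).
  apply: measurableT_comp => //.
  exact: (measurableT_comp (@measurable_draw_sigma _ _ _ _ _ Y S2 i erefl) measurable_snd).
have := mean_le_indep (draw_events_measurable mY (S := S1))
  (draw_events_measurable mY (S := S2)) (indep_draws mY iY S12) mf (fun=> phi0 _) hc.
rewrite (_ : (fun w => f (w, w)) = fun w => phi (\sum_(j <- i :: t) g (Y j w))); last first.
  by apply/funext => w; rewrite /f/= sumE big_cons addrC.
apply; apply: aeW => w1; rewrite /f/= sumE.
exact: (mean_le_law i (hpsi _)).
Qed.

Lemma mean_le_sum_sqr (g : Xi -> R) (v : R) (t : seq I) :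
  measurable_fun setT g -> (\int[P]_s (g s)%:E = 0)%E ->
  mean_le P (fun s => g s ^+ 2) v -> uniq t ->
  mean_le Pr (fun w => (\sum_(j <- t) g (Y j w)) ^+ 2) ((size t)%:R * v).
Proof.
move=> mg g0 gv; have v0 := mean_le_ge0 gv.
have ig : P.-integrable setT (EFin \o g).
  apply: (mean_le_integrable (f := fun s => 1 + g s ^+ 2) (c := 1 + v)) => //.
    move=> s; rewrite ler_norml; have := sqr_ge0 (g s - 1); have := sqr_ge0 (g s + 1).
    by move=> ? ?; apply/andP; split; nra.
  by apply: mean_leD => //; exact: mean_le_cst.
elim: t => [_|i t IH] /=.
  rewrite mul0r; rewrite (_ : (fun _ => _) = fun=> 0); last first.
    by apply/funext => w; rewrite big_nil expr0n.
  exact: mean_le_cst.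
move=> /andP[it ut].
apply: (@sum_step g (fun x => x ^+ 2) (fun x => x ^+ 2 + v)) => //.
- by move=> x; exact: sqr_ge0.
- move=> x; apply: (mean_le_centered (y := g) (g := fun s => x ^+ 2 + g s ^+ 2) (k := 2 * x)) => //.
  + by apply: measurable_funX; apply: measurable_funD => //; exact: measurable_cst.
  + by move=> s; exact: sqr_ge0.
  + by apply: mean_leD => //; apply: mean_le_cst; exact: sqr_ge0.
  + by move=> s; rewrite le_eqVlt; apply/orP; left; apply/eqP; ring.
- have -> : (size t).+1%:R * v = (size t)%:R * v + v by rewrite -natr1 mulrDl mul1r.
  by apply: mean_leD (IH ut) _; exact: mean_le_cst.
Qed.

(* [4 s y^3 <= 2 s^2 y^2 + 2 y^4] removes the odd moment of order 3. *)
Lemma mean_le_sum_pow4 (g : Xi -> R) (m : R) (t : seq I) :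
  measurable_fun setT g -> (\int[P]_s (g s)%:E = 0)%E ->
  mean_le P (fun s => g s ^+ 4) m -> uniq t ->
  mean_le Pr (fun w => (\sum_(j <- t) g (Y j w)) ^+ 4) (7 * (size t)%:R ^+ 2 * m).
Proof.
move=> mg g0 gm; have m0 := mean_le_ge0 gm.
have mg2 : measurable_fun setT (fun s => g s ^+ 2) by exact: measurable_funX.
pose v := Num.sqrt m.
have gv : mean_le P (fun s => g s ^+ 2) v.
  apply: mean_le_root => //; [exact: sqrtr_ge0|by move=> s; exact: sqr_ge0|].
  by rewrite sqr_sqrtr//; under eq_fun do rewrite -exprM.
have v0 := mean_le_ge0 gv.
have v2 : v ^+ 2 = m by rewrite sqr_sqrtr.
have ig : P.-integrable setT (EFin \o g).
  apply: (mean_le_integrable (f := fun s => 1 + g s ^+ 2) (c := 1 + v)) => //.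
    move=> s; rewrite ler_norml; have := sqr_ge0 (g s - 1); have := sqr_ge0 (g s + 1).
    by move=> ? ?; apply/andP; split; nra.
  by apply: mean_leD => //; exact: mean_le_cst.
elim: t => [_|i t IH] /=.
  rewrite expr0n/= mulr0 mul0r; rewrite (_ : (fun _ => _) = fun=> 0); last first.
    by apply/funext => w; rewrite big_nil expr0n.
  exact: mean_le_cst.
move=> /andP[it ut].
apply: (@sum_step g (fun x => x ^+ 4) (fun x => x ^+ 4 + (8 * v * x ^+ 2 + 3 * m))) => //.
- by move=> x; rewrite exprn_even_ge0.
- move=> x; apply: (mean_le_centered (y := g) (k := 4 * x ^+ 3)
    (g := fun s => x ^+ 4 + (8 * x ^+ 2 * g s ^+ 2 + 3 * g s ^+ 4))) => //.
  + by apply: measurable_funX; apply: measurable_funD => //; exact: measurable_cst.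
  + by move=> s; rewrite exprn_even_ge0.
  + apply: mean_leD; first by apply: mean_le_cst; rewrite exprn_even_ge0.
    rewrite (_ : 8 * v * x ^+ 2 = 8 * x ^+ 2 * v); last by ring.
    by apply: mean_leD; apply: mean_leZ => //; rewrite mulr_ge0// sqr_ge0.
  + move=> s; rewrite -subr_ge0.
    rewrite (_ : _ - _ = 2 * (g s * (x - g s)) ^+ 2); last by ring.
    by rewrite mulr_ge0// sqr_ge0.
(* As [v ^+ 2 = m], a further draw raises the bound by [(8 n + 3) m], which is below
   [7 ((n + 1)^2 - n^2) m]. *)
- have hs : (size t)%:R * v * (8 * v) = 8 * (size t)%:R * m by rewrite -v2; ring.
  have n0 : 0 <= (size t)%:R :> R by [].
  apply: (@mean_le_le _ _ _ _ _ (7 * (size t)%:R ^+ 2 * m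
      + (8 * v * ((size t)%:R * v) + 3 * m))).
    apply: mean_leD (IH ut) _; apply: mean_leD; last by apply: mean_le_cst; rewrite mulr_ge0.
    by apply: mean_leZ; [rewrite mulr_ge0|exact: mean_le_sum_sqr].
  rewrite -natr1; move: n0 hs; set n := (size t)%:R => n0 hs.
  have : 0 <= n * m by rewrite mulr_ge0.
  move: hs; rewrite -v2; nra.
Qed.

End IndependentMeans.

Section Lnm_moments.
Context {R : realType} {dW : measure_display} {W : measurableType dW}.
Variable Pr : probability W R.

Let Lnm_pow (q : nat) (f : W -> R) : (0 < q)%N -> (forall w, 0 <= f w) ->
  (Lnm Pr q f `^ q%:R = \int[Pr]_w (f w ^+ q)%:E)%E.
Proof.
move=> q0 f0; rewrite /Lnm poweR_Lnorm ?pnatr_eq0 -?lt0n//.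
by apply: eq_integral => w _; rewrite /= ger0_norm// powR_mulrn.
Qed.

Let Lnm_ge0 (q : nat) (f : W -> R) : (0 <= Lnm Pr q f)%E.
Proof. exact: Lnorm_ge0. Qed.

Lemma Lnm_mean_le (q : nat) (f : W -> R) c : (0 < q)%N -> 0 <= c ->
  measurable_fun setT f -> (forall w, 0 <= f w) ->
  (Lnm Pr q f <= c%:E)%E -> mean_le Pr (fun w => f w ^+ q) (c ^+ q).
Proof.
move=> q0 c0 mf f0 fc; split; first exact: measurable_funX.
  by move=> w; rewrite exprn_ge0.
rewrite -Lnm_pow// -powR_mulrn// -poweR_EFin.
apply: gt0_ler_poweR => //; rewrite in_itv/= leey andbT ?lee_fin//.
Qed.

Lemma mean_le_Lnm (q : nat) (f : W -> R) b : (0 < q)%N ->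
  measurable_fun setT f -> (forall w, 0 <= f w) ->
  mean_le Pr (fun w => f w ^+ q) b ->
  0 <= fine (Lnm Pr q f) /\ mean_le Pr (fun w => f w ^+ q) (fine (Lnm Pr q f) ^+ q).
Proof.
move=> q0 mf f0 [_ _ fb].
have q0' : q%:R != 0 :> R by rewrite pnatr_eq0 -lt0n.
have fin : Lnm Pr q f \is a fin_num.
  rewrite ge0_fin_numE ?Lnm_ge0//; apply: (lty_poweRy q0').
  by rewrite Lnm_pow//; exact: le_lt_trans fb (ltry _).
have h0 : 0 <= fine (Lnm Pr q f) by rewrite fine_ge0// Lnm_ge0.
split=> //; apply: Lnm_mean_le => //.
by rewrite fineK.
Qed.

Lemma mean_le_Lnm_le (q : nat) (f : W -> R) c : (0 < q)%N -> 0 <= c ->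
  measurable_fun setT f -> (forall w, 0 <= f w) ->
  mean_le Pr (fun w => f w ^+ q) (c ^+ q) -> fine (Lnm Pr q f) <= c.
Proof.
move=> q0 c0 mf f0 fc; have [_ _ fc'] := fc.
have [h0 _] := mean_le_Lnm q0 mf f0 fc.
have q0' : q%:R != 0 :> R by rewrite pnatr_eq0 -lt0n.
have fin : Lnm Pr q f \is a fin_num.
  rewrite ge0_fin_numE ?Lnm_ge0//; apply: (lty_poweRy q0').
  by rewrite Lnm_pow//; exact: le_lt_trans fc' (ltry _).
rewrite -(ler_pXn2r q0) ?nnegrE//.
move: fc'; rewrite -Lnm_pow// -(fineK fin) poweR_EFin lee_fin fineK//.
by rewrite powR_mulrn.
Qed.

End Lnm_moments.

(** * Means of random vectors and of empirical averages *)

Section VectorMeans.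
Context {R : realType} {d : nat} {dXi : measure_display} {Xi : measurableType dXi}.
Variable P : probability Xi R.
Implicit Types v : Xi -> 'rV[R]_d.

Definition vmean v : 'rV[R]_d := \row_i \int[P]_s v s 0 i.

Lemma mean_le_coord_integrable v c : vmeas v -> mean_le P (fun s => enorm (v s)) c ->
  forall i, P.-integrable setT (fun s => (v s 0 i)%:E).
Proof.
by move=> mv vc i; apply: (mean_le_integrable (mv i) _ vc) => s; exact: coord_le_enorm.
Qed.

Lemma integral_dot v u : (forall i, P.-integrable setT (fun s => (v s 0 i)%:E)) ->
  P.-integrable setT (fun s => (dot u (v s))%:E) /\
  (\int[P]_s (dot u (v s))%:E = (dot u (vmean v))%:E)%E.
Proof.
move=> iv.
have iuv i : P.-integrable setT (fun s => ((u 0 i)%:E * (v s 0 i)%:E)%E) by exact: integrableZl.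
have E : (fun s => (dot u (v s))%:E) = (fun s => \sum_(i < d) ((u 0 i)%:E * (v s 0 i)%:E)%E).
  by apply/funext => s; rewrite /dot -sumEFin; apply: eq_bigr => i _; rewrite EFinM.
rewrite E; split.
  by apply: integrable_sum => // i _; exact: iuv.
rewrite integral_sum//; rewrite /dot -sumEFin; apply: eq_bigr => i _.
rewrite integralZl// EFinM; congr (_ * _)%E.
by rewrite /vmean mxE /Rintegral fineK//; exact: integrable_fin_num.
Qed.

(** Jensen's inequality for the norm: the squared norm of the mean is the mean of
    [dot (vmean v) (v s)]; Cauchy-Schwarz applies inside, and one factor is cancelled. *)
Lemma enorm_vmean v c : vmeas v -> mean_le P (fun s => enorm (v s)) c ->
  enorm (vmean v) <= c.
Proof.
move=> mv vc; have c0 := mean_le_ge0 vc.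
have iv := mean_le_coord_integrable mv vc.
have [iu uE] := integral_dot (vmean v) iv.
have [->|n0] := eqVneq (enorm (vmean v)) 0; first by [].
have np : 0 < enorm (vmean v) by rewrite lt0r n0 enorm_ge0.
rewrite -(ler_pM2l np) -expr2 enorm_sqr -lee_fin -uE.
have [ms s0 hs] := mean_leZ (enorm_ge0 (vmean v)) vc.
apply: le_trans hs; apply: le_integral => //.
  apply: (mean_le_integrable ms _ (mean_leZ (enorm_ge0 (vmean v)) vc)) => s.
  by rewrite ger0_norm// mulr_ge0 ?enorm_ge0.
by move=> s _; rewrite lee_fin; exact: dot_le_enorm.
Qed.

Lemma vmeanB v v' : (forall i, P.-integrable setT (fun s => (v s 0 i)%:E)) ->
  (forall i, P.-integrable setT (fun s => (v' s 0 i)%:E)) ->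
  vmean (fun s => v s - v' s) = vmean v - vmean v'.
Proof.
move=> iv iv'; apply/rowP => i; rewrite !mxE.
have := @RintegralB _ _ _ P setT (fun s => v s 0 i) (fun s => v' s 0 i) measurableT (iv i) (iv' i).
by move=> <-; apply: eq_Rintegral => s _; rewrite !mxE.
Qed.

End VectorMeans.

Section SampleMeans.
Context {R : realType} {d : nat} {dXi dW : measure_display}.
Context {Xi : measurableType dXi} {W : measurableType dW}.
Variables (P : probability Xi R) (Pr : probability W R) (M : nat) (s : 'I_M -> W -> Xi).
Hypotheses (M0 : (0 < M)%N) (iid : iid_sample P Pr s).

Let ms j : measurable_fun setT (s j). Proof. by have [] := iid. Qed.

Let M0R : 0 < M%:R :> R. Proof. by rewrite ltr0n. Qed.

Let size_index : size (index_enum 'I_M) = M.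
Proof. by rewrite /index_enum; case: index_enum_key => /=; rewrite -enumT size_enum_ord. Qed.

Lemma mean_le_sample_sqr (g : Xi -> R) (v : R) :
  measurable_fun setT g -> (\int[P]_x (g x)%:E = 0)%E ->
  mean_le P (fun x => g x ^+ 2) v ->
  mean_le Pr (fun w => (M%:R^-1 * \sum_j g (s j w)) ^+ 2) (v / M%:R).
Proof.
move=> mg g0 gv.
have h := mean_le_sum_sqr iid mg g0 gv (index_enum_uniq 'I_M).
have := mean_leZ (_ : 0 <= M%:R^-1 ^+ 2) h; rewrite size_index exprn_ge0 ?invr_ge0// => /(_ isT).
have -> : M%:R^-1 ^+ 2 * (M%:R * v) = v / M%:R.
  by rewrite expr2 -mulrA mulKf ?gt_eqF// mulrC.
by under eq_fun do rewrite -exprMn.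
Qed.

Lemma mean_le_sample_pow4 (g : Xi -> R) (m : R) :
  measurable_fun setT g -> (\int[P]_x (g x)%:E = 0)%E ->
  mean_le P (fun x => g x ^+ 4) m ->
  mean_le Pr (fun w => (M%:R^-1 * \sum_j g (s j w)) ^+ 4) (7 * m / M%:R ^+ 2).
Proof.
move=> mg g0 gv.
have h := mean_le_sum_pow4 iid mg g0 gv (index_enum_uniq 'I_M).
have := mean_leZ (_ : 0 <= M%:R^-1 ^+ 4) h; rewrite size_index exprn_ge0 ?invr_ge0// => /(_ isT).
have -> : M%:R^-1 ^+ 4 * (7 * M%:R ^+ 2 * m) = 7 * m / M%:R ^+ 2.
  by field; rewrite gt_eqF.
by under eq_fun do rewrite -exprMn.
Qed.

Variable v : Xi -> 'rV[R]_d.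
Hypotheses (mv : vmeas v) (v0 : forall i, (\int[P]_x (v x 0 i)%:E = 0)%E).

Let sample_mean w : 'rV[R]_d := M%:R^-1 *: \sum_j v (s j w).

Let sample_meanE w i : sample_mean w 0 i = M%:R^-1 * \sum_j v (s j w) 0 i.
Proof. by rewrite /sample_mean mxE summxE. Qed.

Let vmeas_sample_mean : vmeas sample_mean.
Proof.
apply: vmeasZ; first exact: measurable_cst.
by apply: vmeas_sum => j i; apply: (measurableT_comp (mv i)).
Qed.

Lemma mean_le_vsample_sqr c : mean_le P (fun x => enorm (v x) ^+ 2) c ->
  mean_le Pr (fun w => enorm (M%:R^-1 *: \sum_j v (s j w)) ^+ 2) (c / M%:R).
Proof.
move=> vc; have [mvc _ ivc] := vc.
have cc i : mean_le P (fun x => v x 0 i ^+ 2) c.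
  apply: (mean_leW vc); first by apply: measurable_funX; exact: mv.
    by move=> x; exact: sqr_ge0.
  by move=> x; rewrite -[leLHS]real_normK ?num_real// sqr_ler// coord_le_enorm.
(* The exact second moments of the coordinates are kept. They sum to at most [c], whereas bounding
   each of them by [c] would cost a factor [d]. *)
pose ci i := fine (\int[P]_x (v x 0 i ^+ 2)%:E)%E.
have fi i : (\int[P]_x (v x 0 i ^+ 2)%:E)%E \is a fin_num.
  rewrite ge0_fin_numE; last by apply: integral_ge0 => x _; rewrite lee_fin sqr_ge0.
  by have [_ _ h] := cc i; exact: le_lt_trans h (ltry _).
have cic i : mean_le P (fun x => v x 0 i ^+ 2) (ci i).
  by have [? ? ?] := cc i; split=> //; rewrite /ci fineK.
have sc : \sum_i ci i <= c.
  rewrite -lee_fin -sumEFin; under eq_bigr do rewrite /ci fineK//.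
  have hm i : measurable_fun setT (fun x => (v x 0 i ^+ 2)%:E).
    by apply/measurable_EFinP; apply: measurable_funX; exact: mv.
  have h0 i x : setT x -> (0 <= (v x 0 i ^+ 2)%:E)%E by rewrite lee_fin sqr_ge0.
  rewrite -(@ge0_integral_sum _ _ _ P setT measurableT _ _ hm h0).
  apply: le_trans ivc; rewrite le_eqVlt; apply/orP; left; apply/eqP.
  by apply: eq_integral => x _; rewrite sumEFin enorm_sqr /dot; congr (_%:E).
have h := mean_le_sum (index_enum 'I_d) (fun i => mean_le_sample_sqr (mv i) (v0 i) (cic i)).
apply: (mean_le_le (b := \sum_i ci i / M%:R)); last first.
  by rewrite -mulr_suml ler_pM2r ?invr_gt0.
apply: (mean_leW h).
- by apply: measurable_funX; apply: measurable_enorm; exact: vmeas_sample_mean.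
- by move=> w; exact: sqr_ge0.
- move=> w; rewrite enorm_sqr /dot; apply: ler_sum => i _.
  by rewrite -/(sample_mean w) sample_meanE -expr2.
Qed.

(** One factor [d] comes from squaring a sum of [d] squares, the other from bounding every
    coordinate's fourth moment by [m]. *)
Lemma mean_le_vsample_pow4 m : mean_le P (fun x => enorm (v x) ^+ 4) m ->
  mean_le Pr (fun w => enorm (M%:R^-1 *: \sum_j v (s j w)) ^+ 4)
    (7 * d%:R ^+ 2 * m / M%:R ^+ 2).
Proof.
move=> vm.
have cc i : mean_le P (fun x => v x 0 i ^+ 4) m.
  apply: (mean_leW vm); first by apply: measurable_funX; exact: mv.
    by move=> x; rewrite exprn_even_ge0.
  move=> x; rewrite !pow4E sqr_ler ?sqr_ge0//.
  by rewrite -[leLHS]real_normK ?num_real// sqr_ler// coord_le_enorm.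
have h := mean_le_sum (index_enum 'I_d) (fun i => mean_le_sample_pow4 (mv i) (v0 i) (cc i)).
have {}h := mean_leZ (ler0n R d) h.
apply: (mean_le_le (b := d%:R * \sum_(i < d) (7 * m / M%:R ^+ 2))); last first.
  by rewrite sumr_const card_ord -mulr_natl le_eqVlt; apply/orP; left; apply/eqP; ring.
apply: (mean_leW h).
- by apply: measurable_funX; apply: measurable_enorm; exact: vmeas_sample_mean.
- by move=> w; rewrite exprn_even_ge0.
- move=> w; rewrite pow4E enorm_sqr -/(sample_mean w).
  have -> : dot (sample_mean w) (sample_mean w) = \sum_i sample_mean w 0 i ^+ 2.
    by apply: eq_bigr => i _; rewrite expr2.
  under [X in _ <= _ * X]eq_bigr do rewrite -sample_meanE pow4E.
  exact: sqr_sum_le.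
Qed.

Lemma sample_mean_centered (u : 'rV[R]_d) :
  (forall i, P.-integrable setT (fun x => (v x 0 i)%:E)) ->
  Pr.-integrable setT (fun w => (dot u (M%:R^-1 *: \sum_j v (s j w)))%:E) /\
  (\int[Pr]_w (dot u (M%:R^-1 *: \sum_j v (s j w)))%:E = 0)%E.
Proof.
move=> iv.
have ij i : Pr.-integrable setT (fun w => (sample_mean w 0 i)%:E) /\
    (\int[Pr]_w (sample_mean w 0 i)%:E = 0)%E.
  have E : (fun w => (sample_mean w 0 i)%:E) =
      (fun w => (M%:R^-1)%:E * \sum_j (v (s j w) 0 i)%:E)%E.
    by apply/funext => w; rewrite sample_meanE EFinM -sumEFin.
  have is_ j : Pr.-integrable setT (fun w => (v (s j w) 0 i)%:E).
    by have [] := integral_law iid (g := fun x => v x 0 i) j (iv i).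
  have isum : Pr.-integrable setT (fun w => \sum_j (v (s j w) 0 i)%:E)%E.
    by apply: integrable_sum => // j _; exact: is_.
  rewrite E; split; first exact: integrableZl.
  rewrite integralZl// integral_sum//= big1 ?mule0// => j _.
  by have [_ ->] := integral_law iid (g := fun x => v x 0 i) j (iv i).
have [h1 ->] := integral_dot u (fun i => (ij i).1); split=> //.
rewrite /dot big1// => i _; rewrite /vmean mxE /Rintegral (ij i).2.
by rewrite mulr0.
Qed.

End SampleMeans.

(** * The random operator *)

(** The common ground of the compact and the general case: second moments, which follow from the
    fourth moments assumed for general [X]. *)
Record square_integrable_model {R : realType} {d : nat} {dXi : measure_display}
    {Xi : measurableType dXi} (P : probability Xi R) (X : set 'rV[R]_d)
    (F : Xi -> 'rV[R]_d -> 'rV[R]_d) (Lip : Xi -> R) : Prop := {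
  model_nonempty : X !=set0;
  model_closed : closed X;
  model_convex : convex_set X;
  model_measurable : random_operator X F;
  model_Lip_measurable : measurable_fun setT Lip;
  model_Lip_ge0 : forall s, 0 <= Lip s;
  model_Lip_ae : \forall s \ae P, 1 <= Lip s /\
    forall x y, X x -> X y -> enorm (F s x - F s y) <= Lip s * enorm (x - y);
  model_Lip_moment : exists c, mean_le P (fun s => Lip s ^+ 2) c;
  model_op_moment : exists2 x, X x & exists c, mean_le P (fun s => enorm (F s x) ^+ 2) c }.

Section OperatorMoments.
Context {R : realType} {d : nat} {dXi : measure_display} {Xi : measurableType dXi}.
Variables (P : probability Xi R) (X : set 'rV[R]_d).
Variables (F : Xi -> 'rV[R]_d -> 'rV[R]_d) (Lip : Xi -> R).
Hypothesis model : square_integrable_model P X F Lip.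

Let X0 : X !=set0 := model_nonempty model.
Let Xcl : closed X := model_closed model.
Let Xcvx : convex_set X := model_convex model.
Let mF : random_operator X F := model_measurable model.
Let mLip : measurable_fun setT Lip := model_Lip_measurable model.
Let Lip0 : forall s, 0 <= Lip s := model_Lip_ge0 model.
Let aeLip := model_Lip_ae model.
Let Lip2 := model_Lip_moment model.
Let F2 := model_op_moment model.

Let T := mean_op P F.
Let L := Lmean P Lip.
Let K := Lnorm_lip P Lip 2.

Definition noise (x : 'rV[R]_d) (s : Xi) : 'rV[R]_d := F s x - T x.

Lemma Lnorm_lip_mean : 0 <= K /\ mean_le P (fun s => Lip s ^+ 2) (K ^+ 2).
Proof. by case: Lip2 => c; exact: mean_le_Lnm. Qed.

Let K0 : 0 <= K. Proof. by have [] := Lnorm_lip_mean. Qed.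
Let KP : mean_le P (fun s => Lip s ^+ 2) (K ^+ 2). Proof. by have [] := Lnorm_lip_mean. Qed.

Lemma Lmean_mean : mean_le P Lip L.
Proof.
have [_ _ h] := mean_le_root K0 mLip Lip0 KP.
split=> //; rewrite /L /Lmean /Rintegral fineK//.
rewrite ge0_fin_numE; last by apply: integral_ge0 => s _; rewrite lee_fin.
exact: le_lt_trans h (ltry _).
Qed.

Lemma Lmean_ge0 : 0 <= L. Proof. exact: mean_le_ge0 Lmean_mean. Qed.

Lemma Lnorm_lip_ge1 : 1 <= K.
Proof.
have h : mean_le P (fun=> 1) (K ^+ 2).
  apply: (mean_le_ae KP) => //; apply: filterS aeLip => s [h _].
  by rewrite -(expr1n _ 2) sqr_ler.
have {}h : 1 <= K ^+ 2.
  case: h => _ _; rewrite integral_cst// [X in (_ * X)%E](_ : _ = 1%E) ?mule1 ?lee_fin//.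
  exact: probability_setT.
by rewrite -(@ler_pXn2r _ 2)// ?nnegrE// expr1n.
Qed.

Lemma Lq_ge1 : 1 <= Lq P Lip 2.
Proof. by rewrite /Lq -[leLHS]addr0 lerD ?Lnorm_lip_ge1// Lmean_ge0. Qed.

(** The noise at two points differs by at most [Lip s + L] times their distance. Minkowski's
    inequality for this constant explains why [Lq P Lip 2] is the sum of a norm and a mean. *)
Lemma mean_le_LipD_sqr : mean_le P (fun s => (Lip s + L) ^+ 2) (Lq P Lip 2 ^+ 2).
Proof.
apply: mean_leD_sqr => //; first exact: Lmean_ge0.
- by move=> _; exact: Lmean_ge0.
- by apply: mean_le_cst; exact: sqr_ge0.
Qed.

Lemma Lip_centered : (\int[P]_s (Lip s - L)%:E = 0)%E.
Proof.
have iL : P.-integrable setT (EFin \o Lip).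
  by apply: (mean_le_integrable mLip _ Lmean_mean) => s; rewrite ger0_norm.
under eq_integral do rewrite EFinB.
rewrite integralB//; last exact: finite_measure_integrable_cst.
rewrite integral_cst// [X in (_ - _ * X)%E](_ : _ = 1%E) ?mule1; last exact: probability_setT.
by rewrite /L /Lmean /Rintegral fineK ?subee//; exact: integrable_fin_num.
Qed.

Lemma vmeas_F x : X x -> vmeas (fun s => F s x).
Proof.
by move=> Xx; apply: (vmeas_op Xcl mF (s := id) (x := fun=> x)).
Qed.

Lemma mean_le_op_sqr x : X x -> exists c, mean_le P (fun s => enorm (F s x) ^+ 2) c.
Proof.
move=> Xx; have [y Xy [c cP]] := F2.
exists (2 * c + 2 * enorm (x - y) ^+ 2 * K ^+ 2).
have h := mean_leD (mean_leZ (ler0n R 2) cP)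
  (mean_leZ (mulr_ge0 (ler0n R 2) (sqr_ge0 (enorm (x - y)))) KP).
apply: (mean_le_ae h) => //.
- by apply: measurable_funX; apply: measurable_enorm; exact: vmeas_F.
- by move=> s; exact: sqr_ge0.
- apply: filterS aeLip => s [_ /(_ x y Xx Xy) hs].
  have := enormD_sqr (F s y) (F s x - F s y); rewrite addrC subrK => /le_trans; apply.
  rewrite lerD2l -mulrA ler_pM2l// -exprMn mulrC.
  by apply: sqr_ler => //; exact: enorm_ge0.
Qed.

Lemma op_integrable x : X x -> forall i, P.-integrable setT (fun s => (F s x 0 i)%:E).
Proof.
move=> Xx; have [c cP] := mean_le_op_sqr Xx.
have h := mean_leD (mean_le_cst P (ler01 : 0 <= 1 :> R)) cP.
apply: (@mean_le_coord_integrable _ _ _ _ _ _ (1 + c)); first exact: vmeas_F.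
apply: (mean_leW h).
- by apply: measurable_enorm; exact: vmeas_F.
- by move=> s; exact: enorm_ge0.
- by move=> s; have := sqr_ge0 (enorm (F s x) - 1); nra.
Qed.

Lemma vmeas_noise x : X x -> vmeas (noise x).
Proof. by move=> Xx; apply: vmeasB; [exact: vmeas_F | exact: vmeas_cst]. Qed.

Lemma noise_integrable x : X x -> forall i, P.-integrable setT (fun s => (noise x s 0 i)%:E).
Proof.
move=> Xx i; have ii := op_integrable Xx i.
rewrite (_ : (fun _ => _) = (fun s => (F s x 0 i)%:E - (T x 0 i)%:E)%E).
  apply: integrableB => //; exact: finite_measure_integrable_cst.
by apply/funext => s; rewrite !mxE.
Qed.

Lemma noise_centered x : X x -> forall i, (\int[P]_s (noise x s 0 i)%:E = 0)%E.
Proof.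
move=> Xx i; have ii := op_integrable Xx i.
under eq_integral do rewrite /noise !mxE EFinB.
rewrite integralB//; last exact: finite_measure_integrable_cst.
rewrite integral_cst// [X in (_ - _ * X)%E](_ : _ = 1%E) ?mule1; last exact: probability_setT.
by rewrite /Rintegral fineK ?subee//; exact: integrable_fin_num.
Qed.

Lemma mean_op_lipschitz x y : X x -> X y -> enorm (T x - T y) <= L * enorm (x - y).
Proof.
move=> Xx Xy.
rewrite (_ : T x - T y = vmean P (fun s => F s x - F s y)); last first.
  by rewrite vmeanB//; exact: op_integrable.
apply: enorm_vmean; first by apply: vmeasB; exact: vmeas_F.
rewrite mulrC; apply: (mean_le_ae (mean_leZ (enorm_ge0 (x - y)) Lmean_mean)) => //.
- by apply: measurable_enorm; apply: vmeasB; exact: vmeas_F.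
- by move=> s; exact: enorm_ge0.
- by apply: filterS aeLip => s [_ /(_ x y Xx Xy)]; rewrite mulrC.
Qed.

(** [T] is Lipschitz on [X] only. Composed with the projection it becomes globally Lipschitz and is
    unchanged on [X], which gives its measurability along random points of [X]. *)
Lemma mean_op_proj_lipschitz x y :
  enorm (T (proj X x) - T (proj X y)) <= L * enorm (x - y).
Proof.
apply: (le_trans (mean_op_lipschitz (projX X0 Xcl _) (projX X0 Xcl _))).
by rewrite ler_wpM2l ?Lmean_ge0// proj_nonexpansive.
Qed.

(** Moving the point changes the residual once directly and once through the projected step, where
    [T] adds [L]. *)
Lemma residual_proj_lipschitz x y :
  `|residual X T (proj X x) - residual X T (proj X y)| <= (2 + L) * enorm (x - y).
Proof.
have aux (a b c e g h k l n : R) : a <= b + c -> c <= e + g -> g <= h ->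
  h <= b + k -> k <= l * n -> b <= n -> a - e <= (2 + l) * n by lra.
have key u v : residual X T (proj X u) - residual X T (proj X v) <= (2 + L) * enorm (u - v).
  rewrite /residual; set p := proj X u; set q := proj X v.
  have h1 := ler_enorm_dist q p (proj X (p - T p)).
  have h2 := ler_enorm_dist (proj X (q - T q)) q (proj X (p - T p)).
  have h3 := proj_nonexpansive X0 Xcl Xcvx (q - T q) (p - T p).
  have h4 : enorm (q - T q - (p - T p)) <= enorm (q - p) + enorm (T p - T q).
    apply: le_trans (ler_enormD _ _); rewrite le_eqVlt; apply/orP; left; apply/eqP.
    by congr enorm; rewrite opprD opprK addrACA [- T q + _]addrC.
  have h5 := mean_op_proj_lipschitz u v.
  have h6 := proj_nonexpansive X0 Xcl Xcvx u v.
  rewrite -/p -/q in h5 h6; rewrite (enorm_sym q p) in h4.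
  exact: aux h1 h2 h3 h4 h5 h6.
rewrite ler_norml; apply/andP; split; last exact: key.
by rewrite lerNl opprB (enorm_sym x y); exact: key.
Qed.

Lemma noise_lipschitz_sqr x y : X x -> X y ->
  mean_le P (fun s => enorm (noise x s - noise y s) ^+ 2) (enorm (x - y) ^+ 2 * Lq P Lip 2 ^+ 2).
Proof.
move=> Xx Xy.
apply: (mean_le_ae (mean_leZ (sqr_ge0 (enorm (x - y))) mean_le_LipD_sqr)) => //.
- apply: measurable_funX; apply: measurable_enorm; apply: vmeasB; exact: vmeas_noise.
- by move=> s; exact: sqr_ge0.
- apply: filterS aeLip => s [_ /(_ x y Xx Xy) hs].
  rewrite -exprMn sqr_ler ?enorm_ge0//.
  have -> : noise x s - noise y s = (F s x - F s y) - (T x - T y).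
    by rewrite /noise !opprD !opprK addrACA.
  apply: le_trans (ler_enormD _ _) _; rewrite enormN.
  rewrite mulrDr ![enorm (x - y) * _]mulrC; apply: lerD; first exact: hs.
  exact: mean_op_lipschitz.
Qed.

Lemma sigma2_mean x : X x -> 0 <= sigma P F 2 x /\
  mean_le P (fun s => enorm (noise x s) ^+ 2) (sigma P F 2 x ^+ 2).
Proof.
move=> Xx; have [c cP] := mean_le_op_sqr Xx.
apply: (@mean_le_Lnm _ _ _ P 2 (fun s => enorm (noise x s)) (2 * c + 2 * enorm (T x) ^+ 2)) => //.
- by apply: measurable_enorm; exact: vmeas_noise.
- by move=> s; exact: enorm_ge0.
have h := mean_leD (mean_leZ (ler0n R 2) cP) (mean_leZ (ler0n R 2) (mean_le_cst P (sqr_ge0 (enorm (T x))))).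
apply: (mean_leW h).
- by apply: measurable_funX; apply: measurable_enorm; exact: vmeas_noise.
- by move=> s; exact: sqr_ge0.
- by move=> s; have := enormD_sqr (F s x) (- T x); rewrite enormN.
Qed.

Lemma noise_sqr x y : X x -> X y ->
  mean_le P (fun s => enorm (noise x s) ^+ 2)
    ((sigma P F 2 y + Lq P Lip 2 * enorm (x - y)) ^+ 2).
Proof.
move=> Xx Xy; have [s0 sP] := sigma2_mean Xy.
have q0 : 0 <= Lq P Lip 2 * enorm (x - y).
  by rewrite mulr_ge0 ?enorm_ge0// (le_trans ler01 Lq_ge1).
have mxy : measurable_fun setT (fun s => enorm (noise x s - noise y s)).
  by apply: measurable_enorm; apply: vmeasB; exact: vmeas_noise.
have my : measurable_fun setT (fun s => enorm (noise y s)).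
  by apply: measurable_enorm; exact: vmeas_noise.
have hl : mean_le P (fun s => enorm (noise x s - noise y s) ^+ 2) ((Lq P Lip 2 * enorm (x - y)) ^+ 2).
  by rewrite exprMn mulrC; exact: noise_lipschitz_sqr.
have := mean_leD_sqr s0 q0 my mxy (fun s => enorm_ge0 _) (fun s => enorm_ge0 _) sP hl.
move=> h; apply: (mean_leW h).
- by apply: measurable_funX; apply: measurable_enorm; exact: vmeas_noise.
- by move=> s; exact: sqr_ge0.
- move=> s; apply: sqr_ler; first exact: enorm_ge0.
  by have := ler_enormD (noise y s) (noise x s - noise y s); rewrite addrC subrK.
Qed.

Section Sample.
Context {dW : measure_display} {W : measurableType dW}.
Variables (Pr : probability W R) (M : nat) (s : 'I_M -> W -> Xi).
Hypotheses (M0 : (0 < M)%N) (iid : iid_sample P Pr s).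

Let ms j : measurable_fun setT (s j). Proof. by have [] := iid. Qed.

Let M0R : 0 < M%:R :> R. Proof. by rewrite ltr0n. Qed.

Definition Lip_avg (w : W) : R := M%:R^-1 * \sum_j Lip (s j w).

Definition good_sample (w : W) : Prop := forall j, 1 <= Lip (s j w) /\
  forall x y, X x -> X y ->
    enorm (F (s j w) x - F (s j w) y) <= Lip (s j w) * enorm (x - y).

Lemma ae_good_sample : \forall w \ae Pr, good_sample w.
Proof. by apply: filter_forall => j; exact: (ae_law iid j aeLip). Qed.

Lemma Lip_avg_ge1 w : good_sample w -> 1 <= Lip_avg w.
Proof.
move=> gw; rewrite /Lip_avg mulrC ler_pdivlMr// mul1r.
have -> : M%:R = \sum_(j < M) (1 : R) by rewrite sumr_const card_ord.
by apply: ler_sum => j _; have [] := gw j.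
Qed.

Lemma emp_op_lipschitz w x y : good_sample w -> X x -> X y ->
  enorm (emp_op F (fun j => s j w) x - emp_op F (fun j => s j w) y)
    <= Lip_avg w * enorm (x - y).
Proof.
move=> gw Xx Xy; rewrite /emp_op /Lip_avg -scalerBr enormZ ger0_norm ?invr_ge0//.
rewrite -mulrA ler_pM2l ?invr_gt0// -sumrB.
apply: le_trans (enorm_sum _ _ _) _; rewrite mulr_suml.
by apply: ler_sum => j _; have [_] := gw j; exact.
Qed.

Lemma emp_errE w x : emp_err P F (fun j => s j w) x = M%:R^-1 *: \sum_j noise x (s j w).
Proof.
rewrite /emp_err /emp_op /noise sumrB scalerBr; congr (_ - _).
rewrite sumr_const card_ord -[X in _ *: X]scaler_nat scalerA mulVf ?scale1r//.
by rewrite gt_eqF.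
Qed.

Lemma emp_errBE w x y : emp_err P F (fun j => s j w) x - emp_err P F (fun j => s j w) y =
  M%:R^-1 *: \sum_j (noise x (s j w) - noise y (s j w)).
Proof. by rewrite !emp_errE -scalerBr -sumrB. Qed.

Lemma emp_err_lipschitz w x y : good_sample w -> X x -> X y ->
  enorm (emp_err P F (fun j => s j w) x - emp_err P F (fun j => s j w) y)
    <= (Lip_avg w + L) * enorm (x - y).
Proof.
move=> gw Xx Xy; rewrite /emp_err.
set a := emp_op _ _ x; set b := emp_op _ _ y.
have -> : a - mean_op P F x - (b - mean_op P F y) = (a - b) - (T x - T y).
  by rewrite !opprD !opprK addrACA.
apply: le_trans (ler_enormD _ _) _; rewrite enormN mulrDl.
by apply: lerD; [exact: emp_op_lipschitz | exact: mean_op_lipschitz].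
Qed.

Lemma vmeas_emp_err (x : W -> 'rV[R]_d) : vmeas x -> (forall w, X (x w)) ->
  vmeas (fun w => emp_err P F (fun j => s j w) (x w)).
Proof.
move=> mx Xx; apply: vmeasB; first exact: (vmeas_emp_op Xcl mF).
have -> : (fun w => mean_op P F (x w)) = (fun w => T (proj X (x w))).
  by apply/funext => w; rewrite proj_id.
exact: (vmeas_lipschitz mean_op_proj_lipschitz mx).
Qed.

Lemma mean_le_emp_err x c : X x -> mean_le P (fun s => enorm (noise x s) ^+ 2) c ->
  mean_le Pr (fun w => enorm (emp_err P F (fun j => s j w) x) ^+ 2) (c / M%:R).
Proof.
move=> Xx h; under eq_fun do rewrite emp_errE.
exact: (mean_le_vsample_sqr M0 iid (vmeas_noise Xx) (noise_centered Xx) h).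
Qed.

Lemma mean_le_emp_errB x y : X x -> X y ->
  mean_le Pr (fun w => enorm (emp_err P F (fun j => s j w) x - emp_err P F (fun j => s j w) y) ^+ 2)
    (enorm (x - y) ^+ 2 * Lq P Lip 2 ^+ 2 / M%:R).
Proof.
move=> Xx Xy; under eq_fun do rewrite emp_errBE.
apply: (@mean_le_vsample_sqr _ _ _ _ _ _ P Pr M s M0 iid (fun t => noise x t - noise y t)).
- by apply: vmeasB; exact: vmeas_noise.
- move=> i.
  transitivity (\int[P]_t ((noise x t 0 i)%:E - (noise y t 0 i)%:E))%E.
    by apply: eq_integral => t _; rewrite -EFinB !mxE.
  by rewrite integralB ?noise_centered ?sube0//; exact: noise_integrable.
- exact: noise_lipschitz_sqr.
Qed.

Lemma emp_err_centered x (u : 'rV[R]_d) : X x ->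
  Pr.-integrable setT (fun w => (dot u (emp_err P F (fun j => s j w) x))%:E) /\
  (\int[Pr]_w (dot u (emp_err P F (fun j => s j w) x))%:E = 0)%E.
Proof.
move=> Xx; have := sample_mean_centered iid (noise_centered Xx) u (noise_integrable Xx).
rewrite (_ : (fun w => _) = fun w => (dot u (emp_err P F (fun j => s j w) x))%:E)//.
by apply/funext => w; rewrite emp_errE.
Qed.

Lemma mean_le_Lip_avg_sqr : mean_le Pr (fun w => Lip_avg w ^+ 2) (K ^+ 2).
Proof.
have h := mean_leZ (_ : 0 <= M%:R^-1) (mean_le_sum (index_enum 'I_M) (fun j => mean_le_law iid j KP)).
rewrite invr_ge0 ler0n in h; have {}h := h isT.
apply: (mean_le_le (b := M%:R^-1 * \sum_(j < M) K ^+ 2)); last first.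
  by rewrite sumr_const card_ord -[X in _ * X]mulr_natl mulKf// gt_eqF.
apply: (mean_leW h).
- apply: measurable_funX; apply: measurable_funM; first exact: measurable_cst.
  by apply: measurable_sum => j; exact: measurableT_comp.
- by move=> w; exact: sqr_ge0.
- move=> w; rewrite /Lip_avg exprMn expr2 -mulrA ler_pM2l ?invr_gt0//.
  by rewrite mulrC ler_pdivrMr// mulrC sqr_sum_le.
Qed.

Lemma mean_le_Lip_avgB_sqr :
  mean_le Pr (fun w => (Lip_avg w - L) ^+ 2) (Lq P Lip 2 ^+ 2 / M%:R).
Proof.
have E : (fun w => (Lip_avg w - L) ^+ 2) = fun w => (M%:R^-1 * \sum_j (Lip (s j w) - L)) ^+ 2.
  apply/funext => w; congr (_ ^+ 2); rewrite sumrB mulrBr; congr (_ - _).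
  by rewrite sumr_const card_ord -[X in _ * X]mulr_natl mulKf// gt_eqF.
rewrite E; apply: (mean_le_sample_sqr M0 iid (g := fun t => Lip t - L)).
- by apply: measurable_funB => //; exact: measurable_cst.
- exact: Lip_centered.
- apply: (mean_leW mean_le_LipD_sqr).
  + by apply: measurable_funX; apply: measurable_funB => //; exact: measurable_cst.
  + by move=> t; exact: sqr_ge0.
  + by move=> t; have := Lip0 t; have := Lmean_ge0; nra.
Qed.

End Sample.

End OperatorMoments.

(** * One step of the algorithm *)

Section OneStep.
Context {R : realType} {d : nat} {dXi : measure_display} {Xi : measurableType dXi}.
Variables (P : probability Xi R) (X : set 'rV[R]_d).
Variables (F : Xi -> 'rV[R]_d -> 'rV[R]_d) (Lip : Xi -> R).
Hypothesis model : square_integrable_model P X F Lip.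
Variables (ah theta lam : R).
Hypotheses (ah01 : 0 < ah <= 1) (theta01 : 0 < theta < 1) (lam0 : 0 < lam).

Let X0 : X !=set0 := model_nonempty model.
Let Xcl : closed X := model_closed model.
Let Xcvx : convex_set X := model_convex model.
Let mF : random_operator X F := model_measurable model.

Let ah0 : 0 < ah. Proof. by case/andP: ah01. Qed.

Let T := mean_op P F.
Let L := Lmean P Lip.
Let K := Lnorm_lip P Lip 2.
Let LQ := Lq P Lip 2.

Lemma geometric_partial_sum n : \sum_(l < n) theta ^+ l <= (1 - theta)^-1.
Proof.
have /andP[th0 th1] := theta01.
have h : (1 - theta) * \sum_(l < n) theta ^+ l = 1 - theta ^+ n.
  elim: n => [|n IH]; first by rewrite big_ord0 mulr0 expr0 subrr.
  by rewrite big_ord_recr/= mulrDr IH exprS; ring.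
rewrite -(@ler_pM2l _ (1 - theta)) ?subr_gt0// h divff ?gt_eqF ?subr_gt0//.
by rewrite gerBl exprn_ge0// ltW.
Qed.

Section Sample.
Context {dW : measure_display} {W : measurableType dW}.
Variables (Pr : probability W R) (M : nat) (s : 'I_M -> W -> Xi).
Hypotheses (M0 : (0 < M)%N) (iid : iid_sample P Pr s).
Variable x : 'rV[R]_d.
Hypothesis Xx : X x.

Let ms j : measurable_fun setT (s j). Proof. by have [] := iid. Qed.

Let M0R : 0 < M%:R :> R. Proof. by rewrite ltr0n. Qed.

Definition search_step (w : W) : R := line_search X F ah theta lam (fun j => s j w) x.

Definition search_point (w : W) : 'rV[R]_d :=
  trial_point X F (fun j => s j w) x (search_step w).

Lemma search_pointX w : X (search_point w).
Proof. exact: projX. Qed.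

Lemma measurable_search_step : measurable_fun setT search_step.
Proof. by apply: (measurable_line_search X0 Xcl Xcvx mF (x := fun=> x)). Qed.

Lemma vmeas_search_point : vmeas search_point.
Proof.
apply: (vmeas_trial_point X0 Xcl Xcvx mF (x := fun=> x)) => //.
exact: measurable_search_step.
Qed.

Let err y w := emp_err P F (fun j => s j w) y.

Let measurable_err_sqr (y : W -> 'rV[R]_d) : vmeas y -> (forall w, X (y w)) ->
  measurable_fun setT (fun w => enorm (err (y w) w) ^+ 2).
Proof.
by move=> my Xy; apply: measurable_funX; apply: measurable_enorm; exact: (vmeas_emp_err model iid my Xy).
Qed.

(* The accepted step is one of countably many values theta^l ah, and the trial
   point at that value is close to a deterministic point, so the error there is
   compared with the errors at these deterministic points. *)
Lemma mean_le_search_error (S2 H : R) (h : W -> R) :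
  mean_le P (fun t => enorm (noise P F x t) ^+ 2) S2 -> mean_le Pr h H ->
  (forall w u v, X u -> X v -> enorm (u - v) <= enorm (err x w) ->
     (Lip_avg Lip s w - L) ^+ 2 * enorm (u - v) ^+ 2 <= h w) ->
  mean_le Pr (fun w => enorm (err (search_point w) w) ^+ 2)
    ((3 + 24 * L ^+ 2) * (S2 / M%:R) + 6 * H
     + 3 * (enorm (T x) ^+ 2 * LQ ^+ 2 / M%:R * (1 - theta)^-1)).
Proof.
move=> xS hH hle; have /andP[th0 th1] := theta01.
have aux (p l2 r t hw u v w0 : R) : 0 <= p -> 0 <= l2 * u - r -> t <= hw ->
  v <= 2 * t + 8 * r - p ->
  3 * u + 3 * w0 + 3 * v <= 3 * w0 + ((3 + 24 * l2) * u + 6 * hw) by lra.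
have L0 : 0 <= L := Lmean_ge0 model.
have e1 := mean_le_emp_err model M0 iid Xx xS.
pose A w := (3 + 24 * L ^+ 2) * enorm (err x w) ^+ 2 + 6 * h w.
have cL : 0 <= 3 + 24 * L ^+ 2 by rewrite addr_ge0// mulr_ge0// sqr_ge0.
have AP : mean_le Pr A ((3 + 24 * L ^+ 2) * (S2 / M%:R) + 6 * H).
  by apply: mean_leD; apply: mean_leZ.
have [mA A0 _] := AP.
pose B w := enorm (err (search_point w) w) ^+ 2.
have mB : measurable_fun setT B.
  by apply: measurable_err_sqr; [exact: vmeas_search_point | exact: search_pointX].
(* [f'] is the part of the error that [A] does not account for. It is at most [g l w] for the
   exponent [l] accepted at [w], so [mean_le_series] bounds its mean. *)
pose f' w := Num.max (B w - A w) 0.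
have mf' : measurable_fun setT f'.
  by apply: measurable_maxr => //; exact: measurable_funB.
pose zb l := proj X (x - (theta ^+ l * ah) *: T x).
have Xzb l : X (zb l) by exact: projX.
pose g l w := 3 * enorm (err (zb l) w - err x w) ^+ 2.
pose c0 := enorm (T x) ^+ 2 * LQ ^+ 2 / M%:R.
have c00 : 0 <= c0 by rewrite /c0 divr_ge0// mulr_ge0// sqr_ge0.
have zbx l : enorm (zb l - x) <= theta ^+ l * ah * enorm (T x).
  rewrite -[X in enorm (_ - X)](proj_id X0 Xcl Xcvx Xx); apply: le_trans (proj_nonexpansive X0 Xcl Xcvx _ _) _.
  rewrite addrAC subrr add0r enormN enormZ ger0_norm//.
  by rewrite mulr_ge0 ?exprn_ge0 ?(ltW th0)// ltW.
have thah l : 0 <= theta ^+ l * ah <= 1.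
  apply/andP; split; first by rewrite mulr_ge0 ?exprn_ge0 ?(ltW th0)// ltW.
  by rewrite mulr_ile1 ?exprn_ge0 ?exprn_ile1 ?(ltW th0) ?(ltW th1) ?(ltW ah0)//; case/andP: ah01.
(* The squared steps are bounded by the terms of a geometric series of ratio [theta], since no step
   exceeds 1. *)
have thah2 l : (theta ^+ l * ah) ^+ 2 <= theta ^+ l.
  have /andP[ha0 ha1] := ah01.
  have h0 : 0 <= theta ^+ l by rewrite exprn_ge0 ?(ltW th0).
  have h1 : theta ^+ l <= 1 by rewrite exprn_ile1 ?(ltW th0) ?(ltW th1).
  have /andP[k0 k1] := thah l.
  rewrite expr2 -[leRHS]mulr1; apply: ler_pM => //.
  by rewrite -[leRHS]mulr1; apply: ler_pM => //; exact: ltW.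
have gP l : mean_le Pr (g l) (3 * (theta ^+ l * c0)).
  apply: mean_leZ => //; apply: (mean_le_le (mean_le_emp_errB model M0 iid (Xzb l) Xx)).
  rewrite /c0 (mulrA (theta ^+ l)) (mulrA (theta ^+ l)) ler_pM2r ?invr_gt0//.
  rewrite -/LQ ler_wpM2r ?sqr_ge0//.
  apply: (@le_trans _ _ ((theta ^+ l * ah * enorm (T x)) ^+ 2)).
    by apply: sqr_ler; [exact: enorm_ge0 | exact: zbx].
  by rewrite exprMn ler_wpM2r ?sqr_ge0.
have f'P : mean_le Pr f' (3 * (c0 * (1 - theta)^-1)).
  apply: (mean_le_series mf' _ gP).
  - by move=> w; rewrite le_max lexx orbT.
  - move=> n; rewrite -mulr_sumr -mulr_suml ler_pM2l// [leRHS]mulrC.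
    by rewrite ler_wpM2r// geometric_partial_sum.
  - apply: filterS (ae_good_sample model iid) => w gw.
    have [[l alE] _ _] := @line_searchP _ _ _ _ X F X0 Xcl ah theta lam ah0 theta01 lam0 M
      (fun j => s j w) x (Lip_avg Lip s w) Xx (Lip_avg_ge1 M0 gw)
      (fun y y' Xy Xy' => emp_op_lipschitz M0 gw Xy Xy').
    exists l; rewrite ge_max; apply/andP; split; last first.
      by rewrite /g mulr_ge0// sqr_ge0.
    rewrite lerBlDr /B /A /g.
    set z := search_point w.
    have zE : z = proj X (x - (theta ^+ l * ah) *: emp_op F (fun j => s j w) x).
      by rewrite /z /search_point /search_step alE.
    have dz : enorm (z - zb l) <= enorm (err x w).
      rewrite zE; apply: le_trans (proj_nonexpansive X0 Xcl Xcvx _ _) _.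
      rewrite opprB addrC addrA subrK -scalerBr enormZ.
      have /andP[k0 k1] := thah l; rewrite ger0_norm// enorm_sym.
      by rewrite ler_piMl ?enorm_ge0.
    have Xz : X z by exact: search_pointX.
    (* The error is followed from [x] to the deterministic point [zb l] and from there to the
       accepted point [z]. The first displacement is of order theta^l, the second is at most the
       error at [x]. *)
    have h1 := enormD3_sqr (err x w) (err (zb l) w - err x w) (err z w - err (zb l) w).
    have E : err x w + (err (zb l) w - err x w) + (err z w - err (zb l) w) = err z w.
      by rewrite [err x w + _]addrC subrK addrC subrK.
    rewrite E in h1; apply: (le_trans h1).
    have h2 : enorm (err z w - err (zb l) w) ^+ 2 <=
        (Lip_avg Lip s w + L) ^+ 2 * enorm (z - zb l) ^+ 2.
      rewrite -exprMn sqr_ler ?enorm_ge0//.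
      exact: (emp_err_lipschitz model M0 gw Xz (Xzb l)).
    have h3 := hle w z (zb l) Xz (Xzb l) dz.
    have h4 : enorm (z - zb l) ^+ 2 <= enorm (err x w) ^+ 2 by rewrite sqr_ler ?enorm_ge0.
    have h5 := sqr_ge0 (enorm (z - zb l)).
    move: h2 h3 h4 h5.
    move: (enorm (err z w - err (zb l) w)) (Lip_avg Lip s w) (enorm (z - zb l)) (enorm (err x w)).
    move: (enorm (err (zb l) w - err x w)) (h w) => b hw a la e e1' h2 h3 h4 h5.
    (* This square is the defect in [(la + L)^2 <= 2 (la - L)^2 + 8 L^2], which separates the
       fluctuation of the averaged Lipschitz constant from its mean. Multiplied by 3 it yields the
       coefficients 6 and 24. *)
    have k1 : 0 <= (la - 3 * L) ^+ 2 * e ^+ 2 by rewrite mulr_ge0// sqr_ge0.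
    have k2 : 0 <= L ^+ 2 * (e1' ^+ 2 - e ^+ 2) by rewrite mulr_ge0 ?sqr_ge0// subr_ge0.
    have k3 : (la + L) ^+ 2 * e ^+ 2 = 2 * ((la - L) ^+ 2 * e ^+ 2) + 8 * (L ^+ 2 * e ^+ 2)
      - (la - 3 * L) ^+ 2 * e ^+ 2 by ring.
    move: h2; rewrite k3; move: k1 k2 h3; rewrite mulrBr.
    move=> k1 k2 h3 h2; exact: (aux _ _ _ _ _ (e1' ^+ 2) _ (b ^+ 2) k1 k2 h3 h2).
apply: (mean_leW (mean_leD AP f'P)) => //; first by move=> w; exact: sqr_ge0.
by move=> w; rewrite -lerBlDl /f' le_max lexx.
Qed.

End Sample.

Section Step.
Context {dW : measure_display} {W : measurableType dW}.
Variables (Pr : probability W R) (M : nat) (s t : 'I_M -> W -> Xi).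

Definition both_samples (i : 'I_M + 'I_M) : W -> Xi :=
  match i with inl j => s j | inr j => t j end.

Hypotheses (M0 : (0 < M)%N) (iid : iid_sample P Pr both_samples).

Lemma iid_fst : iid_sample P Pr s.
Proof. exact: (iid_sample_inj (@inl_inj 'I_M 'I_M) iid). Qed.

Lemma iid_snd : iid_sample P Pr t.
Proof. exact: (iid_sample_inj (@inr_inj 'I_M 'I_M) iid). Qed.

Variables (x xs : 'rV[R]_d).
Hypotheses (Xx : X x) (sol : solutions X T xs) (pm : pseudo_monotone X T).
Hypothesis lam6 : 6 * lam ^+ 2 <= 1.

Let z := search_point s x.
Let al := search_step s x.

Definition next_point (w1 w2 : W) : 'rV[R]_d :=
  proj X (x - al w1 *: emp_op F (fun j => t j w2) (z w1)).

Definition residual_gain : R :=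
  (1 - 6 * lam ^+ 2) / 2 * (Num.min (lam * theta) ah ^+ 2 / K ^+ 2) * residual X T x ^+ 2.

Let K1 : 1 <= K := Lnorm_lip_ge1 model.
Let K20 : 0 < K ^+ 2. Proof. by rewrite exprn_gt0// (lt_le_trans ltr01 K1). Qed.

Lemma residual_gain_ge0 : 0 <= residual_gain.
Proof.
rewrite /residual_gain mulr_ge0 ?sqr_ge0// mulr_ge0//.
  by rewrite divr_ge0// subr_ge0.
by rewrite divr_ge0// sqr_ge0.
Qed.

(* E[alpha^2] is bounded below through alpha >= m / Lhat and
   alpha^2 + (m Lhat / K^2)^2 >= 2 m^2 / K^2, which needs only E[Lhat^2] <= K^2. *)
Lemma mean_le_next_point (b3 : 'rV[R]_d -> R) (B1 B2 B3 : R) :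
  mean_le Pr (fun w => enorm (emp_err P F (fun j => s j w) x) ^+ 2) B1 ->
  mean_le Pr (fun w => enorm (emp_err P F (fun j => s j w) (z w)) ^+ 2) B2 ->
  (forall y, X y -> mean_le Pr (fun w => enorm (emp_err P F (fun j => t j w) y) ^+ 2) (b3 y)) ->
  mean_le Pr (fun w => b3 (z w)) B3 ->
  mean_le Pr (fun w => enorm (next_point w w - xs) ^+ 2 + residual_gain)
    (enorm (x - xs) ^+ 2 + ah ^+ 2 * ((1 - 6 * lam ^+ 2) * B1 + 6 * B2 + 6 * B3)).
Proof.
move=> h1 h2 h3 h4.
(* In [aux] the step is bounded above, by [a2], in the error terms, and below, through
   [m <= al0 * la], in the gain. *)
have aux (D e1 e2 e3 g q al0 m r k la a2 ip : R) :
  0 < k -> 0 <= q -> 0 <= al0 -> al0 ^+ 2 <= a2 -> 0 <= m -> m <= al0 * la -> 0 <= e1 ->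
  0 <= e2 -> 0 <= e3 -> 0 <= r ->
  g + q / 2 * (al0 ^+ 2 * r) <= D + al0 ^+ 2 * (q * e1 + 6 * e2 + 6 * e3) - 2 * al0 * ip ->
  g + 2 * (q / 2 * (m ^+ 2 / k) * r) <= (-2 * al0) * ip + (D + (a2 * (q * e1 + 6 * e2)
    + 6 * a2 * e3 + q / 2 * (m ^+ 2 / k) * r / k * la ^+ 2)).
  move=> k0 q0 al00 ala m0 mla e10 e20 e30 r0 H.
  have H1 : al0 ^+ 2 * (q * e1 + 6 * e2 + 6 * e3) <= a2 * (q * e1 + 6 * e2 + 6 * e3).
    by rewrite ler_wpM2r// !addr_ge0// mulr_ge0.
  have H2 : 2 * (m ^+ 2 / k) <= al0 ^+ 2 + m ^+ 2 / k / k * la ^+ 2.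
    have := sqr_ge0 (al0 - m / k * la).
    have : 2 * (m / k) * m <= 2 * (m / k) * (al0 * la).
      by rewrite ler_wpM2l// mulr_ge0// divr_ge0// ltW.
    rewrite (_ : m ^+ 2 / k / k * la ^+ 2 = (m / k * la) ^+ 2); last first.
      by move: k^-1 => kv; ring.
    rewrite (_ : m ^+ 2 / k = m / k * m); last by move: k^-1 => kv; ring.
    move: (m / k) => mk; nra.
  have H3 := ler_wpM2l (mulr_ge0 (divr_ge0 q0 (ler0n R 2)) r0) H2.
  have E1 : q / 2 * r * (2 * (m ^+ 2 / k)) = 2 * (q / 2 * (m ^+ 2 / k) * r) by ring.
  have E2 : q / 2 * r * (al0 ^+ 2 + m ^+ 2 / k / k * la ^+ 2) =
    q / 2 * (al0 ^+ 2 * r) + q / 2 * (m ^+ 2 / k) * r / k * la ^+ 2.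
    by move: (m ^+ 2 / k) => u; move: k^-1 => kv; ring.
  rewrite E1 E2 in H3; move: (q / 2 * (m ^+ 2 / k) * r / k * la ^+ 2) (q / 2 * (m ^+ 2 / k) * r) H3 => u v H3.
  lra.
have q0 : 0 <= 1 - 6 * lam ^+ 2 by rewrite subr_ge0.
have is_ := iid_fst; have it := iid_snd.
have [mY _ iY] := iid.
have ms j : measurable_fun setT (s j) by have [] := is_.
have mt j : measurable_fun setT (t j) by have [] := it.
have [Xxs _] := sol.
set rho := residual_gain; have rho0 : 0 <= rho := residual_gain_ge0.
pose S1 : set ('I_M + 'I_M) := [set i | if i is inl _ then true else false].
pose S2 : set ('I_M + 'I_M) := [set i | if i is inl _ then false else true].
have S12 : S1 `&` S2 = set0 by apply/seteqP; split=> // -[i|i] [].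
pose W1 := g_sigma_algebraType (draw_events both_samples S1).
pose W2 := g_sigma_algebraType (draw_events both_samples S2).
have ms1 j : measurable_fun setT (s j : W1 -> Xi).
  exact: (@measurable_draw_sigma _ _ _ _ _ both_samples S1 (inl j)).
have mt2 j : measurable_fun setT (t j : W2 -> Xi).
  exact: (@measurable_draw_sigma _ _ _ _ _ both_samples S2 (inr j)).
(* The gain is added twice: the lower bound on the squared step yields twice [rho], minus
   [rho / K ^+ 2] times the square of [Lip_avg], whose mean is at most [rho]. One copy of [rho] is
   cancelled at the end by [mean_leB_cst]. *)
pose f (p : W1 * W2) := enorm (next_point p.1 p.2 - xs) ^+ 2 + rho + rho.
have mal : measurable_fun setT (fun p : W1 * W2 => al p.1).
  apply: (measurable_line_search X0 Xcl Xcvx mF (x := fun=> x) (s := fun j (p : W1 * W2) => s j p.1)) => //.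
  by move=> j; apply: (measurableT_comp (ms1 j)).
have mz : vmeas (fun p : W1 * W2 => z p.1).
  apply: (vmeas_trial_point X0 Xcl Xcvx mF (x := fun=> x) (s := fun j (p : W1 * W2) => s j p.1)) => //.
  by move=> j; apply: (measurableT_comp (ms1 j)).
have mnext : vmeas (fun p : W1 * W2 => next_point p.1 p.2).
  apply: (vmeas_proj X0 Xcl Xcvx); apply: vmeasB => //; apply: vmeasZ => //.
  apply: (vmeas_emp_op Xcl mF (s := fun j (p : W1 * W2) => t j p.2)) => //.
    by move=> j; apply: (measurableT_comp (mt2 j)).
  by move=> p; exact: (search_pointX s x).
have mf : measurable_fun setT f.
  apply: measurable_funD => //; apply: measurable_funD => //.
  by apply: measurable_funX; apply: measurable_enorm; apply: vmeasB.
have f0 p : 0 <= f p by rewrite /f !addr_ge0// sqr_ge0.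
pose h w := enorm (x - xs) ^+ 2 + (ah ^+ 2 * ((1 - 6 * lam ^+ 2) * enorm (emp_err P F (fun j => s j w) x) ^+ 2
   + 6 * enorm (emp_err P F (fun j => s j w) (z w)) ^+ 2) + 6 * ah ^+ 2 * b3 (z w)
   + rho / K ^+ 2 * Lip_avg Lip s w ^+ 2).
have rk0 : 0 <= rho / K ^+ 2 by rewrite divr_ge0// ltW.
have ah20 : 0 <= ah ^+ 2 := sqr_ge0 ah.
have hP : mean_le Pr h (enorm (x - xs) ^+ 2
    + (ah ^+ 2 * ((1 - 6 * lam ^+ 2) * B1 + 6 * B2) + 6 * ah ^+ 2 * B3 + rho / K ^+ 2 * K ^+ 2)).
  apply: mean_leD; first by apply: mean_le_cst; exact: sqr_ge0.
  apply: mean_leD; last by apply: mean_leZ => //; exact: (mean_le_Lip_avg_sqr model M0 is_).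
  apply: mean_leD; last by apply: mean_leZ => //; rewrite mulr_ge0.
  apply: mean_leZ => //; apply: mean_leD; first exact: mean_leZ.
  exact: mean_leZ.
have key : {ae Pr, forall w1 : W, mean_le Pr (fun w2 => f (w1, w2)) (h w1)}.
  apply: filterS (ae_good_sample model is_) => w1 gw.
  have [[l alE] acc mal1] := @line_searchP _ _ _ _ X F X0 Xcl ah theta lam ah0 theta01 lam0 M
      (fun j => s j w1) x (Lip_avg Lip s w1) Xx (Lip_avg_ge1 M0 gw)
      (fun y y' Xy Xy' => emp_op_lipschitz M0 gw Xy Xy').
  have Xz : X (z w1) by exact: search_pointX.
  have /andP[th0 th1] := theta01; have /andP[_ ah1] := ah01.
  have al0 : 0 < al w1 by rewrite /al /search_step alE mulr_gt0// exprn_gt0.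
  have alah : al w1 <= ah.
    by rewrite /al /search_step alE ger_pMl// exprn_ile1// ltW.
  have [iy y0] := emp_err_centered model M0 it (z w1 - xs) Xz.
  have gP := mean_leD (mean_le_cst Pr (sqr_ge0 (enorm (x - xs))))
    (mean_leD (mean_leD (mean_le_cst Pr (mulr_ge0 ah20 (addr_ge0
      (mulr_ge0 q0 (sqr_ge0 (enorm (emp_err P F (fun j => s j w1) x))))
      (mulr_ge0 (ler0n R 6) (sqr_ge0 (enorm (emp_err P F (fun j => s j w1) (z w1))))))))
      (mean_leZ (mulr_ge0 (ler0n R 6) ah20) (h3 _ Xz)))
      (mean_le_cst Pr (mulr_ge0 rk0 (sqr_ge0 (Lip_avg Lip s w1))))).
  (* With the first sample frozen, the step and [z w1] are constants, so the cross term with the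
     second sample's error at [z w1] has mean zero. *)
  apply: (mean_le_centered _ _ iy y0 gP (k := -2 * al w1)).
  - apply: measurable_funD => //; apply: measurable_funD => //.
    apply: measurable_funX; apply: measurable_enorm; apply: vmeasB => //.
    apply: (vmeas_proj X0 Xcl Xcvx); apply: vmeasB => //; apply: vmeasZ => //.
      exact: (measurable_cst (al w1)).
    by apply: (vmeas_emp_op Xcl mF (s := t) (x := fun=> z w1)).
  - by move=> w2; exact: f0.
  - move=> w2; rewrite /f -[_ + rho + rho]addrA -mulr2n -[rho *+ 2]mulr_natl.
    rewrite dotC.
    have acc' : al w1 * enorm (emp_op F (fun j => s j w1) (z w1) - emp_op F (fun j => s j w1) x)
      <= lam * enorm (z w1 - x) by exact: acc.
    have D := @extragradient_descent _ _ X X0 Xcl Xcvx T x xs (emp_op F (fun j => s j w1) x)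
      (emp_op F (fun j => s j w1) (z w1)) (emp_op F (fun j => t j w2) (z w1)) (al w1) lam pm Xx sol
      (introT andP (conj al0 (le_trans alah ah1))) lam0 lam6 acc'.
    apply: (aux _ _ _ _ _ _ _ _ _ _ _ _ _ K20 q0 (ltW al0) _ _ _ _ _ _ _ D).
    + by rewrite sqr_ler// ltW.
    + by rewrite le_min mulr_ge0 ?(ltW lam0) ?(ltW th0)//= ltW.
    + exact: mal1.
    + exact: sqr_ge0.
    + exact: sqr_ge0.
    + exact: sqr_ge0.
    + exact: sqr_ge0.
have := mean_le_indep (draw_events_measurable mY (S := S1))
  (draw_events_measurable mY (S := S2)) (indep_draws mY iY S12) mf f0 hP key.
rewrite divfK ?gt_eqF//.
set c := enorm (x - xs) ^+ 2 + _; set c' := enorm (x - xs) ^+ 2 + _.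
have -> : c = c' + rho by rewrite /c /c'; ring.
move=> H; apply: (mean_leB_cst _ _ rho0 H).
  apply: measurable_funD => //; apply: measurable_funX; apply: measurable_enorm; apply: vmeasB => //.
  apply: (vmeas_proj X0 Xcl Xcvx); apply: vmeasB => //; apply: vmeasZ => //.
    exact: (measurable_search_step is_ Xx).
  apply: (vmeas_emp_op Xcl mF) => //; first exact: (vmeas_search_point is_ Xx).
  by move=> w; exact: search_pointX.
by move=> w; rewrite addr_ge0// sqr_ge0.
Qed.

End Step.

End OneStep.

Lemma pow4D_le {R : realDomainType} (a b : R) : (a + b) ^+ 4 <= 8 * a ^+ 4 + 8 * b ^+ 4.
Proof.
have h1 : (a + b) ^+ 2 <= 2 * (a ^+ 2 + b ^+ 2) by have := sqr_ge0 (a - b); nra.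
have h2 : (a ^+ 2 + b ^+ 2) ^+ 2 <= 2 * (a ^+ 4 + b ^+ 4).
  by rewrite !pow4E; have := sqr_ge0 (a ^+ 2 - b ^+ 2); nra.
have h3 := sqr_ler (sqr_ge0 (a + b)) h1.
rewrite pow4E; apply: (le_trans h3); rewrite exprMn; nra.
Qed.

(** * Error at the search point from moment assumptions *)

Section OwnBounds.
Context {R : realType} {d : nat} {dXi : measure_display} {Xi : measurableType dXi}.
Variables (P : probability Xi R) (X : set 'rV[R]_d).
Variables (F : Xi -> 'rV[R]_d -> 'rV[R]_d) (Lip : Xi -> R).
Hypothesis model : square_integrable_model P X F Lip.
Variables (ah theta lam : R).
Hypotheses (ah01 : 0 < ah <= 1) (theta01 : 0 < theta < 1) (lam0 : 0 < lam).

Let Xcl : closed X := model_closed model.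
Let mF : random_operator X F := model_measurable model.
Let mLip : measurable_fun setT Lip := model_Lip_measurable model.
Let Lip0 : forall s, 0 <= Lip s := model_Lip_ge0 model.

Let T := mean_op P F.
Let L := Lmean P Lip.
Let LQ := Lq P Lip 2.

(** Two ways to control [(Lip_avg Lip s w - L) ^+ 2] times a squared displacement: displacements in
    [X] are bounded and second moments suffice, or fourth moments permit Cauchy-Schwarz. *)
Definition search_moments : Prop :=
  (exists B, forall u v, X u -> X v -> enorm (u - v) <= B) \/
  ((exists c, mean_le P (fun s => Lip s ^+ 4) c) /\
   exists2 x, X x & exists c, mean_le P (fun s => enorm (F s x) ^+ 4) c).

Lemma noise_pow4 : (exists c, mean_le P (fun s => Lip s ^+ 4) c) ->
  (exists2 x, X x & exists c, mean_le P (fun s => enorm (F s x) ^+ 4) c) ->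
  forall xs, X xs ->
  (exists c, mean_le P (fun s => (Lip s - L) ^+ 4) c) /\
  exists c, forall x, X x -> mean_le P (fun s => enorm (noise P F x s) ^+ 4)
    (c * (1 + enorm (x - xs) ^+ 2) ^+ 2).
Proof.
move=> [l lP] [y Xy [f fP]] xs Xxs.
have L0 : 0 <= L := Lmean_ge0 model.
have l0 := mean_le_ge0 lP; have f0 := mean_le_ge0 fP.
have LL : mean_le P (fun s => (Lip s + L) ^+ 4) (8 * l + 8 * L ^+ 4).
  apply: (mean_leW (mean_leD (mean_leZ (ler0n R 8) lP)
    (mean_leZ (ler0n R 8) (mean_le_cst P (exprn_ge0 4 L0))))).
  - by apply: measurable_funX; apply: measurable_funD.
  - by move=> s; rewrite exprn_ge0// addr_ge0.
  - by move=> s; exact: pow4D_le.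
split.
  exists (8 * l + 8 * L ^+ 4); apply: (mean_leW LL).
  - by apply: measurable_funX; apply: measurable_funB.
  - by move=> s; rewrite exprn_even_ge0.
  - move=> s; rewrite !pow4E sqr_ler ?sqr_ge0//; have := Lip0 s; move: (Lip s) L0 => a.
    move: L => b b0 a0; have := mulr_ge0 a0 b0; nra.
pose q := 8 * l + 8 * L ^+ 4.
have q0 : 0 <= q by exact: mean_le_ge0 LL.
pose Tf := enorm (T y).
have Tf0 : 0 <= Tf := enorm_ge0 _.
(* The fourth power of [enorm (x - y)] is split at [xs], and [1 + D^4 <= (1 + D^2)^2] brings the
   bound into a form with a constant independent of [x]. *)
pose m := 8 * (8 * f + 8 * Tf ^+ 4) + 8 * q * (8 + 8 * enorm (xs - y) ^+ 4).
exists m => x Xx.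
have hy : mean_le P (fun s => enorm (noise P F y s) ^+ 4) (8 * f + 8 * Tf ^+ 4).
  apply: (mean_leW (mean_leD (mean_leZ (ler0n R 8) fP)
    (mean_leZ (ler0n R 8) (mean_le_cst P (exprn_ge0 4 Tf0))))).
  - by apply: measurable_funX; apply: measurable_enorm; exact: (vmeas_noise model).
  - by move=> s; rewrite exprn_ge0// enorm_ge0.
  - move=> s; apply: le_trans (pow4D_le _ _).
    rewrite !pow4E; apply: sqr_ler; first exact: sqr_ge0.
    apply: sqr_ler; first exact: enorm_ge0.
    by have := ler_enormD (F s y) (- T y); rewrite enormN.
set D := enorm (x - xs); set D1 := enorm (xs - y).
have D0 : 0 <= D := enorm_ge0 _; have D10 : 0 <= D1 := enorm_ge0 _.
have hxy : enorm (x - y) <= D + D1 by exact: ler_enorm_dist.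
have hxy0 : 0 <= enorm (x - y) := enorm_ge0 _.
have h4 := mean_leD (mean_leZ (ler0n R 8) hy) (mean_leZ
  (mulr_ge0 (ler0n R 8) (exprn_ge0 4 hxy0)) LL).
apply: (@mean_le_ae _ _ _ _ _ _ _ _ h4).
- by apply: measurable_funX; apply: measurable_enorm; exact: (vmeas_noise model).
- by move=> s; rewrite exprn_ge0// enorm_ge0.
- apply: filterS (model_Lip_ae model) => s [_ /(_ x y Xx Xy) hs].
  rewrite -mulrA -exprMn; apply: le_trans (pow4D_le _ _).
  rewrite !pow4E; apply: sqr_ler; first exact: sqr_ge0.
  apply: sqr_ler; first exact: enorm_ge0.
  have -> : noise P F x s = noise P F y s + ((F s x - F s y) - (T x - T y)).
    rewrite /noise -/T !opprD !opprK [RHS]addrC [X in _ = X + _]addrACA -[RHS]addrA.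
    by rewrite [X in _ = _ + X]addrACA addNr subrr !addr0.
  apply: le_trans (ler_enormD _ _) _; rewrite lerD2l.
  apply: le_trans (ler_enormD _ _) _; rewrite enormN mulrDr ![enorm (x - y) * _]mulrC.
  by apply: lerD => //; exact: (mean_op_lipschitz model).
- have hD : 1 + D ^+ 4 <= (1 + D ^+ 2) ^+ 2 by rewrite pow4E; have := sqr_ge0 D; nra.
  have h5 : enorm (x - y) ^+ 4 <= 8 * D ^+ 4 + 8 * D1 ^+ 4.
    by apply: le_trans (pow4D_le _ _); rewrite !pow4E !sqr_ler ?sqr_ge0.
  have D40 : 0 <= D ^+ 4 by rewrite exprn_ge0.
  have D140 : 0 <= D1 ^+ 4 by rewrite exprn_ge0.
  have f1 : 0 <= 8 * f + 8 * Tf ^+ 4 by rewrite addr_ge0// mulr_ge0// exprn_ge0.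
  rewrite -/q /m -/D1; move: (8 * f + 8 * Tf ^+ 4) f1 => u u0.
  apply: (@le_trans _ _ (8 * u + 8 * (8 * D ^+ 4 + 8 * D1 ^+ 4) * q)).
    by rewrite lerD2l ler_wpM2r// ler_pM2l.
  apply: (@le_trans _ _ ((8 * u + 8 * q * (8 + 8 * D1 ^+ 4)) * (1 + D ^+ 4))); last first.
    rewrite ler_wpM2l// addr_ge0// mulr_ge0// ?mulr_ge0// addr_ge0// mulr_ge0//.
  have k1 : 0 <= u * D ^+ 4 by rewrite mulr_ge0.
  have k2 : 0 <= q * D1 ^+ 4 * D ^+ 4 by rewrite !mulr_ge0.
  move: (D ^+ 4) (D1 ^+ 4) k1 k2 D40 D140 => v w k1 k2 v0 w0.
  by lra.
Qed.

(** [C] is chosen before the probability space, the sample size and the point, so a single constant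
    serves all iterations. *)
Lemma search_error_bound (xs : 'rV[R]_d) : X xs -> search_moments ->
  exists2 C, 0 <= C & forall (dW : measure_display) (W : measurableType dW)
    (Pr : probability W R) (M : nat) (s : 'I_M -> W -> Xi) (x : 'rV[R]_d),
    (0 < M)%N -> iid_sample P Pr s -> X x ->
    mean_le Pr (fun w => enorm (emp_err P F (fun j => s j w)
        (search_point X F ah theta lam s x w)) ^+ 2)
      (C / M%:R * (1 + enorm (x - xs) ^+ 2)).
Proof.
move=> Xxs sm.
have L0 : 0 <= L := Lmean_ge0 model.
have LQ1 : 1 <= LQ := Lq_ge1 model.
have /andP[th0 th1] := theta01.
have [CH CH0 hCH] : exists2 CH, 0 <= CH & forall (dW : measure_display) (W : measurableType dW)
    (Pr : probability W R) (M : nat) (s : 'I_M -> W -> Xi) (x : 'rV[R]_d),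
    (0 < M)%N -> iid_sample P Pr s -> X x ->
    exists h : W -> R, mean_le Pr h (CH / M%:R * (1 + enorm (x - xs) ^+ 2)) /\
      forall w u v, X u -> X v -> enorm (u - v) <= enorm (emp_err P F (fun j => s j w) x) ->
       (Lip_avg Lip s w - L) ^+ 2 * enorm (u - v) ^+ 2 <= h w.
  case: sm => [[B hB]|[l4 F4]].
    exists (B ^+ 2 * LQ ^+ 2); first by rewrite mulr_ge0// sqr_ge0.
    move=> dW W Pr M s x M0 iid Xx; exists (fun w => B ^+ 2 * (Lip_avg Lip s w - L) ^+ 2); split.
      apply: (mean_le_le (mean_leZ (sqr_ge0 B) (mean_le_Lip_avgB_sqr model M0 iid))).
      rewrite -/LQ mulrA -[leLHS]mulr1 ler_wpM2l//.
        by rewrite divr_ge0// mulr_ge0// sqr_ge0.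
      by rewrite lerDl sqr_ge0.
    move=> w u v Xu Xv _; rewrite mulrC ler_wpM2r ?sqr_ge0// sqr_ler ?enorm_ge0//.
    exact: hB.
  have [[m1 m1P] [m2 m2P]] := noise_pow4 l4 F4 Xxs.
  have m10 := mean_le_ge0 m1P.
  have m20 : 0 <= m2.
    by have := mean_le_ge0 (m2P xs Xxs); rewrite pmulr_lge0// exprn_gt0// ltr_wpDr ?sqr_ge0.
  pose r1 := Num.sqrt (7 * m1); pose r2 := Num.sqrt (7 * d%:R ^+ 2 * m2).
  have r10 : 0 <= r1 := sqrtr_ge0 _; have r20 : 0 <= r2 := sqrtr_ge0 _.
  exists (r1 * r2); first by rewrite mulr_ge0.
  move=> dW W Pr M s x M0 iid Xx.
  have M0R : 0 < M%:R :> R by rewrite ltr0n.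
  have M1R : 1 <= M%:R :> R by rewrite ler1n.
  pose e w := enorm (emp_err P F (fun j => s j w) x).
  exists (fun w => (Lip_avg Lip s w - L) ^+ 2 * e w ^+ 2); split; last first.
    by move=> w u v _ _ h; rewrite ler_wpM2l ?sqr_ge0// sqr_ler ?enorm_ge0.
  set D2 := 1 + enorm (x - xs) ^+ 2.
  have D20 : 0 <= D2 by rewrite addr_ge0// sqr_ge0.
  have msd : measurable_fun setT (fun w => (Lip_avg Lip s w - L) ^+ 2).
    by have [] := mean_le_Lip_avgB_sqr model M0 iid.
  have me : measurable_fun setT (fun w => e w ^+ 2).
    by have [] := mean_le_emp_err model M0 iid Xx (sigma2_mean model Xx).2.
  have ha : mean_le Pr (fun w => ((Lip_avg Lip s w - L) ^+ 2) ^+ 2) ((r1 / M%:R) ^+ 2).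
    have E : (fun w => ((Lip_avg Lip s w - L) ^+ 2) ^+ 2) = fun w => (M%:R^-1 * \sum_j (Lip (s j w) - L)) ^+ 4.
      apply/funext => w; rewrite -pow4E; congr (_ ^+ 4); rewrite sumrB mulrBr; congr (_ - _).
      by rewrite sumr_const card_ord -[X in _ * X]mulr_natl mulKf// gt_eqF.
    rewrite E expr_div_n sqr_sqrtr ?mulr_ge0//.
    apply: (mean_le_sample_pow4 M0 iid (g := fun t => Lip t - L)) => //.
      by apply: measurable_funB.
    exact: (Lip_centered model).
  have hb : mean_le Pr (fun w => (e w ^+ 2) ^+ 2) ((r2 * D2 / M%:R) ^+ 2).
    have := mean_le_vsample_pow4 M0 iid (vmeas_noise model Xx) (noise_centered model Xx) (m2P x Xx).
    rewrite -/D2 expr_div_n exprMn sqr_sqrtr ?mulr_ge0 ?sqr_ge0// !mulrA.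
    rewrite (_ : (fun w => (e w ^+ 2) ^+ 2) = fun w => enorm (M%:R^-1 *: \sum_j noise P F x (s j w)) ^+ 4)//.
    by apply/funext => w; rewrite -pow4E /e emp_errE.
  have := mean_leM (divr_ge0 r10 (ltW M0R)) (divr_ge0 (mulr_ge0 r20 D20) (ltW M0R)) msd me
    (fun=> sqr_ge0 _) (fun=> sqr_ge0 _) ha hb.
  move=> h; apply: (mean_le_le h).
  (* Both factors are of order [1 / M], so the product is of order [1 / M^2]; one factor is given
     up. *)
  have -> : r1 / M%:R * (r2 * D2 / M%:R) = r1 * r2 / M%:R * D2 * M%:R^-1 by ring.
  rewrite ler_piMr// ?invf_le1//.
  by rewrite mulr_ge0// divr_ge0// ?mulr_ge0// ltW.
have [s0 _] := sigma2_mean model Xxs.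
set S := sigma P F 2 xs in s0.
pose cS := 2 * S ^+ 2 + 2 * LQ ^+ 2.
have cS0 : 0 <= cS by rewrite addr_ge0// mulr_ge0// sqr_ge0.
pose cT := 2 * enorm (T xs) ^+ 2 + 2 * L ^+ 2.
have cT0 : 0 <= cT by rewrite addr_ge0// mulr_ge0// sqr_ge0.
have cL : 0 <= 3 + 24 * L ^+ 2 by rewrite addr_ge0// mulr_ge0// sqr_ge0.
have th10 : 0 <= (1 - theta)^-1 by rewrite invr_ge0 subr_ge0 ltW.
exists ((3 + 24 * L ^+ 2) * cS + 6 * CH + 3 * (cT * LQ ^+ 2 * (1 - theta)^-1)).
  apply: addr_ge0; last by rewrite mulr_ge0// mulr_ge0// mulr_ge0// sqr_ge0.
  by apply: addr_ge0; exact: mulr_ge0.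
move=> dW W Pr M s x M0 iid Xx.
have [h [hH hle]] := hCH _ _ _ _ _ _ M0 iid Xx.
have := mean_le_search_error model ah01 theta01 lam0 M0 iid Xx (noise_sqr model Xx Xxs) hH hle.
move=> hm; apply: (mean_le_le hm).
have M0R : 0 < M%:R :> R by rewrite ltr0n.
rewrite -/LQ -/S -/L -/T; set D := enorm (x - xs).
have D0 : 0 <= D := enorm_ge0 _.
have hS : (S + LQ * D) ^+ 2 <= cS * (1 + D ^+ 2).
  rewrite /cS; have := sqr_ge0 (S - LQ * D); have := sqr_ge0 (S * D); have := sqr_ge0 LQ.
  rewrite !exprMn; nra.
have hT : enorm (T x) ^+ 2 <= cT * (1 + D ^+ 2).
  have h1 := enormD_sqr (T xs) (T x - T xs).
  rewrite addrC subrK in h1; apply: (le_trans h1).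
  have h2 : enorm (T x - T xs) ^+ 2 <= L ^+ 2 * D ^+ 2.
    rewrite -exprMn sqr_ler ?enorm_ge0//; exact: (mean_op_lipschitz model).
  have h3 : 0 <= enorm (T xs) ^+ 2 * D ^+ 2 by rewrite mulr_ge0 ?sqr_ge0.
  have h4 := sqr_ge0 L.
  rewrite /cT; move: (enorm (T xs) ^+ 2) (enorm (T x - T xs) ^+ 2) (D ^+ 2) (L ^+ 2) h2 h3 h4.
  move=> p q r u h2 h3 h4; lra.
have -> : ((3 + 24 * L ^+ 2) * cS + 6 * CH + 3 * (cT * LQ ^+ 2 * (1 - theta)^-1)) / M%:R * (1 + D ^+ 2)
  = (3 + 24 * L ^+ 2) * (cS * (1 + D ^+ 2) / M%:R) + 6 * (CH / M%:R * (1 + D ^+ 2))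
   + 3 * (cT * (1 + D ^+ 2) * LQ ^+ 2 / M%:R * (1 - theta)^-1) by ring.
apply: lerD; first apply: lerD => //.
  by rewrite ler_wpM2l// ler_wpM2r// invr_ge0 ltW.
rewrite ler_pM2l// ler_wpM2r// ler_wpM2r ?invr_ge0 ?(ltW M0R)//.
by rewrite ler_wpM2r// sqr_ge0.
Qed.

End OwnBounds.

(** * The iterates and their history *)

Section Iterates.
Context {R : realType} {d : nat} {dXi : measure_display} {Xi : measurableType dXi}.
Variables (P : probability Xi R) (X : set 'rV[R]_d).
Variables (F : Xi -> 'rV[R]_d -> 'rV[R]_d) (Lip : Xi -> R).
Hypothesis model : square_integrable_model P X F Lip.
Variables (ah theta lam : R).
Hypotheses (ah01 : 0 < ah <= 1) (theta01 : 0 < theta < 1) (lam0 : 0 < lam).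
Variable x0 : 'rV[R]_d.
Hypothesis Xx0 : X x0.
Context {dW : measure_display} {W : measurableType dW}.
Variables (Pr : probability W R) (Nk : nat -> nat) (xi eta : forall k, 'I_(Nk k) -> W -> Xi).
Hypotheses (Nk0 : forall k, (0 < Nk k)%N) (iid : iid_sample P Pr (all_draws xi eta)).

Let X0 : X !=set0 := model_nonempty model.
Let Xcl : closed X := model_closed model.
Let Xcvx : convex_set X := model_convex model.
Let mF : random_operator X F := model_measurable model.

Let T := mean_op P F.

Let ah0 : 0 < ah. Proof. by case/andP: ah01. Qed.

Let Y := all_draws xi eta.
Let I : eqType := ({k & 'I_(Nk k)} + {k & 'I_(Nk k)})%type.

Let x := iterate X F ah theta lam x0 xi eta.

Lemma iterateX k w : X (x k w).
Proof. by case: k => [|k] //; exact: projX. Qed.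

Definition draw_time (i : I) : nat := match i with inl u => tag u | inr u => tag u end.

Definition past (k : nat) : set I := [set i | (draw_time i < k)%N].

Definition present (k : nat) : set I := [set i | draw_time i = k].

Lemma history_draws k : history xi eta k = <<s draw_events Y (past k)>>.
Proof.
rewrite /history; congr (<<s _ >>); apply/seteqP; split => A /=.
  move=> [i [j [B [ik mB [->|->]]]]].
    by exists (inl (Tagged (fun k => 'I_(Nk k)) j)), B.
  by exists (inr (Tagged (fun k => 'I_(Nk k)) j)), B.
by move=> [[[i j]|[i j]] [B [ik mB ->]]]; exists i, j, B; split => //; [left|right].
Qed.

Let mY i : measurable_fun setT (Y i). Proof. by have [] := iid. Qed.

Lemma history_measurable k : history xi eta k `<=` measurable.
Proof.
rewrite history_draws; apply: smallest_sub; first exact: sigma_algebra_measurable.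
exact: draw_events_measurable.
Qed.

Lemma indep_past_present k :
  indep_systems Pr <<s draw_events Y (past k)>> <<s draw_events Y (present k)>>.
Proof.
apply: indep_draws => //; first by have [] := iid.
apply/seteqP; split => // i [ik ki].
by have : (draw_time i < k)%N := ik; rewrite (ki : draw_time i = k) ltnn.
Qed.

Lemma iid_present k : iid_sample P Pr (both_samples (@xi k) (@eta k)).
Proof.
pose g (i : 'I_(Nk k) + 'I_(Nk k)) : I := match i with
  | inl j => inl (Tagged (fun k => 'I_(Nk k)) j)
  | inr j => inr (Tagged (fun k => 'I_(Nk k)) j) end.
have ginj : injective g.
  move=> [i|i] [j|j] //= [] /eqP.
    by rewrite -tag_eqE /tag_eq/= eqxx tagged_asE => /eqP ->.
  by rewrite -tag_eqE /tag_eq/= eqxx tagged_asE => /eqP ->.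
have := iid_sample_inj ginj iid.
by rewrite (_ : (fun j => _) = both_samples (@xi k) (@eta k))//; apply/funext => -[i|i].
Qed.

(** The map [g] may be the identity from [W] itself or from [W] with a smaller sigma-algebra, so one
    induction gives measurability as well as adaptedness to the past draws. *)
Lemma vmeas_iterate {dV : measure_display} (V : measurableType dV) (g : V -> W) k :
  (forall i (j : 'I_(Nk i)), (i < k)%N ->
     measurable_fun setT (@xi i j \o g) /\ measurable_fun setT (@eta i j \o g)) ->
  vmeas (fun v => x k (g v)).
Proof.
elim: k => [|k IH] hk; first exact: vmeas_cst.
have {}IH : vmeas (fun v => x k (g v)) by apply: IH => i j ik; apply: hk; exact: ltnW.
have mxi j : measurable_fun setT (fun v => @xi k j (g v)) by have [] := hk k j (leqnn _).
have meta j : measurable_fun setT (fun v => @eta k j (g v)) by have [] := hk k j (leqnn _).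
have mal : measurable_fun setT (fun v => line_search X F ah theta lam (fun j => @xi k j (g v)) (x k (g v))).
  by apply: (measurable_line_search X0 Xcl Xcvx mF (s := fun j v => @xi k j (g v))) => // v; exact: iterateX.
have mz : vmeas (fun v => trial_point X F (fun j => @xi k j (g v)) (x k (g v))
    (line_search X F ah theta lam (fun j => @xi k j (g v)) (x k (g v)))).
  by apply: (vmeas_trial_point X0 Xcl Xcvx mF (s := fun j v => @xi k j (g v))) => // v; exact: iterateX.
apply: (vmeas_proj X0 Xcl Xcvx); apply: vmeasB => //; apply: vmeasZ => //.
by apply: (vmeas_emp_op Xcl mF (s := fun j v => @eta k j (g v))) => // v; exact: projX.
Qed.

Let WH k := g_sigma_algebraType (draw_events Y (past k)).
Let WP k := g_sigma_algebraType (draw_events Y (present k)).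

Let mxi_past k i (j : 'I_(Nk i)) : (i < k)%N ->
  measurable_fun setT (@xi i j : WH k -> Xi) /\ measurable_fun setT (@eta i j : WH k -> Xi).
Proof.
move=> ik; split.
  exact: (@measurable_draw_sigma _ _ _ _ _ Y (past k) (inl (Tagged (fun k => 'I_(Nk k)) j))).
exact: (@measurable_draw_sigma _ _ _ _ _ Y (past k) (inr (Tagged (fun k => 'I_(Nk k)) j))).
Qed.

Let mxi_present k (j : 'I_(Nk k)) :
  measurable_fun setT (@xi k j : WP k -> Xi) /\ measurable_fun setT (@eta k j : WP k -> Xi).
Proof.
split.
  exact: (@measurable_draw_sigma _ _ _ _ _ Y (present k) (inl (Tagged (fun k => 'I_(Nk k)) j))).
exact: (@measurable_draw_sigma _ _ _ _ _ Y (present k) (inr (Tagged (fun k => 'I_(Nk k)) j))).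
Qed.

Lemma vmeas_iterate_past k : vmeas (x k : WH k -> 'rV[R]_d).
Proof. by apply: (@vmeas_iterate _ (WH k) id) => i j ik; exact: mxi_past. Qed.

Lemma vmeas_iterateT k : vmeas (x k : W -> 'rV[R]_d).
Proof.
apply: (@vmeas_iterate _ W id) => i j _; split.
  exact: (mY (inl (Tagged (fun k => 'I_(Nk k)) j))).
exact: (mY (inr (Tagged (fun k => 'I_(Nk k)) j))).
Qed.

Lemma vmeas_iterate_fst k : vmeas (fun p : WH k * WP k => x k p.1).
Proof. by move=> i; apply: (measurableT_comp (vmeas_iterate_past i)). Qed.

Lemma vmeas_stop_point k :
  vmeas (fun p : WH k * WP k => trial_point X F (fun j => @xi k j p.2) (x k p.1) ah).
Proof.
apply: (vmeas_trial_point X0 Xcl Xcvx mF (s := fun j (p : WH k * WP k) => @xi k j p.2)) => //.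
- by move=> j; apply: (measurableT_comp (mxi_present j).1).
- exact: vmeas_iterate_fst.
- by move=> p; exact: iterateX.
Qed.

Lemma vmeas_next k : vmeas (fun p : WH k * WP k =>
  next_point X F ah theta lam (@xi k) (@eta k) (x k p.1) p.2 p.2).
Proof.
have m1 j : measurable_fun setT (fun p : WH k * WP k => @xi k j p.2).
  by apply: (measurableT_comp (mxi_present j).1).
have m2 j : measurable_fun setT (fun p : WH k * WP k => @eta k j p.2).
  by apply: (measurableT_comp (mxi_present j).2).
have mx := @vmeas_iterate_fst k.
have Xx (p : WH k * WP k) : X (x k p.1) by exact: iterateX.
have mal : measurable_fun setT (fun p : WH k * WP k =>
    line_search X F ah theta lam (fun j => @xi k j p.2) (x k p.1)).
  exact: (measurable_line_search X0 Xcl Xcvx mF lam ah0 theta01 m1 mx Xx).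
apply: (vmeas_proj X0 Xcl Xcvx); apply: vmeasB => //; apply: vmeasZ => //.
apply: (vmeas_emp_op Xcl mF (s := fun j (p : WH k * WP k) => @eta k j p.2)) => //.
  exact: (vmeas_trial_point X0 Xcl Xcvx mF m1 mx Xx mal).
by move=> p; exact: projX.
Qed.

Lemma measurable_residual {dV : measure_display} (V : measurableType dV) (u : V -> 'rV[R]_d) :
  vmeas u -> (forall v, X (u v)) -> measurable_fun setT (fun v => residual X T (u v)).
Proof.
move=> mu Xu.
rewrite (_ : (fun v => _) = (fun y => residual X T (proj X y)) \o u); last first.
  by apply/funext => v /=; rewrite proj_id.
apply: vmeas_continuous => //.
exact: lipschitz_enorm_continuous (residual_proj_lipschitz model).
Qed.

Lemma history_sub k : history xi eta k `<=` history xi eta k.+1.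
Proof.
apply: sub_sigma_algebra2 => A [i [j [B [ik mB AE]]]].
by exists i, j, B; split => //; exact: leqW.
Qed.

Lemma historyI k A B : history xi eta k A -> history xi eta k B -> history xi eta k (A `&` B).
Proof. by rewrite history_draws => hA hB; apply: (@measurableI _ (WH k)). Qed.

Lemma historyC k A : history xi eta k A -> history xi eta k (~` A).
Proof. by rewrite history_draws => hA; apply: (@measurableC _ (WH k)). Qed.

Lemma historyT k : history xi eta k setT.
Proof. by rewrite history_draws; apply: (@measurableT _ (WH k)). Qed.

Lemma history_dist_lt k (xs : 'rV[R]_d) t :
  history xi eta k [set w | 1 + enorm (x k w - xs) ^+ 2 < t].
Proof.
rewrite history_draws.
have mf : measurable_fun setT (fun w : WH k => 1 + enorm (x k w - xs) ^+ 2).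
  apply: measurable_funD; first exact: measurable_cst.
  apply: measurable_funX; apply: measurable_enorm.
  by apply: vmeasB; [exact: vmeas_iterate_past | exact: vmeas_cst].
have := mf measurableT _ (measurable_itv `]-oo, t[).
by rewrite setTI; congr (measurable _); apply/seteqP; split => w /=; rewrite in_itv.
Qed.

(** The test at index [k] reads the sample [xi k], which enters the history only at [k.+1]. *)
Lemma history_stop_test k :
  history xi eta k.+1 (stop_test X F ah theta lam x0 xi eta k).
Proof.
rewrite history_draws.
have mx : vmeas (x k : WH k.+1 -> 'rV[R]_d).
  by apply: (@vmeas_iterate _ (WH k.+1) id) => i j ik; exact: (mxi_past j (leqW ik)).
have mt : vmeas (fun w : WH k.+1 => trial_point X F (fun j => @xi k j w) (x k w) ah).
  apply: (vmeas_trial_point X0 Xcl Xcvx mF (s := fun j (w : WH k.+1) => @xi k j w)) => //.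
  - by move=> j; have [] := mxi_past j (ltnSn k).
  - by move=> w; exact: iterateX.
have := measurable_enorm (vmeasB mx mt) measurableT (measurable_set1 0).
rewrite setTI; congr (measurable _); apply/seteqP; split => w /=.
  by move/enorm_eq0/eqP; rewrite subr_eq0 => /eqP.
by move=> h; rewrite /stop_test/= -/x in h; rewrite [X in X - _]h subrr enorm0.
Qed.

Lemma history_generated k :
  history xi eta k (generated X F ah theta lam x0 xi eta k).
Proof.
elim: k => [|k IH].
  rewrite (_ : generated _ _ _ _ _ _ _ _ 0 = setT); first exact: historyT.
  by apply/seteqP; split.
rewrite (_ : generated _ _ _ _ _ _ _ _ k.+1 =
    generated X F ah theta lam x0 xi eta k `&` ~` stop_test X F ah theta lam x0 xi eta k).
  by apply: historyI; [exact: history_sub | apply: historyC; exact: history_stop_test].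
apply/seteqP; split => [w h|w [h1 h2] i].
  by split => [i ik|]; apply: h => //; exact: leqW.
by rewrite ltnS leq_eqVlt => /orP[/eqP ->|ik]; [exact: h2 | exact: h1].
Qed.

Let gain := residual_gain P X F Lip ah theta lam.

Lemma measurable_gain {dV : measure_display} (V : measurableType dV) (u : V -> 'rV[R]_d) :
  vmeas u -> (forall v, X (u v)) -> measurable_fun setT (fun v => gain (u v)).
Proof.
move=> mu Xu; apply: measurable_funM; first exact: measurable_cst.
by apply: measurable_funX; exact: measurable_residual.
Qed.

Hypothesis lam6 : 6 * lam ^+ 2 <= 1.

(** A one-step bound at every fixed point of [X] passes to the random iterate, which is frozen
    because past and present draws are independent. The constant [e] is 1 for the almost
    supermartingale and 0 for the rate. *)
Lemma mean_le_iterate k (A : set W) (xs : 'rV[R]_d) (E : 'rV[R]_d -> R) e c :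
  history xi eta k A -> 0 <= e ->
  (forall y, X y -> mean_le Pr (fun w =>
     enorm (next_point X F ah theta lam (@xi k) (@eta k) y w w - xs) ^+ 2 + gain y) (E y)) ->
  mean_le Pr (fun w => \1_A w * (E (x k w) + e)) c ->
  mean_le Pr (fun w => \1_A w * (enorm (x k.+1 w - xs) ^+ 2 + gain (x k w) + e)) c.
Proof.
rewrite history_draws => hA e0 hE hc.
have gain0 y : 0 <= gain y by exact: residual_gain_ge0.
pose f (p : WH k * WP k) := \1_A p.1 *
  (enorm (next_point X F ah theta lam (@xi k) (@eta k) (x k p.1) p.2 p.2 - xs) ^+ 2 + gain (x k p.1) + e).
have mf : measurable_fun setT f.
  apply: measurable_funM.
    have mA : measurable_fun setT (\1_A : WH k -> R) by exact: measurable_indic.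
    exact: (measurableT_comp mA measurable_fst).
  apply: measurable_funD; last exact: measurable_cst.
  apply: measurable_funD.
    apply: measurable_funX; apply: measurable_enorm; apply: vmeasB; last exact: vmeas_cst.
    exact: vmeas_next.
  by apply: measurable_gain; [exact: vmeas_iterate_fst | move=> p; exact: iterateX].
have f0 p : 0 <= f p.
  by rewrite /f mulr_ge0 ?addr_ge0 ?sqr_ge0// indicE.
have := mean_le_indep (draw_events_measurable mY (S := past k))
  (draw_events_measurable mY (S := present k)) (@indep_past_present k) mf f0 hc.
apply; apply: aeW => w; rewrite /f/=; apply: mean_leZ; first by rewrite indicE.
apply: mean_leD; last exact: mean_le_cst.
by apply: hE; exact: iterateX.
Qed.

(** If [dot (T y) (u - y)] were negative for some [u] in [X], the fixed-point equation would force
    the centred variable [e] to be at least the positive constant [c] almost surely, against its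
    zero mean. *)
Lemma ae_trial_fixed_solution (M : nat) (s : 'I_M -> W -> Xi) (y : 'rV[R]_d) :
  (0 < M)%N -> iid_sample P Pr s -> X y ->
  {ae Pr, forall w, y = trial_point X F (fun j => s j w) y ah} -> solutions X T y.
Proof.
move=> M0 iids Xy hy; split=> // u Xu; rewrite leNgt; apply/negP => Tu0.
pose e w := dot (u - y) (emp_err P F (fun j => s j w) y).
have [ie e0] := emp_err_centered model M0 iids (u - y) Xy.
pose c := - dot (T y) (u - y); have c0 : 0 < c by rewrite oppr_gt0.
have me : measurable_fun setT e by have /measurable_int/measurable_EFinP := ie.
have mcst : measurable_fun setT (fun _ : W => c) by exact: measurable_cst.
(* The maximum with [c] agrees with [e] almost everywhere and is at least [c] everywhere, so its
   integral is zero and yet at least [c]. *)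
have mm : measurable_fun setT (fun w => Num.max (e w) c) by exact: measurable_maxr.
have E : (\int[Pr]_w (Num.max (e w) c)%:E = 0)%E.
  rewrite -e0; apply: ae_eq_integral => //; try exact/measurable_EFinP.
  apply: filterS hy => w yE _; congr (_%:E); apply/max_idPl.
  have := proj_vi X0 Xcl Xcvx (y - ah *: emp_op F (fun j => s j w) y) Xu.
  rewrite -/(trial_point X F (fun j => s j w) y ah) -yE addrAC subrr add0r dotNl dotZl.
  rewrite oppr_le0 pmulr_rge0// => h.
  by rewrite /c /e (dotC (u - y)) /emp_err dotDl dotNl -/T lerDr.
have : (c%:E <= 0)%E.
  rewrite -E; have [_ _ _] := mean_le_cst Pr (ltW c0).
  have -> : c%:E = (\int[Pr]_w (fun=> c%:E) w)%E.
    by rewrite integral_cst// [X in (_ * X)%E](_ : _ = 1%E) ?mule1//; exact: probability_setT.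
  apply: ge0_le_integral => //.
  - by move=> w _; rewrite lee_fin ltW.
  - exact/measurable_EFinP.
  - by move=> w _; rewrite lee_fin le_max lexx orbT.
by rewrite lee_fin leNgt c0.
Qed.

(** One sample that fixes the iterate does not make it a solution. On a past event where stopping is
    almost sure, independence shows that, for almost every frozen past, almost every fresh sample
    fixes the iterate; [ae_trial_fixed_solution] applies to this constant point. *)
Lemma stopped_solution k (A : set W) : history xi eta k A ->
  {ae Pr, forall w, A w -> x k w = trial_point X F (fun j => @xi k j w) (x k w) ah} ->
  {ae Pr, forall w, A w -> solutions X T (x k w)}.
Proof.
move=> hA stp; have mA := history_measurable hA.
rewrite history_draws in hA.
(* [g] measures the violation of the stopping test on [A]. Its integral is zero; written as an
   iterated integral, this gives a zero inner integral for almost every past. *)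
pose g (p : WH k * WP k) : R := \1_A p.1 *
  enorm (x k p.1 - trial_point X F (fun j => @xi k j p.2) (x k p.1) ah).
have mg : measurable_fun setT g.
  apply: measurable_funM.
    have mA' : measurable_fun setT (\1_A : WH k -> R) by exact: measurable_indic.
    exact: (measurableT_comp mA' measurable_fst).
  by apply: measurable_enorm; apply: vmeasB; [exact: vmeas_iterate_fst | exact: vmeas_stop_point].
have g0 p : 0 <= g p by rewrite /g mulr_ge0 ?enorm_ge0// indicE.
have mEg : measurable_fun setT (EFin \o g) by exact/measurable_EFinP.
have mpast := draw_events_measurable mY (S := past k).
have mpres := draw_events_measurable mY (S := present k).
have mdiag : measurable_fun setT (fun w : W => g (w, w)).
  apply: (measurableT_comp mg).
  by apply/measurable_fun_pairP; split; exact: measurable_id_sigma.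
have mEd : measurable_fun setT (EFin \o (fun w : W => g (w, w))) by exact/measurable_EFinP.
have Eg : (\int[Pr]_w (EFin \o g) (w, w) = 0)%E.
  transitivity (\int[Pr]_(w in setT) cst 0%E w)%E; last exact: integral0.
  apply: (@ae_eq_integral _ W R Pr setT (cst 0%E) (EFin \o (fun w : W => g (w, w))) measurableT).
  - exact: mEd.
  - exact: measurable_cst.
  apply: filterS stp => w hw _; rewrite /g/= indicE.
  have [wA|wA] := boolP (w \in A); last by rewrite mul0r.
  by rewrite mul1r -hw ?subrr ?enorm0//; exact: set_mem.
rewrite (integral_indep mpast mpres (@indep_past_present k) mEg) in Eg; last by move=> p; rewrite lee_fin.
have ms : measurable_fun setT (fun w1 : W => \int[Pr]_w2 (EFin \o g) (w1, w2))%E.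
  have h := @measurable_indep_section _ _ _ Pr (draw_events Y (past k)) _ mpres (EFin \o g) mEg (fun p => g0 p).
  exact: (measurableT_comp h (measurable_id_sigma mpast)).
have /(ae_eq_integral_abs Pr measurableT ms) : (\int[Pr]_w1 `|\int[Pr]_w2 (EFin \o g) (w1, w2)| = 0)%E.
  rewrite -[RHS]Eg; apply: eq_integral => w _; rewrite gee0_abs//.
  by apply: integral_ge0 => w2 _; rewrite lee_fin.
apply: filterS => w1 /(_ Logic.I) hw1 Aw1.
have iid_xi := iid_fst (iid_present k).
apply: (ae_trial_fixed_solution (Nk0 k) iid_xi (iterateX k w1)).
have m2 : measurable_fun setT (fun w2 : W => (EFin \o g) (w1, w2)).
  have h : measurable_fun setT (fun w2 : WP k => (EFin \o g) (w1 : WH k, w2)).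
    exact: (measurableT_comp mEg (measurable_pair1 (w1 : WH k))).
  exact: (measurableT_comp h (measurable_id_sigma mpres)).
have /(ae_eq_integral_abs Pr measurableT m2) : (\int[Pr]_w2 `|(EFin \o g) (w1, w2)| = 0)%E.
  rewrite -[RHS]hw1; apply: eq_integral => w _; rewrite gee0_abs// lee_fin; exact: g0.
apply: filterS => w2 /(_ Logic.I) [].
rewrite /g/= indicE mem_set// mul1r => /enorm_eq0 /eqP.
by rewrite subr_eq0 => /eqP.
Qed.

End Iterates.

(** * One-step bound for the asymptotic statements *)

Section StepBounds.
Context {R : realType} {d : nat} {dXi : measure_display} {Xi : measurableType dXi}.
Variables (P : probability Xi R) (X : set 'rV[R]_d).
Variables (F : Xi -> 'rV[R]_d -> 'rV[R]_d) (Lip : Xi -> R).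
Hypothesis model : square_integrable_model P X F Lip.
Variables (ah theta lam : R).
Hypotheses (ah01 : 0 < ah <= 1) (theta01 : 0 < theta < 1) (lam0 : 0 < lam).

Let X0 : X !=set0 := model_nonempty model.
Let Xcl : closed X := model_closed model.
Let Xcvx : convex_set X := model_convex model.

Let T := mean_op P F.
Let L := Lmean P Lip.
Let LQ := Lq P Lip 2.
Let ah0 : 0 < ah. Proof. by case/andP: ah01. Qed.

Section Sample.
Context {dW : measure_display} {W : measurableType dW}.
Variables (Pr : probability W R) (M : nat) (s : 'I_M -> W -> Xi).
Hypotheses (M0 : (0 < M)%N) (iid : iid_sample P Pr s).
Variables (x xs : 'rV[R]_d).
Hypotheses (Xx : X x) (sol : solutions X T xs).

(** The bound holds at every [w], as [trial_error_bound] demands: an empty set of accepted steps has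
    [sup] equal to 0. *)
Lemma search_step_itv w : 0 <= search_step X F ah theta lam s x w <= ah.
Proof.
have /andP[th0 th1] := theta01.
rewrite /search_step /line_search; set A := [set _ | _].
have A0 al : A al -> 0 <= al by move=> [l -> _]; rewrite mulr_ge0 ?exprn_ge0// ltW.
have Aah : ubound A ah.
  by move=> _ [l -> _]; rewrite ger_pMl// exprn_ile1// ltW.
have [[al Aal]|nA] := pselect (A !=set0).
  apply/andP; split; last by apply: ge_sup => //; exists al.
  by apply: le_trans (A0 _ Aal) _; apply: ub_le_sup => //; exists ah.
by rewrite sup_out ?lexx ?ltW// => -[].
Qed.

(** A solution is fixed by projected steps of every length, so [xs] can be written with the accepted
    random step itself before nonexpansiveness compares the two points. *)
Lemma search_point_dist w :
  enorm (search_point X F ah theta lam s x w - xs) <=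
  (1 + L * ah) * enorm (x - xs) + ah * enorm (emp_err P F (fun j => s j w) x).
Proof.
have /andP[al0 alah] := search_step_itv w.
have [Xxs _] := sol.
rewrite /search_point /trial_point.
set al := search_step X F ah theta lam s x w in al0 alah *.
rewrite -[X in enorm (_ - X)](solution_residual0 X0 Xcl Xcvx al0 sol).
apply: le_trans (proj_nonexpansive X0 Xcl Xcvx _ _) _.
set g := emp_op F (fun j => s j w) x.
have -> : x - al *: g - (xs - al *: T xs) =
    (x - xs) + (- (al *: (g - T x)) - al *: (T x - T xs)).
  rewrite opprD opprK addrACA; congr (_ + _).
  by rewrite -opprD -scalerDr subrKA scalerBr opprB addrC.
apply: le_trans (ler_enormD _ _) _; rewrite mulrDl mul1r -addrA lerD2l.
apply: le_trans (ler_enormD _ _) _; rewrite !enormN !enormZ (ger0_norm al0) addrC.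
apply: lerD; first by apply: ler_wpM2r; [exact: enorm_ge0 | exact: alah].
rewrite [L * ah]mulrC -mulrA; apply: ler_pM => //; first exact: enorm_ge0.
exact: (mean_op_lipschitz model).
Qed.

Lemma mean_le_search_dist (p q Q : R) : 0 <= p -> 0 <= q -> 0 <= Q ->
  mean_le Pr (fun w => enorm (emp_err P F (fun j => s j w) x) ^+ 2) (Q ^+ 2) ->
  mean_le Pr (fun w => (p + q * enorm (search_point X F ah theta lam s x w - xs)) ^+ 2)
    ((p + q * ((1 + L * ah) * enorm (x - xs) + ah * Q)) ^+ 2).
Proof.
move=> p0 q0 Q0 hQ.
have L0 : 0 <= L := Lmean_ge0 model.
have ah0' := ltW ah0.
have D0 := enorm_ge0 (x - xs).
pose a := p + q * ((1 + L * ah) * enorm (x - xs)).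
have a0 : 0 <= a by rewrite addr_ge0// mulr_ge0// mulr_ge0// addr_ge0// mulr_ge0.
have me : measurable_fun setT (fun w => enorm (emp_err P F (fun j => s j w) x)).
  by apply: measurable_enorm; apply: (vmeas_emp_err model iid (x := fun=> x)) => //; exact: vmeas_cst.
have qa0 : 0 <= q * ah by rewrite mulr_ge0.
have h1 : mean_le Pr (fun w => (q * ah * enorm (emp_err P F (fun j => s j w) x)) ^+ 2) ((q * ah * Q) ^+ 2).
  rewrite exprMn; under eq_fun do rewrite exprMn.
  by apply: mean_leZ => //; exact: sqr_ge0.
have mq : measurable_fun setT (fun w => q * ah * enorm (emp_err P F (fun j => s j w) x)).
  by apply: measurable_funM => //; exact: measurable_cst.
have h2 := mean_leD_sqr a0 (mulr_ge0 qa0 Q0) (measurable_cst a) mq (fun=> a0)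
  (fun w => mulr_ge0 qa0 (enorm_ge0 _)) (mean_le_cst Pr (sqr_ge0 a)) h1.
rewrite (_ : p + _ = a + q * ah * Q); last by rewrite /a; ring.
apply: (mean_leW h2) => //.
- apply: measurable_funX; apply: measurable_funD; first exact: measurable_cst.
  apply: measurable_funM; first exact: measurable_cst.
  apply: measurable_enorm; apply: vmeasB; last exact: vmeas_cst.
  exact: (vmeas_search_point model lam ah01 theta01 iid Xx).
- by move=> w; exact: sqr_ge0.
- move=> w; apply: sqr_ler.
    by rewrite addr_ge0// mulr_ge0// enorm_ge0.
  rewrite /a -addrA lerD2l -mulrA -mulrDr ler_wpM2l//.
  exact: search_point_dist.
Qed.

End Sample.

Hypothesis sm : search_moments P X F Lip.

Lemma next_point_bound (xs : 'rV[R]_d) : solutions X T xs -> pseudo_monotone X T ->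
  6 * lam ^+ 2 <= 1 ->
  exists2 C, 0 <= C & forall (dW : measure_display) (W : measurableType dW)
    (Pr : probability W R) (M : nat) (s t : 'I_M -> W -> Xi) (x : 'rV[R]_d),
    (0 < M)%N -> iid_sample P Pr (both_samples s t) -> X x ->
    mean_le Pr (fun w => enorm (next_point X F ah theta lam s t x w w - xs) ^+ 2
        + residual_gain P X F Lip ah theta lam x)
      (enorm (x - xs) ^+ 2 + C / M%:R * (1 + enorm (x - xs) ^+ 2)).
Proof.
move=> sol pm lam6; have [Xxs _] := sol.
have [C2 C20 hC2] := search_error_bound model ah01 theta01 lam0 Xxs sm.
have L0 : 0 <= L := Lmean_ge0 model.
have LQ1 : 1 <= LQ := Lq_ge1 model.
have LQ0 : 0 <= LQ := le_trans ler01 LQ1.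
have ah0' := ltW ah0; have /andP[_ ah1] := ah01.
have [s0 _] := sigma2_mean model Xxs.
set S := sigma P F 2 xs in s0.
pose cS := 2 * S ^+ 2 + 2 * LQ ^+ 2.
(* [q] bounds the coefficient of [D] in the distance from the search point to [xs]: [1 + L * ah]
   from the step and [ah * LQ] from the error, with [ah <= 1]. *)
pose q := 1 + L + LQ.
have q0 : 0 <= q by rewrite /q addr_ge0// addr_ge0.
pose c3 := 2 * (S + LQ * S) ^+ 2 + 2 * (LQ * q) ^+ 2.
have cS0 : 0 <= cS by rewrite addr_ge0// mulr_ge0// sqr_ge0.
have c30 : 0 <= c3 by rewrite addr_ge0// mulr_ge0// sqr_ge0.
have sq2 (u v D : R) : (u + v * D) ^+ 2 <= (2 * u ^+ 2 + 2 * v ^+ 2) * (1 + D ^+ 2).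
  have := sqr_ge0 (u - v * D); have := sqr_ge0 (u * D); have := sqr_ge0 v.
  rewrite !exprMn; nra.
have lam20 := sqr_ge0 lam.
exists (cS + 6 * C2 + 6 * c3); first by rewrite addr_ge0 ?mulr_ge0// addr_ge0// mulr_ge0.
move=> dW W Pr M s t x M0 iid Xx.
have is_ := iid_fst iid; have it := iid_snd iid.
have M0R : 0 < M%:R :> R by rewrite ltr0n.
have M1R : 1 <= M%:R :> R by rewrite ler1n.
set D := enorm (x - xs); have D0 : 0 <= D := enorm_ge0 _.
have h1 := mean_le_emp_err model M0 is_ Xx (noise_sqr model Xx Xxs).
rewrite -/LQ -/S -/D in h1.
have h2 := hC2 _ _ _ _ _ _ M0 is_ Xx.
pose b3 y := (S + LQ * enorm (y - xs)) ^+ 2 / M%:R.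
have h3 y : X y -> mean_le Pr (fun w => enorm (emp_err P F (fun j => t j w) y) ^+ 2) (b3 y).
  by move=> Xy; exact: (mean_le_emp_err model M0 it Xy (noise_sqr model Xy Xxs)).
have h1' : mean_le Pr (fun w => enorm (emp_err P F (fun j => s j w) x) ^+ 2) ((S + LQ * D) ^+ 2).
  apply: (mean_le_le h1); rewrite ler_pdivrMr// ler_peMr// sqr_ge0//.
have SD0 : 0 <= S + LQ * D by rewrite addr_ge0// mulr_ge0.
have h4 := mean_le_search_dist is_ Xx sol s0 LQ0 SD0 h1'.
rewrite -/D in h4.
have Mi0 : 0 <= M%:R^-1 :> R by rewrite invr_ge0 ltW.
have h5 : mean_le Pr (fun w => b3 (search_point X F ah theta lam s x w)) (c3 / M%:R * (1 + D ^+ 2)).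
  have h := mean_leZ Mi0 h4.
  rewrite (_ : (fun w => b3 _) = fun w => M%:R^-1 * (S + LQ * enorm (search_point X F ah theta lam s x w - xs)) ^+ 2); last first.
    by apply/funext => w; rewrite /b3 mulrC.
  apply: (mean_le_le h); rewrite [leRHS]mulrAC mulrC ler_wpM2r//.
  apply: le_trans (sq2 _ _ D); apply: sqr_ler.
    by rewrite addr_ge0// mulr_ge0// addr_ge0// mulr_ge0// addr_ge0// mulr_ge0.
  have k1 : ah * (S + LQ * D) <= S + LQ * D by rewrite ler_piMl.
  have k2 : L * ah * D <= L * D by rewrite ler_wpM2r// ler_piMr.
  have k3 : (1 + L * ah) * D + ah * (S + LQ * D) <= S + q * D.
    by rewrite /q; move: k1 k2; lra.
  have := ler_wpM2l LQ0 k3; rewrite /q; lra.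
have := mean_le_next_point model ah01 theta01 lam0 M0 iid Xx sol pm lam6 h1 h2 h3 h5.
move=> h; apply: (mean_le_le h); rewrite -/D lerD2l.
set V := 1 + D ^+ 2; have V0 : 0 <= V by rewrite addr_ge0// sqr_ge0.
have h1b : (S + LQ * D) ^+ 2 / M%:R <= cS / M%:R * V.
  by rewrite [leRHS]mulrAC ler_wpM2r//; exact: sq2.
have B10 := mean_le_ge0 h1.
have ah20 : 0 <= ah ^+ 2 <= 1 by rewrite sqr_ge0 exprn_ile1.
have B20 : 0 <= C2 / M%:R * V by rewrite mulr_ge0// divr_ge0// ltW.
have B30 : 0 <= c3 / M%:R * V by rewrite mulr_ge0// divr_ge0// ltW.
have k : (1 - 6 * lam ^+ 2) * ((S + LQ * D) ^+ 2 / M%:R) <= cS / M%:R * V.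
  apply: le_trans h1b; rewrite ler_piMl// gerBl mulr_ge0//.
have kk0 : 0 <= (1 - 6 * lam ^+ 2) * ((S + LQ * D) ^+ 2 / M%:R) by rewrite mulr_ge0// subr_ge0.
have /andP[a20 a21] := ah20.
apply: (@le_trans _ _ ((1 - 6 * lam ^+ 2) * ((S + LQ * D) ^+ 2 / M%:R)
    + 6 * (C2 / M%:R * V) + 6 * (c3 / M%:R * V))).
  by rewrite ler_piMl// addr_ge0 ?mulr_ge0// addr_ge0// mulr_ge0.
have -> : (cS + 6 * C2 + 6 * c3) / M%:R * V =
  cS / M%:R * V + 6 * (C2 / M%:R * V) + 6 * (c3 / M%:R * V) by ring.
by rewrite !lerD2r.
Qed.

End StepBounds.

(** * Almost supermartingales *)

Section ExactMeans.
Context {R : realType} {dW : measure_display} {W : measurableType dW}.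
Variable Pr : probability W R.
Implicit Types f g : W -> R.

Definition mean f : R := fine (\int[Pr]_w (f w)%:E)%E.

Lemma mean_leP f c : mean_le Pr f c -> mean_le Pr f (mean f).
Proof.
move=> [mf f0 fc]; split=> //; rewrite /mean fineK// ge0_fin_numE.
  exact: le_lt_trans fc (ltry _).
by apply: integral_ge0 => w _; rewrite lee_fin.
Qed.

Lemma mean_leE f c : mean_le Pr f c -> (\int[Pr]_w (f w)%:E = (mean f)%:E)%E.
Proof.
move=> [mf f0 fc]; rewrite /mean fineK// ge0_fin_numE.
  exact: le_lt_trans fc (ltry _).
by apply: integral_ge0 => w _; rewrite lee_fin.
Qed.

Lemma mean_le_mean f c : mean_le Pr f c -> mean f <= c.
Proof. by move=> h; rewrite -lee_fin -(mean_leE h); have [] := h. Qed.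

Lemma meanD f g a b : mean_le Pr f a -> mean_le Pr g b ->
  mean (fun w => f w + g w) = mean f + mean g.
Proof.
move=> hf hg; have [mf f0 _] := hf; have [mg g0 _] := hg.
apply: EFin_inj; rewrite EFinD -(mean_leE hf) -(mean_leE hg) -(mean_leE (mean_leD hf hg)).
under eq_integral do rewrite EFinD.
by rewrite ge0_integralD//; try exact/measurable_EFinP; move=> w _; rewrite lee_fin.
Qed.

Lemma meanZ k f c : 0 <= k -> mean_le Pr f c -> mean (fun w => k * f w) = k * mean f.
Proof.
move=> k0 hf; have [mf f0 _] := hf; have hkf := mean_leZ k0 hf.
apply: EFin_inj; rewrite EFinM -(mean_leE hf) -(mean_leE hkf).
under eq_integral do rewrite EFinM.
rewrite ge0_integralZl_EFin//; last exact/measurable_EFinP.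
by move=> w _; rewrite lee_fin.
Qed.

Lemma mean_le_indic (A : set W) : measurable A -> mean_le Pr (fun w => \1_A w) (fine (Pr A)).
Proof.
move=> mA; split; first exact: measurable_indic.
  by move=> w; rewrite indicE.
rewrite integral_indic// setIT fineK//; exact: fin_num_measure.
Qed.

Lemma mean_indic (A : set W) : measurable A -> mean (fun w => \1_A w) = fine (Pr A).
Proof. by move=> mA; rewrite /mean integral_indic// setIT. Qed.

Lemma mean_ge0 f : (forall w, 0 <= f w) -> 0 <= mean f.
Proof. by move=> f0; rewrite fine_ge0// integral_ge0// => w _; rewrite lee_fin. Qed.

End ExactMeans.

Section AlmostSupermartingale.
Context {R : realType} {dW : measure_display} {W : measurableType dW}.
Variable Pr : probability W R.
Variables (H : nat -> set (set W)) (V G : nat -> W -> R) (gam : nat -> R) (Gam v0 : R).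
Hypotheses (H_measurable : forall k, H k `<=` measurable)
  (H_mono : forall k, H k `<=` H k.+1) (HT : forall k, H k setT)
  (HI : forall k A B, H k A -> H k B -> H k (A `&` B))
  (HV : forall k t, H k [set w | V k w < t]).
Hypotheses (V0 : forall w, V 0%N w = v0) (V_ge0 : forall k w, 0 <= V k w)
  (mV : forall k, measurable_fun setT (V k)) (mG : forall k, measurable_fun setT (G k))
  (G_ge0 : forall k w, 0 <= G k w) (gam_ge0 : forall k, 0 <= gam k)
  (gam_sum : forall n, \sum_(k < n) gam k <= Gam).
Hypothesis step : forall k A c, H k A -> mean_le Pr (fun w => \1_A w * V k w) c ->
  mean_le Pr (fun w => \1_A w * (V k.+1 w + G k w)) ((1 + gam k) * c).

Let v00 : 0 <= v0. Proof. by rewrite -(V0 point) V_ge0. Qed.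

(** [p k] dominates the product of the factors [1 + gam i], so dividing [V k] by [p k] removes the
    growth; [p k] itself stays below [expR Gam]. *)
Let p k : R := expR (\sum_(i < k) gam i).

Let p0 k : 0 < p k. Proof. exact: expR_gt0. Qed.

Let p_le k : p k <= expR Gam. Proof. by rewrite ler_expR. Qed.

Let pS k : (1 + gam k) * p k <= p k.+1.
Proof.
rewrite /p big_ord_recr/= expRD mulrC ler_wpM2l ?expR_ge0//.
exact: expR_ge1Dx.
Qed.

Let stepT k c : mean_le Pr (V k) c ->
  mean_le Pr (fun w => V k.+1 w + G k w) ((1 + gam k) * c).
Proof.
have E (f : W -> R) : (fun w => \1_(setT : set W) w * f w) = f.
  by apply/funext => w; rewrite indicT mul1r.
by move=> h; have := @step k setT c (HT k); rewrite !E; exact.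
Qed.

Let mean_le_V k : mean_le Pr (V k) (p k * v0).
Proof.
elim: k => [|k IH].
  rewrite /p big_ord0 expR0 mul1r (_ : V 0%N = fun=> v0); first exact: mean_le_cst.
  exact/funext.
have h := stepT IH.
apply: (mean_le_le (b := (1 + gam k) * (p k * v0))).
  by apply: (mean_leW h) => // w; rewrite lerDl.
by rewrite mulrA ler_wpM2r.
Qed.

Lemma supermartingale_mean_bound k : mean_le Pr (V k) (expR Gam * v0).
Proof. by apply: (mean_le_le (mean_le_V k)); rewrite ler_wpM2r. Qed.

Lemma supermartingale_gain_le k : exists c, mean_le Pr (G k) c.
Proof.
exists ((1 + gam k) * (p k * v0)); apply: (mean_leW (stepT (mean_le_V k))) => // w.
by rewrite lerDr.
Qed.

(** The means of [V] telescope once [V k] in the growth term is replaced by its uniform mean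
    bound. *)
Lemma supermartingale_gain_sum n :
  \sum_(k < n) mean Pr (G k) <= v0 + Gam * (expR Gam * v0).
Proof.
have key k : mean Pr (V k.+1) + mean Pr (G k) <= mean Pr (V k) + gam k * (expR Gam * v0).
  have [c hG] := supermartingale_gain_le k.
  rewrite -(meanD (mean_le_V k.+1) hG).
  apply: le_trans (mean_le_mean (stepT (mean_leP (mean_le_V k)))) _.
  rewrite mulrDl mul1r lerD2l ler_wpM2l//.
  exact: mean_le_mean (supermartingale_mean_bound k).
have h : mean Pr (V n) + \sum_(k < n) mean Pr (G k) <= v0 + (\sum_(k < n) gam k) * (expR Gam * v0).
  elim: n => [|n IH].
    rewrite !big_ord0 addr0 mul0r addr0.
    by have := mean_le_mean (mean_le_V 0); rewrite /p big_ord0 expR0 mul1r.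
  rewrite !big_ord_recr/= mulrDl; have := key n.
  move: IH; move: (mean Pr (V n)) (mean Pr (V n.+1)) (mean Pr (G n)) => a b c.
  move: (\sum_(k < n) mean Pr (G k)) ((\sum_(k < n) gam k) * (expR Gam * v0)) => u v.
  by move: (gam n * _) => z; lra.
have h0 : 0 <= mean Pr (V n) by apply: mean_ge0.
have h1 : (\sum_(k < n) gam k) * (expR Gam * v0) <= Gam * (expR Gam * v0).
  by rewrite ler_wpM2r// mulr_ge0// expR_ge0.
apply: le_trans (le_trans h _); first by rewrite lerDr.
by rewrite lerD2l.
Qed.

Let B t k := \bigcap_(i in [set i | (i <= k)%N]) [set w | V i w < t * p i].

Let BS t k : B t k.+1 = B t k `&` [set w | V k.+1 w < t * p k.+1].
Proof.
apply/seteqP; split => [w h|w [h1 h2] i /=].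
  by split => [i /= ik|]; apply: h => //=; exact: leqW.
by rewrite leq_eqVlt => /orP[/eqP ->|] //; exact: h1.
Qed.

Let HB t k : H k (B t k).
Proof.
elim: k => [|k IH]; last by rewrite BS; apply: HI; [exact: H_mono | exact: HV].
rewrite (_ : B t 0 = [set w | V 0%N w < t * p 0])//.
apply/seteqP; split => [w h|w h i /=]; first exact: (h 0%N).
by rewrite leqn0 => /eqP ->.
Qed.

(* Ville's maximal inequality *)
Let ville t k : 0 < t -> t * fine (Pr (~` B t k)) <= v0.
Proof.
move=> t0.
have mB j : measurable (B t j) by exact: H_measurable (HB t j).
(* The induction accounts for the mass that has crossed the level: a first crossing at time [k]
   removes at least [t * p k] on its event, and the mean of what remains is nonnegative. *)
suff h : mean_le Pr (fun w => \1_(B t k) w * V k w) (p k * (v0 - t * fine (Pr (~` B t k)))).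
  by have := mean_le_ge0 h; rewrite pmulr_rge0// subr_ge0.
elim: k => [|k IH].
  have -> : p 0 = 1 by rewrite /p big_ord0 expR0.
  rewrite mul1r.
  have BE : B t 0 = [set w | v0 < t].
    apply/seteqP; split => [w h|w h i /=].
      by have := h 0%N (leqnn _); rewrite /= V0 /p big_ord0 expR0 mulr1.
    by rewrite leqn0 => /eqP ->; rewrite V0 /p big_ord0 expR0 mulr1.
  have [vt|vt] := ltP v0 t.
    have -> : B t 0 = setT by rewrite BE; apply/seteqP; split.
    rewrite setCT measure0 mulr0 subr0.
    rewrite (_ : (fun _ => _) = fun=> v0); first exact: mean_le_cst.
    by apply/funext => w; rewrite indicT mul1r V0.
  have -> : B t 0 = set0 by rewrite BE; apply/seteqP; split => w //=; rewrite ltNge vt.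
  rewrite setC0 probability_setT mulr1.
  rewrite (_ : (fun _ => _) = fun=> 0); last by apply/funext => w; rewrite indic0 mul0r.
  by apply: (mean_le_le (mean_le_cst Pr (lexx 0))); rewrite subr_ge0.
set q := fine _ in IH *; set q' := fine _.
have h1 := step (HB t k) IH.
have h2 : mean_le Pr (fun w => \1_(B t k) w * V k.+1 w) (p k.+1 * (v0 - t * q)).
  apply: (mean_le_le (b := (1 + gam k) * (p k * (v0 - t * q)))).
    apply: (mean_leW h1).
    - by apply: measurable_funM => //; exact: measurable_indic.
    - by move=> w; rewrite mulr_ge0// indicE.
    - by move=> w; rewrite ler_wpM2l ?lerDl// indicE.
  rewrite mulrA ler_wpM2r//.
  by have := mean_le_ge0 IH; rewrite pmulr_rge0.
(* [D] is the event of a first crossing at [k.+1]; there [V k.+1] is at least [t * p k.+1]. *)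
pose D := B t k `\` B t k.+1.
have mD : measurable D by exact: measurableD.
have q'E : q' = q + fine (Pr D).
  have fq : Pr (~` B t k) \is a fin_num by apply: fin_num_measure; exact: measurableC.
  have fD : Pr D \is a fin_num by exact: fin_num_measure.
  rewrite /q' /q -fineD//.
  rewrite -measureU; [|exact: measurableC|exact: mD|]; last first.
    by rewrite /D; apply/seteqP; split => // w [? [? _]].
  congr (fine (Pr _)); apply/seteqP; split => w.
    move=> h; have [wB|wB] := pselect (B t k w); [by right; split|by left].
  move=> [h|[_ h]] //; apply: contra_not h; rewrite BS; by case.
have tp0 : 0 <= t * p k.+1 by rewrite mulr_ge0// ltW.
have h3 := mean_leZ tp0 (mean_le_indic Pr mD).
have h4 : mean_le Pr (fun w => \1_(B t k.+1) w * V k.+1 w) (p k.+1 * (v0 - t * q)).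
  apply: (mean_leW h2).
  - by apply: measurable_funM => //; exact: measurable_indic.
  - by move=> w; rewrite mulr_ge0// indicE.
  - move=> w; rewrite ler_wpM2r// !indicE.
    have [|//] := boolP (w \in B t k.+1); rewrite inE BS => -[wB _].
    by rewrite mem_set.
have h5 : mean_le Pr (fun w => \1_(B t k.+1) w * V k.+1 w + t * p k.+1 * \1_D w) (p k.+1 * (v0 - t * q)).
  have [m4 n4 _] := h4; have [m3 n3 _] := h3.
  apply: (mean_leW h2); first exact: measurable_funD.
    by move=> w; rewrite addr_ge0.
  move=> w; rewrite !indicE.
  have [wB'|wB'] := boolP (w \in B t k.+1).
    have wB : w \in B t k by move: wB'; rewrite !inE BS => -[].
    have wD : w \notin D by apply/negP; rewrite inE => -[_]; apply; exact: set_mem.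
    by rewrite wB (negbTE wD) mulr0 addr0.
  have [wD|wD] := boolP (w \in D); last first.
    by rewrite mul0r mulr0 addr0 mulr_ge0.
  have wB : w \in B t k by move: wD; rewrite !inE => -[].
  rewrite wB mul0r add0r mulr1 mul1r leNgt; apply/negP => hlt.
  move: wD; rewrite inE => -[wBk]; apply; rewrite BS; split => //.
split.
- by have [] := h4.
- by have [] := h4.
rewrite (mean_leE h4) lee_fin.
have := mean_le_mean h5; rewrite (meanD h4 h3).
have -> : mean Pr (fun w => t * p k.+1 * \1_D w) = t * p k.+1 * fine (Pr D).
  by rewrite (meanZ tp0 (mean_le_indic Pr mD)) mean_indic.
rewrite q'E; move: (mean Pr _) (fine (Pr D)) (p k.+1) => a b c; lra.
Qed.

Lemma supermartingale_bounded : \forall w \ae Pr, exists b, forall k, V k w <= b.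
Proof.
have mB t j : measurable (B t j) by exact: H_measurable (HB t j).
(* On [U n] the level [n.+1] is crossed at some time, with probability at most [v0 / n.+1]. Outside
   the null intersection, [V] stays below [n.+1 * expR Gam] for some [n]. *)
pose U n := \bigcup_k ~` B n.+1%:R k.
have mU n : measurable (U n).
  by apply: bigcup_measurable => k _; exact: measurableC.
have PU n : (Pr (U n) <= (v0 / n.+1%:R)%:E)%E.
  have nd : nondecreasing_seq (fun k => ~` B n.+1%:R k).
    apply/nondecreasing_seqP => k; apply/subsetPset; apply: subsetC.
    by rewrite BS; exact: subIsetl.
  have cv := nondecreasing_cvg_mu (mu := Pr) (fun k => measurableC (mB n.+1%:R k)) (mU n) nd.
  rewrite -(cvg_lim _ cv)//; apply: lime_le; first by apply/cvg_ex; exists (Pr (U n)).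
  apply: nearW => k /=.
  rewrite -[leLHS]fineK; last by apply: fin_num_measure; exact: measurableC.
  by rewrite lee_fin ler_pdivlMr// mulrC ville.
exists (\bigcap_n U n); split.
- by apply: bigcapT_measurable.
- apply/eqP; rewrite eq_le measure_ge0 andbT; apply/lee_addgt0Pr => e e0.
  rewrite add0e.
  have [n hn] : exists n : nat, v0 / n.+1%:R <= e.
    exists (Num.truncn (v0 / e)); rewrite ler_pdivrMr// mulrC -ler_pdivrMr//.
    exact: ltW (truncnS_gt _).
  apply: (@le_trans _ _ (Pr (U n))).
    by apply: le_measure; rewrite ?inE//; [exact: bigcapT_measurable | exact: bigcap_inf].
  by apply: le_trans (PU n) _; rewrite lee_fin.
- move=> w /= hw n _; apply: contrapT => nU; apply: hw.
  exists (n.+1%:R * expR Gam) => k.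
  have wB : B n.+1%:R k w by apply: contrapT => h; apply: nU; exists k.
  apply: (le_trans (ltW (wB k (leqnn k)))).
  by rewrite ler_pM2l.
Qed.

End AlmostSupermartingale.

Lemma cvg0_bounded_sum {R : realType} (a : nat -> R) (b : R) :
  (forall n, 0 <= a n) -> (forall n, \sum_(k < n) a k <= b) -> a n @[n --> \oo] --> 0.
Proof.
move=> a0 ab; apply: cvg_series_cvg_0; apply: nondecreasing_is_cvgn.
  apply/nondecreasing_seqP => n; rewrite /series/= big_nat_recr//= lerDl; exact: a0.
by exists b => _ [n _ <-]; rewrite /series/= big_mkord.
Qed.

Section SummableMeans.
Context {R : realType} {dW : measure_display} {W : measurableType dW}.
Variable Pr : probability W R.

(** By Tonelli the sum of all [f k] has finite mean, so it is finite almost surely and its terms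
    tend to 0. *)
Lemma ae_cvg0_summable_mean (f : nat -> W -> R) (b : R) :
  (forall k, exists c, mean_le Pr (f k) c) ->
  (forall n, \sum_(k < n) mean Pr (f k) <= b) ->
  \forall w \ae Pr, f k w @[k --> \oo] --> 0.
Proof.
move=> hf hb.
have mf k : measurable_fun setT (EFin \o f k) by have [c [/measurable_EFinP]] := hf k.
have f0 k w : 0 <= f k w by have [c [_ + _]] := hf k; exact.
pose g w := (\sum_(0 <= k <oo) (f k w)%:E)%E.
have g0 w : (0 <= g w)%E by apply: nneseries_ge0 => k _ _; rewrite lee_fin.
have mg : measurable_fun setT g.
  apply: ge0_emeasurable_sum; [by move=> k w _ _; rewrite lee_fin | by move=> k _; exact: mf].
have ig : Pr.-integrable setT g.
  apply/integrableP; split => //.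
  under eq_integral do rewrite gee0_abs//.
  rewrite /g integral_nneseries//; last by move=> k w _; rewrite lee_fin.
  apply: (@le_lt_trans _ _ b%:E); last exact: ltry.
  apply: lime_le.
    by apply: is_cvg_nneseries => n _ _; apply: integral_ge0 => w _; rewrite lee_fin.
  apply: nearW => n; rewrite big_mkord.
  rewrite (eq_bigr (fun k : 'I_n => (mean Pr (f k))%:E)).
    by rewrite sumEFin lee_fin; exact: hb.
  by move=> k _; have [c hc] := hf k; rewrite (mean_leE hc).
apply: filterS (integrable_ae measurableT ig) => w /(_ I) gw.
apply: (@cvg0_bounded_sum _ _ (fine (g w))) => // n.
rewrite -lee_fin fineK// -sumEFin.
apply: le_trans (nneseries_lim_ge n _) => //; first by rewrite big_mkord.
by move=> k _; rewrite lee_fin.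
Qed.

Lemma integral_indicM (A : set W) (f : W -> R) : measurable A ->
  (\int[Pr]_(w in A) (f w)%:E = \int[Pr]_w (\1_A w * f w)%:E)%E.
Proof.
move=> mA; rewrite integral_mkcond; apply: eq_integral => w _.
by rewrite patchE indicE; case: ifP => _; rewrite ?mul1r ?mul0r.
Qed.

End SummableMeans.

(** * From a vanishing residual to the solution set *)

Section ResidualLimit.
Context {R : realType} {d : nat} (X : set 'rV[R]_d).
Hypotheses (X0 : X !=set0) (Xcl : closed X) (Xcvx : convex_set X).
Variable T : 'rV[R]_d -> 'rV[R]_d.
Hypothesis rcont : continuous (fun y => residual X T (proj X y)).
Let Xstar := solutions X T.

Lemma residual_eq0 y : X y -> residual X T y = 0 -> Xstar y.
Proof.
move=> Xy /enorm_eq0/eqP; rewrite subr_eq0 => /eqP yE.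
by apply: (residual0_solution X0 Xcl Xcvx Xy ltr01); rewrite scale1r.
Qed.

Variables (x : nat -> 'rV[R]_d) (xs : 'rV[R]_d) (B : R).
Hypotheses (Xx : forall k, X (x k)) (sol : Xstar xs).
Hypothesis xB : forall k, enorm (xs - x k) <= B.
Hypothesis rx : residual X T (x k) @[k --> \oo] --> 0.

(** Near a point of positive residual the residual stays above half of that value, so the sequence
    cannot keep returning there. *)
Lemma residual_cluster : cluster (x k @[k --> \oo]) `<=` Xstar.
Proof.
move=> p cp.
have Xp : X p.
  have evX : \forall k \near \oo, X (x k) by apply: nearW => k; exact: Xx.
  by apply: Xcl => U pU; apply: (cp X U evX pU).
apply: residual_eq0 => //; apply/eqP; rewrite eq_le enorm_ge0 andbT leNgt; apply/negP => r0.
set m := residual X T p in r0 *.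
have nb : nbhs p [set y | m / 2 < residual X T (proj X y)].
  have h : nbhs (residual X T (proj X p)) [set t | m / 2 < t]; last exact: (@rcont p _ h).
  rewrite proj_id// -/m.
  apply: open_nbhs_nbhs; split; first exact: open_gt.
  by rewrite /= ltr_pdivrMr// ltr_pMr// ltr1n.
have ev : (x k @[k --> \oo]) [set y | X y /\ residual X T y < m / 2].
  have m2 : 0 < m / 2 by rewrite divr_gt0.
  have h : \forall k \near \oo, residual X T (x k) < m / 2.
    exact: (@cvgr_lt _ _ _ _ _ _ rx (m / 2) m2).
  have h' : \forall k \near \oo, X (x k) /\ residual X T (x k) < m / 2.
    by apply: filterS h => k hk; split.
  exact: h'.
have [y [[Xy ry] /=]] := cp _ _ ev nb.
by rewrite proj_id// ltNge (ltW ry).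
Qed.

(** The points of [X] in the bounding ball at distance at least [e] from every solution form a
    compact set [Ke]. If it is nonempty, the residual has a positive minimum on it, so the iterates
    eventually leave it. *)
Lemma residual_dist : dist_to (x k) Xstar @[k --> \oo] --> 0.
Proof.
have dist_ge0 y : 0 <= dist_to y Xstar.
  apply: lb_le_inf; first by exists (enorm (y - xs)), xs.
  by move=> _ [z _ <-]; exact: enorm_ge0.
apply/cvgrPdist_lt => e e0.
pose Ke := (X `&` [set y | enorm (xs - y) <= B]) `&`
  \bigcap_(z in Xstar) [set y | e <= enorm (z - y)].
have cKe : compact Ke.
  apply: (subclosed_compact _ (enorm_bounded_compact (x := xs) (B := B) Xcl)); last by move=> y [].
  apply: closedI.
    by apply: compact_closed; [exact: norm_hausdorff | exact: enorm_bounded_compact].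
  apply: closed_bigI => z _.
  have -> : [set y | e <= enorm (z - y)] = (fun y => enorm (z - y)) @^-1` [set b | e <= b] by [].
  apply: closed_comp; last exact: closed_ge.
  by move=> y _; exact: enorm_dist_continuous.
have far k : ~ Ke (x k) -> `|0 - dist_to (x k) Xstar| < e.
  move=> nK; rewrite sub0r normrN ger0_norm//.
  have [z [zs ze]] : exists z, Xstar z /\ enorm (z - x k) < e.
    apply: contrapT => nz; apply: nK; split; first by split; [exact: Xx | exact: xB].
    by move=> z zs /=; rewrite leNgt; apply/negP => h; apply: nz; exists z.
  apply: le_lt_trans ze; rewrite enorm_sym.
  have lb : has_lbound [set enorm (x k - y) | y in Xstar].
    by exists 0 => _ [u _ <-]; exact: enorm_ge0.
  have mem : [set enorm (x k - y) | y in Xstar] (enorm (x k - z)) by exists z.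
  exact: (ge_inf lb mem).
have [K0|/set0P Kn0] := eqVneq Ke set0.
  by exists 0%N => // k _; apply: far; rewrite K0.
have [] := @EVT_min_rV _ _ (fun y => residual X T (proj X y)) Ke Kn0 cKe.
  exact: continuous_subspaceT.
move=> c; rewrite inE => -[[Xc _] hc] cmin.
have m0 : 0 < residual X T c.
  rewrite lt0r enorm_ge0 andbT; apply/eqP => /(residual_eq0 Xc) cs.
  by have := hc c cs; rewrite /= subrr enorm0 leNgt e0.
have h : \forall k \near \oo, residual X T (x k) < residual X T c.
  exact: (@cvgr_lt _ _ _ _ _ _ rx _ m0).
apply: filterS h => k hk; apply: far => Kx.
have := cmin (x k) (mem_set Kx).
by rewrite !proj_id// leNgt hk.
Qed.

End ResidualLimit.

(** * Sample sizes *)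

Section SampleSizes.
Context {R : realType}.
Variables (N : nat) (b mu : R).
Hypotheses (N0 : (0 < N)%N) (b0 : 0 < b) (mu2 : 2 < mu).

Lemma sample_size_gt0 k : (0 < sample_size N b mu k)%N.
Proof. by rewrite /sample_size muln_gt0 N0. Qed.

(* Tangent-line bounds: [ln (1 - 1/s) <= - 1/s] and, for [r = ln (s-1) / ln s],
   [r `^ (- b) >= 1 - b (r - 1)]. *)
Lemma inv_ln_telescope (s : R) : 2 < s ->
  (s * ln s `^ (1 + b))^-1 <= (ln (s - 1) `^ (- b) - ln s `^ (- b)) / b.
Proof.
move=> s2; have s0 : 0 < s by lra.
have s10 : 0 < s - 1 by lra.
set u := ln s; set v := ln (s - 1).
have v0 : 0 < v by rewrite ln_gt0//; lra.
have uv : s^-1 <= u - v.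
  have : v - u <= - s^-1.
    rewrite /u /v -ln_div ?posrE//.
    have -> : (s - 1) / s = 1 + (- s^-1) by rewrite mulrBl divff ?gt_eqF// mul1r.
    by apply: le_ln1Dx; rewrite ltrN2 invf_lt1//; apply: lt_trans s2; lra.
  lra.
have s10V : 0 < s^-1 by rewrite invr_gt0.
have u0 : 0 < u by lra.
have key : b * (u - v) / u * u `^ (- b) <= v `^ (- b) - u `^ (- b).
  have r0 : 0 < v / u by rewrite divr_gt0.
  have -> : v `^ (- b) = (v / u) `^ (- b) * u `^ (- b).
    by rewrite -powRM ?divfK ?gt_eqF// ltW.
  have h : 1 - b * (v / u - 1) <= (v / u) `^ (- b).
    rewrite /powR gt_eqF//; apply: le_trans (expR_ge1Dx _).
    rewrite mulNr lerD2l lerN2 ler_pM2l//.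
    have := @le_ln1Dx R (v / u - 1); rewrite addrCA subrr addr0; apply.
    by rewrite ltrBrDl subrr.
  have U0 : 0 <= u `^ (- b) by exact: powR_ge0.
  have := ler_wpM2r U0 h.
  have -> : b * (u - v) / u = - (b * (v / u - 1)).
    by rewrite -mulrN opprB mulrBr mulrBr mulr1 mulrBl mulfK ?gt_eqF// mulrA.
  lra.
rewrite ler_pdivlMr//; apply: le_trans key.
rewrite invfM powRD; last by apply/implyP => _; rewrite gt_eqF.
rewrite powRr1 ?(ltW u0)// powRN invfM.
rewrite (_ : s^-1 * (u^-1 * (u `^ b)^-1) * b = b * s^-1 / u * (u `^ b)^-1); last first.
  by ring.
rewrite ler_wpM2r ?invr_ge0 ?powR_ge0// ler_wpM2r ?invr_ge0 ?(ltW u0)//.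
by rewrite ler_wpM2l ?(ltW b0).
Qed.

Lemma sample_size_sum n :
  \sum_(k < n) (sample_size N b mu k)%:R^-1 <= (N%:R * b * ln (mu - 1) `^ b)^-1.
Proof.
have N0R : 0 < N%:R :> R by rewrite ltr0n.
(* The shift by 1 makes the bound of [inv_ln_telescope] at [k%:R + mu] equal to
   [(g k - g k.+1) / b]. *)
pose g k := ln (k%:R + mu - 1) `^ (- b).
have sk (k : nat) : 2 < k%:R + mu by apply: lt_le_trans mu2 _; rewrite lerDr.
have term k : (sample_size N b mu k)%:R^-1 <= (N%:R * b)^-1 * (g k - g k.+1).
  set s := k%:R + mu.
  have h0 : 0 < s * ln s `^ (1 + b).
    rewrite mulr_gt0//; first by have := sk k; rewrite -/s; lra.
    by rewrite powR_gt0// ln_gt0//; have := sk k; rewrite -/s; lra.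
  have h1 : (sample_size N b mu k)%:R^-1 <= (N%:R * (s * ln s `^ (1 + b)))^-1.
    have h2 : N%:R * (s * ln s `^ (1 + b)) <= (sample_size N b mu k)%:R.
      by rewrite /sample_size natrM ler_pM2l//; apply: ltW; exact: truncnS_gt.
    by rewrite lef_pV2// posrE ?ltr0n ?sample_size_gt0// mulr_gt0.
  apply: (le_trans h1); rewrite !invfM -mulrA ler_pM2l ?invr_gt0//.
  have := inv_ln_telescope (sk k); rewrite -/s invfM => /le_trans; apply.
  rewrite [leLHS]mulrC ler_pM2l ?invr_gt0// /g -/s.
  by rewrite (_ : k.+1%:R + mu - 1 = s)// /s -natr1; ring.
have tele : \sum_(k < n) (sample_size N b mu k)%:R^-1 <= (N%:R * b)^-1 * (g 0%N - g n).
  elim: n => [|n IH]; first by rewrite big_ord0 subrr mulr0.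
  rewrite big_ord_recr/=.
  have -> : (N%:R * b)^-1 * (g 0%N - g n.+1) =
    (N%:R * b)^-1 * (g 0%N - g n) + (N%:R * b)^-1 * (g n - g n.+1) by ring.
  exact: lerD.
apply: (le_trans tele); rewrite [leRHS]invfM ler_pM2l ?invr_gt0 ?mulr_gt0//.
rewrite -powRN (_ : ln (mu - 1) `^ (- b) = g 0%N); last by rewrite /g add0r.
by rewrite gerBl powR_ge0.
Qed.

End SampleSizes.

(** * Asymptotics *)

Section Asymptotics.
Context {R : realType} {d : nat} {dXi : measure_display} {Xi : measurableType dXi}.
Variables (P : probability Xi R) (X : set 'rV[R]_d).
Variables (F : Xi -> 'rV[R]_d -> 'rV[R]_d) (Lip : Xi -> R).
Hypothesis model : square_integrable_model P X F Lip.
Hypothesis sm : search_moments P X F Lip.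
Variables (ah theta lam : R).
Hypotheses (ah01 : 0 < ah <= 1) (theta01 : 0 < theta < 1) (lam0 : 0 < lam).
Hypothesis lam6 : 6 * lam ^+ 2 < 1.
Variable x0 : 'rV[R]_d.
Hypothesis Xx0 : X x0.
Context {dW : measure_display} {W : measurableType dW}.
Variables (Pr : probability W R) (Nk : nat -> nat) (xi eta : forall k, 'I_(Nk k) -> W -> Xi).
Hypotheses (Nk0 : forall k, (0 < Nk k)%N) (iid : iid_sample P Pr (all_draws xi eta)).
Variable S : R.
Hypothesis Nk_sum : forall n, \sum_(k < n) (Nk k)%:R^-1 <= S.
Variable xs : 'rV[R]_d.

Let T := mean_op P F.

Hypotheses (sol : solutions X T xs) (pm : pseudo_monotone X T).

Let X0 : X !=set0 := model_nonempty model.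
Let Xcl : closed X := model_closed model.
Let Xcvx : convex_set X := model_convex model.
Let ah0 : 0 < ah. Proof. by case/andP: ah01. Qed.
Let x := iterate X F ah theta lam x0 xi eta.
Let gain := residual_gain P X F Lip ah theta lam.
Let r := residual X T.
Let kappa := (1 - 6 * lam ^+ 2) / 2 * (Num.min (lam * theta) ah ^+ 2 / Lnorm_lip P Lip 2 ^+ 2).
Let Xx k w : X (x k w) := iterateX model ah theta lam Xx0 xi eta k w.
Let gain0 y : 0 <= gain y. Proof. by apply: residual_gain_ge0 => //; exact: ltW. Qed.

Lemma gain_factor_gt0 : 0 < kappa.
Proof.
have theta0 : 0 < theta by case/andP: theta01.
have K0 : 0 < Lnorm_lip P Lip 2 by apply: lt_le_trans (Lnorm_lip_ge1 model).
have m0 : 0 < Num.min (lam * theta) ah by rewrite lt_min ah0 mulr_gt0.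
have l0 : 0 < (1 - 6 * lam ^+ 2) / 2 by rewrite divr_gt0// subr_gt0.
by rewrite mulr_gt0// divr_gt0// exprn_gt0.
Qed.

(** The summand 1 makes the one-step error, [C / (Nk k)%:R] times 1 plus the squared distance, a
    multiple of [V k w], so it acts as a growth factor [1 + gam k]. *)
Let V k w := 1 + enorm (x k w - xs) ^+ 2.
Let G k w := gain (x k w).

Lemma iterate_moments :
  [/\ exists B, forall k, mean_le Pr (fun w => enorm (x k w - xs) ^+ 2) B,
      forall k, exists c, mean_le Pr (fun w => r (x k w) ^+ 2) c,
      exists B, forall n, \sum_(k < n) mean Pr (fun w => r (x k w) ^+ 2) <= B &
      \forall w \ae Pr, exists B, forall k, enorm (xs - x k w) <= B].
Proof.
have mx k : vmeas (x k) := vmeas_iterateT model lam ah01 theta01 Xx0 iid k.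
have [C C0 hC] := next_point_bound model ah01 theta01 lam0 sm sol pm (ltW lam6).
have V_ge0 k w : 0 <= V k w by rewrite addr_ge0 ?sqr_ge0.
have mD k : measurable_fun setT (fun w => enorm (x k w - xs) ^+ 2).
  by apply: measurable_funX; apply: measurable_enorm; apply: vmeasB => //; exact: vmeas_cst.
have mV k : measurable_fun setT (V k) by apply: measurable_funD => //; exact: measurable_cst.
have mr k : measurable_fun setT (fun w => r (x k w)) by exact: (measurable_residual model).
have mG k : measurable_fun setT (G k) by exact: (measurable_gain model).
pose gam k := C / (Nk k)%:R.
have gam0 k : 0 <= gam k by rewrite divr_ge0.
have gamS n : \sum_(k < n) gam k <= C * S by rewrite -mulr_sumr ler_wpM2l.
have step k A c : history xi eta k A -> mean_le Pr (fun w => \1_A w * V k w) c ->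
    mean_le Pr (fun w => \1_A w * (V k.+1 w + G k w)) ((1 + gam k) * c).
  move=> hA hc.
  have iidk := iid_present iid k.
  have h1 y : X y -> _ := hC _ _ Pr (Nk k) (@xi k) (@eta k) y (Nk0 k) iidk.
  have h2 : mean_le Pr (fun w => \1_A w * (enorm (x k w - xs) ^+ 2 +
      C / (Nk k)%:R * (1 + enorm (x k w - xs) ^+ 2) + 1)) ((1 + gam k) * c).
    rewrite (_ : (fun _ => _) = fun w => (1 + gam k) * (\1_A w * V k w)).
      by apply: mean_leZ => //; rewrite addr_ge0.
    by apply/funext => w; rewrite /V /gam; ring.
  have := mean_le_iterate model ah01 theta01 Xx0 iid (ltW lam6) hA ler01 h1 h2.
  rewrite (_ : (fun _ => _) = fun w => \1_A w * (V k.+1 w + G k w))//.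
  by apply/funext => w; rewrite /V /G -/gain -/x; ring.
have HV k t : history xi eta k [set w | V k w < t].
  exact: (history_dist_lt model lam ah01 theta01 Xx0).
have hH k : history xi eta k `<=` measurable := history_measurable iid (k := k).
have V0 w : V 0%N w = 1 + enorm (x0 - xs) ^+ 2 by [].
have h_mono k : history xi eta k `<=` history xi eta k.+1 by exact: history_sub.
have hT k : history xi eta k setT by exact: historyT.
have hI k A B : history xi eta k A -> history xi eta k B -> history xi eta k (A `&` B).
  exact: historyI.
have G0 k w : 0 <= G k w by exact: gain0.
have Vb := supermartingale_mean_bound hT V0 V_ge0 mV G0 gamS step.
have Gle := supermartingale_gain_le hT V0 V_ge0 mV mG G0 step.
have Gsum := supermartingale_gain_sum hT V0 V_ge0 mV mG G0 gam0 gamS step.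
have Vae := supermartingale_bounded hH h_mono hI HV V0 V_ge0 mV G0 gamS step.
have kap0 := gain_factor_gt0.
have rG k : (fun w => r (x k w) ^+ 2) = (fun w => kappa^-1 * G k w).
  by apply/funext => w; rewrite /G /gain /residual_gain -/kappa mulKf// gt_eqF.
have kV0 : 0 <= kappa^-1 by rewrite invr_ge0 ltW.
split.
- eexists => k; apply: (mean_leW (Vb k)) => // w; first exact: sqr_ge0.
  by rewrite /V lerDr.
- by move=> k; have [c hc] := Gle k; exists (kappa^-1 * c); rewrite rG; exact: mean_leZ.
- exists (kappa^-1 * ((1 + enorm (x0 - xs) ^+ 2) +
    C * S * (expR (C * S) * (1 + enorm (x0 - xs) ^+ 2)))) => n.
  rewrite (_ : \sum_(k < n) _ = kappa^-1 * \sum_(k < n) mean Pr (G k)).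
    exact: ler_wpM2l.
  rewrite mulr_sumr; apply: eq_bigr => k _; rewrite rG.
  by have [c hc] := Gle k; rewrite (meanZ kV0 hc).
apply: filterS Vae => w [b hb]; exists (1 + b) => k.
rewrite enorm_sym; apply: le_trans (_ : 1 + enorm (x k w - xs) ^+ 2 <= _); last first.
  by apply: le_trans (hb k) _; rewrite lerDr.
have := enorm_ge0 (x k w - xs); move: (enorm _) => e e0; nra.
Qed.

Lemma iterate_limits : \forall w \ae Pr,
  [/\ exists B, forall k, enorm (x k w) <= B,
      dist_to (x k w) (solutions X T) @[k --> \oo] --> (0 : R),
      r (x k w) @[k --> \oo] --> (0 : R) &
      cluster (x k w @[k --> \oo]) `<=` solutions X T].
Proof.
have [_ rle [B rsum] bnd] := iterate_moments.
have rae := ae_cvg0_summable_mean rle rsum.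
apply: filterS2 bnd rae => w [b hb] hr.
have r0 : r (x k w) @[k --> \oo] --> (0 : R).
  have hs : Num.sqrt (r (x k w) ^+ 2) @[k --> \oo] --> Num.sqrt (0 : R).
    by apply: continuous_cvg hr; exact: sqrt_continuous.
  rewrite sqrtr0 in hs; apply: cvg_trans hs; apply: near_eq_cvg.
  by apply: nearW => k; rewrite sqrtr_sqr ger0_norm// enorm_ge0.
have rc : continuous (fun y => residual X T (proj X y)).
  exact: lipschitz_enorm_continuous (residual_proj_lipschitz model).
have Xxw k := Xx k w.
split => //.
- exists (enorm xs + b) => k.
  rewrite (_ : x k w = xs - (xs - x k w)); last by rewrite opprB addrCA subrr addr0.
  apply: le_trans (ler_enormD _ _) _.
  by rewrite enormN lerD2l.
- exact: (residual_dist X0 Xcl Xcvx rc Xxw sol hb r0).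
- exact: (residual_cluster X0 Xcl Xcvx rc Xxw r0).
Qed.

Lemma mean_residual_cvg0 : mean Pr (fun w => r (x k w) ^+ 2) @[k --> \oo] --> (0 : R).
Proof.
have [_ rle [B rsum] _] := iterate_moments.
by apply: cvg0_bounded_sum rsum => k; apply: mean_ge0 => w; exact: sqr_ge0.
Qed.

End Asymptotics.

(** * Rate *)

Lemma bigmine_le_average {R : realType} (f : nat -> R) (c : R) k :
  \sum_(i < k.+1) f i <= k.+1%:R * c ->
  (\big[mine/+oo]_(i < k.+1) (f i)%:E <= c%:E)%E.
Proof.
move=> fc; have [i fi] : exists i : 'I_k.+1, f i <= c.
  apply: contrapT => h; move: fc; apply/negP; rewrite -ltNge.
  rewrite (_ : k.+1%:R * c = \sum_(i < k.+1) c).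
    apply: ltr_sum.
      by apply/hasP; exists ord0; rewrite // mem_index_enum.
    by move=> i _; rewrite ltNge; apply/negP => ?; apply: h; exists i.
  by rewrite sumr_const card_ord mulr_natl.
by apply: (@le_trans _ _ (f i)%:E); [exact: bigmin_le_cond | rewrite lee_fin].
Qed.

Section Rate.
Context {R : realType} {d : nat} {dXi : measure_display} {Xi : measurableType dXi}.
Variables (P : probability Xi R) (X : set 'rV[R]_d).
Variables (F : Xi -> 'rV[R]_d -> 'rV[R]_d) (Lip : Xi -> R).
Hypothesis model : square_integrable_model P X F Lip.
Variables (ah theta lam : R).
Hypotheses (ah01 : 0 < ah <= 1) (theta01 : 0 < theta < 1) (lam0 : 0 < lam).
Hypothesis lam6 : 6 * lam ^+ 2 < 1.
Variable x0 : 'rV[R]_d.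
Hypothesis Xx0 : X x0.
Context {dW : measure_display} {W : measurableType dW}.
Variables (Pr : probability W R) (Nk : nat -> nat) (xi eta : forall k, 'I_(Nk k) -> W -> Xi).
Hypotheses (Nk0 : forall k, (0 < Nk k)%N) (iid : iid_sample P Pr (all_draws xi eta)).
Variable S : R.
Hypothesis Nk_sum : forall n, \sum_(k < n) (Nk k)%:R^-1 <= S.

Let T := mean_op P F.
Let x := iterate X F ah theta lam x0 xi eta.
Let gen := generated X F ah theta lam x0 xi eta.
Let gain := residual_gain P X F Lip ah theta lam.
Let r := residual X T.
Let K := Lnorm_lip P Lip 2.

(** [J] bounds the distances on [gen] only, so the recursion runs on [a j], the mean over [gen j].
    The coefficients [u] and [v] stay abstract: the compact case has [v = 0] and puts its diameter
    term into [u]. *)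
Lemma mean_residual_rate (xs : 'rV[R]_d) (u v J : R) : 0 <= u -> 0 <= v -> 0 <= J ->
  (forall k y, X y -> mean_le Pr (fun w =>
     enorm (next_point X F ah theta lam (@xi k) (@eta k) y w w - xs) ^+ 2 + gain y)
     (enorm (y - xs) ^+ 2 + (u + v * enorm (y - xs) ^+ 2) / (Nk k)%:R)) ->
  (forall k, mean_le Pr (fun w => \1_(gen k) w * enorm (x k w - xs) ^+ 2) J) ->
  (forall k, exists c, mean_le Pr (fun w => r (x k w) ^+ 2) c) ->
  forall k, (\big[mine/+oo]_(i < k.+1) \int[Pr]_(w in gen i) (r (x i w) ^+ 2)%:E <=
    (k.+1%:R^-1 * (2 * K ^+ 2 / ((1 - 6 * lam ^+ 2) * Num.min (lam * theta) ah ^+ 2)) *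
     (enorm (x0 - xs) ^+ 2 + (u + v * J) * S))%:E)%E.
Proof.
move=> u0 v0 J0 step hJ rle k.
have hgen j : history xi eta j (gen j) := history_generated model lam ah01 theta01 Xx0 (k := j).
have mgen j : measurable (gen j) := history_measurable iid (hgen j).
pose kappa := (1 - 6 * lam ^+ 2) / 2 * (Num.min (lam * theta) ah ^+ 2 / K ^+ 2).
have kap0 : 0 < kappa := gain_factor_gt0 model ah01 theta01 lam0 lam6.
pose rho j w := \1_(gen j) w * r (x j w) ^+ 2.
have rho_le j : mean_le Pr (rho j) (mean Pr (rho j)).
  have [c hc] := rle j; have [mr _ _] := hc.
  apply: mean_leP; apply: (mean_leW hc).
  - by apply: measurable_funM => //; exact: measurable_indic.
  - by move=> w; rewrite mulr_ge0 ?sqr_ge0// indicE.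
  - by move=> w; rewrite /rho indicE; case: (_ \in _); rewrite ?mul1r// mul0r sqr_ge0.
pose a j := mean Pr (fun w => \1_(gen j) w * enorm (x j w - xs) ^+ 2).
have key j : a j.+1 + kappa * mean Pr (rho j) <= a j + (u + v * J) / (Nk j)%:R.
  pose A := gen j; have mA : measurable A := mgen j.
  have PA1 : fine (Pr A) <= 1 by rewrite -lee_fin fineK ?fin_num_measure ?probability_le1.
  have N0 : 0 <= (Nk j)%:R^-1 :> R by rewrite invr_ge0.
  have h1 : mean_le Pr (fun w => \1_A w * (enorm (x j w - xs) ^+ 2 +
      (u + v * enorm (x j w - xs) ^+ 2) / (Nk j)%:R + 0)) (a j + (u + v * J) / (Nk j)%:R).
    have hu := mean_leZ u0 (mean_le_le (mean_le_indic Pr mA) PA1).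
    have hs := mean_leD (mean_leP (hJ j)) (mean_leZ N0 (mean_leD hu (mean_leZ v0 (hJ j)))).
    apply: (mean_le_le (b := a j + (Nk j)%:R^-1 * (u * 1 + v * J))).
      rewrite (_ : (fun _ => _) = (fun w => \1_A w * enorm (x j w - xs) ^+ 2 +
        (Nk j)%:R^-1 * (u * \1_A w + v * (\1_A w * enorm (x j w - xs) ^+ 2))))//.
      by apply/funext => w; move: (\1_A w) (enorm _) (_^-1) => p q s; ring.
    by rewrite mulr1 mulrC.
  have h2 := mean_le_iterate model ah01 theta01 Xx0 iid (ltW lam6) (hgen j) (lexx 0) (step j) h1.
  rewrite -/x -/A -/gain in h2.
  have mi : measurable_fun setT (\1_A : W -> R) by exact: measurable_indic.
  have md : measurable_fun setT (fun w => enorm (x j.+1 w - xs) ^+ 2).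
    apply: measurable_funX; apply: measurable_enorm; apply: vmeasB; last exact: vmeas_cst.
    exact: (vmeas_iterateT model lam ah01 theta01 Xx0 iid).
  have h3 := mean_leZ (ltW kap0) (rho_le j).
  have h4 : mean_le Pr (fun w => \1_A w * enorm (x j.+1 w - xs) ^+ 2) (a j + (u + v * J) / (Nk j)%:R).
    apply: (mean_leW h2); first exact: measurable_funM.
      by move=> w; rewrite mulr_ge0 ?sqr_ge0// indicE.
    move=> w; rewrite ler_wpM2l ?indicE// addr0 lerDl.
    by apply: residual_gain_ge0 => //; exact: ltW.
  (* [gen] is decreasing, so the mean over [gen j] dominates the one over [gen j.+1], which closes
     the recursion. *)
  have h5 : a j.+1 <= mean Pr (fun w => \1_A w * enorm (x j.+1 w - xs) ^+ 2).
    have [mJ _ _] := hJ j.+1.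
    apply: mean_le_mean; apply: (mean_leW (mean_leP h4)) => //.
      by move=> w; rewrite mulr_ge0 ?sqr_ge0// indicE.
    move=> w; rewrite ler_wpM2r ?sqr_ge0// !indicE.
    have [|//] := boolP (w \in gen j.+1); rewrite inE => wg.
    by rewrite mem_set// => i ij; apply: wg; exact: leqW.
  have h6 : mean_le Pr (fun w => \1_A w * enorm (x j.+1 w - xs) ^+ 2 + kappa * rho j w)
      (a j + (u + v * J) / (Nk j)%:R).
    rewrite (_ : (fun _ => _) = (fun w => \1_A w * (enorm (x j.+1 w - xs) ^+ 2 + gain (x j w) + 0)))//.
    apply/funext => w; rewrite /gain /residual_gain -/K -/kappa -/r /rho -/A.
    by clearbody kappa; move: (\1_A w) (enorm _) (r _) => p q s; ring.
  have := mean_le_mean h6; rewrite (meanD h4 h3) (meanZ (ltW kap0) (rho_le j)).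
  by apply: le_trans; rewrite lerD2r.
have tele n : a n + kappa * \sum_(i < n) mean Pr (rho i) <=
    enorm (x0 - xs) ^+ 2 + (u + v * J) * \sum_(i < n) (Nk i)%:R^-1.
  elim: n => [|n IH].
    rewrite !big_ord0 !mulr0 !addr0; apply: mean_le_mean.
    rewrite (_ : (fun _ => _) = fun=> enorm (x0 - xs) ^+ 2).
      by apply: mean_le_cst; exact: sqr_ge0.
    apply/funext => w; rewrite (_ : gen 0%N = setT) ?indicT ?mul1r//.
    by apply/seteqP; split.
  rewrite !big_ord_recr/= !mulrDr; have := key n; move: IH.
  move: (a n) (a n.+1) (kappa * mean _ _) (kappa * \sum_(i < n) _) => p q s t.
  move: ((u + v * J) / _) ((u + v * J) * _) (enorm _ ^+ 2) => e f g; lra.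
have sumr : \sum_(i < k.+1) mean Pr (rho i) <=
    kappa^-1 * (enorm (x0 - xs) ^+ 2 + (u + v * J) * S).
  rewrite -ler_pdivrMl ?invr_gt0// invrK.
  have a0 : 0 <= a k.+1.
    by apply: mean_ge0 => w; rewrite mulr_ge0 ?sqr_ge0// indicE.
  apply: le_trans (_ : a k.+1 + kappa * \sum_(i < k.+1) mean Pr (rho i) <= _); first by rewrite lerDr.
  apply: (le_trans (tele k.+1)); rewrite lerD2l ler_wpM2l//.
  by rewrite addr_ge0// mulr_ge0.
have -> : 2 * K ^+ 2 / ((1 - 6 * lam ^+ 2) * Num.min (lam * theta) ah ^+ 2) = kappa^-1.
  rewrite /kappa !invfM !invrK.
  by move: (1 - _)^-1 (_ / Num.min _ _) => p q; ring.
rewrite (eq_bigr (fun i : 'I_k.+1 => (mean Pr (rho i))%:E)); last first.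
  by move=> i _; rewrite integral_indicM// -(mean_leE (rho_le i)).
apply: (bigmine_le_average (f := fun i => mean Pr (rho i))); rewrite -mulrA mulVKf ?pnatr_eq0//.
Qed.

End Rate.

(** * One-step bounds from the trial-error hypothesis *)

Section TrialErrorSteps.
Context {R : realType} {d : nat} {dXi : measure_display} {Xi : measurableType dXi}.
Variables (P : probability Xi R) (X : set 'rV[R]_d).
Variables (F : Xi -> 'rV[R]_d -> 'rV[R]_d) (Lip : Xi -> R).
Hypothesis model : square_integrable_model P X F Lip.
Variables (ah theta lam : R).
Hypotheses (ah01 : 0 < ah <= 1) (theta01 : 0 < theta < 1) (lam0 : 0 < lam).
Hypothesis lam6 : 6 * lam ^+ 2 <= 1.

Let X0 : X !=set0 := model_nonempty model.
Let Xcl : closed X := model_closed model.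
Let Xcvx : convex_set X := model_convex model.
Let ah0 : 0 < ah. Proof. by case/andP: ah01. Qed.
Let T := mean_op P F.
Let L := Lmean P Lip.
Let L2 := Lq P Lip 2.

Section Sample.
Context {dW : measure_display} {W : measurableType dW}.
Variables (Pr : probability W R) (M : nat) (s : 'I_M -> W -> Xi).
Hypotheses (M0 : (0 < M)%N) (iid : iid_sample P Pr s).
Variables (x xs : 'rV[R]_d).
Hypotheses (Xx : X x) (sol : solutions X T xs).
Variable bound : 'rV[R]_d -> 'rV[R]_d -> R.
Hypotheses (teb : trial_error_bound P X F ah bound) (bound0 : 0 <= bound x xs).

Let bound_sqr : (bound x xs / Num.sqrt M%:R) ^+ 2 = bound x xs ^+ 2 / M%:R.
Proof. by rewrite expr_div_n sqr_sqrtr. Qed.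

(** A zero step leaves a point of [X] in place, so the trial bound also covers errors at
    deterministic points. It is used for the first sample at [x] and for the second sample at a
    frozen search point. *)
Lemma trial_error_iterate :
  mean_le Pr (fun w => enorm (emp_err P F (fun j => s j w) x) ^+ 2) (bound x xs ^+ 2 / M%:R).
Proof.
rewrite -bound_sqr; apply: Lnm_mean_le => //.
- by rewrite divr_ge0// sqrtr_ge0.
- by apply: measurable_enorm; apply: (vmeas_emp_err model iid (x := fun=> x)) => //; exact: vmeas_cst.
- by move=> w; exact: enorm_ge0.
have al01 (w : W) : 0 <= (0 : R) <= ah by rewrite lexx ltW.
have E : (fun w => enorm (emp_err P F (fun j => s j w)
      (trial_point X F (fun j => s j w) x 0))) =
    (fun w => enorm (emp_err P F (fun j => s j w) x)).
  by apply/funext => w; rewrite /trial_point scale0r subr0 proj_id.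
by have := teb M0 iid (measurable_cst (0 : R)) al01 Xx sol; rewrite E.
Qed.

Lemma trial_error_search :
  mean_le Pr (fun w => enorm (emp_err P F (fun j => s j w)
    (search_point X F ah theta lam s x w)) ^+ 2) (bound x xs ^+ 2 / M%:R).
Proof.
rewrite -bound_sqr; apply: Lnm_mean_le => //.
- by rewrite divr_ge0// sqrtr_ge0.
- apply: measurable_enorm; apply: (vmeas_emp_err model iid).
    exact: (vmeas_search_point model lam ah01 theta01 iid Xx).
  by move=> w; exact: projX.
- by move=> w; exact: enorm_ge0.
exact: (teb M0 iid (measurable_search_step model lam ah01 theta01 iid Xx)
  (search_step_itv X F lam ah01 theta01 s x) Xx sol).
Qed.

End Sample.

Section Step.
Context {dW : measure_display} {W : measurableType dW}.
Variables (Pr : probability W R) (M : nat) (s t : 'I_M -> W -> Xi).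
Hypotheses (M0 : (0 < M)%N) (iid : iid_sample P Pr (both_samples s t)).
Variables (x xs : 'rV[R]_d).
Hypotheses (Xx : X x) (sol : solutions X T xs) (pm : pseudo_monotone X T).
Let iids := iid_fst iid.
Let iidt := iid_snd iid.
Let gain := residual_gain P X F Lip ah theta lam.

Lemma next_point_bounded (p : 'rV[R]_d -> R) (q : R) : 0 <= p xs -> 0 <= q ->
  trial_error_bound P X F ah (fun _ ys => p ys + q) ->
  mean_le Pr (fun w => enorm (next_point X F ah theta lam s t x w w - xs) ^+ 2 + gain x)
    (enorm (x - xs) ^+ 2 +
     ah ^+ 2 * ((26 - 12 * lam ^+ 2) * (p xs ^+ 2 + q ^+ 2)) / M%:R).
Proof.
move=> p0 q0 teb; have pq0 : 0 <= p xs + q by exact: addr_ge0.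
have B1 := trial_error_iterate M0 iids Xx sol teb pq0.
have B2 := trial_error_search M0 iids Xx sol teb pq0.
have B3 y : X y -> _ := fun Xy => trial_error_iterate (x := y) M0 iidt Xy sol teb pq0.
have c0 : 0 <= (p xs + q) ^+ 2 / M%:R by rewrite divr_ge0// sqr_ge0.
have B4 := mean_le_cst Pr c0.
have h := mean_le_next_point model ah01 theta01 lam0 M0 iid Xx sol pm lam6 B1 B2 B3 B4.
apply: (mean_le_le h); rewrite lerD2l -mulrA ler_wpM2l ?sqr_ge0//.
have N0 : 0 <= (M%:R)^-1 :> R by rewrite invr_ge0.
(* The weights [1 - 6 * lam ^+ 2], 6 and 6 of the three errors add up to [13 - 6 * lam ^+ 2];
   splitting the square of [p xs + q] doubles this. *)
rewrite (_ : _ + _ = (13 - 6 * lam ^+ 2) * (p xs + q) ^+ 2 / M%:R); last first.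
  by move: M%:R^-1 => m; ring.
rewrite ler_wpM2r//.
move: (p xs) => r; move: lam6; move: (lam ^+ 2) => l l6; have := sqr_ge0 (r - q); nra.
Qed.

(* The extrapolation error carries the constant [min L_2 q]: both the second
   moment of the noise and the trial bound (at a zero step) control it, and
   the former is needed for the term with the factor [G]. *)
Lemma next_point_linear (p : 'rV[R]_d -> R) (q G : R) : sigma P F 2 xs <= p xs -> 0 <= q ->
  L2 * ah / Num.sqrt M%:R <= G ->
  trial_error_bound P X F ah (fun y ys => p ys + q * enorm (y - ys)) ->
  mean_le Pr (fun w => enorm (next_point X F ah theta lam s t x w w - xs) ^+ 2 + gain x)
    (enorm (x - xs) ^+ 2 +
     ah ^+ 2 * (2 * p xs ^+ 2 * (6 * (1 + G) ^+ 2 + 7 - 6 * lam ^+ 2)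
      + 2 * (6 * (1 + L * ah + G) ^+ 2 + 7 - 6 * lam ^+ 2) * q ^+ 2 * enorm (x - xs) ^+ 2) / M%:R).
Proof.
move=> sp q0 hG teb; have [Xxs _] := sol.
have [s0 _] := sigma2_mean model Xxs.
set S := sigma P F 2 xs in sp s0.
have p0 : 0 <= p xs by exact: le_trans sp.
have L20 : 0 <= L2 by exact: (le_trans ler01 (Lq_ge1 model)).
have L0 : 0 <= L := Lmean_ge0 model.
set D := enorm (x - xs).
have D0 : 0 <= D by exact: enorm_ge0.
have b0 y : 0 <= p xs + q * enorm (y - xs) by rewrite addr_ge0// mulr_ge0// enorm_ge0.
have B1 := trial_error_iterate M0 iids Xx sol teb (b0 x).
have B2 := trial_error_search M0 iids Xx sol teb (b0 x).
set c := p xs in sp p0 b0 B1 B2 *.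
pose v := Num.min L2 q.
have v0 : 0 <= v by rewrite le_min L20.
pose b3 y := (c + v * enorm (y - xs)) ^+ 2 / M%:R.
have N0 : 0 <= (M%:R)^-1 :> R by rewrite invr_ge0.
have B3 y : X y -> mean_le Pr (fun w => enorm (emp_err P F (fun j => t j w) y) ^+ 2) (b3 y).
  move=> Xy; rewrite /b3 /v; have [_|_] := leP L2 q; last first.
    exact: (trial_error_iterate M0 iidt Xy sol teb (b0 y)).
  apply: (mean_le_le (mean_le_emp_err model M0 iidt Xy (noise_sqr model Xy Xxs))).
  rewrite ler_wpM2r//; apply: sqr_ler; last by rewrite lerD2r.
  by rewrite addr_ge0// mulr_ge0// enorm_ge0.
have M0R : 0 < M%:R :> R by rewrite ltr0n.
pose Q := (S + L2 * D) / Num.sqrt M%:R.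
have Q0 : 0 <= Q by rewrite divr_ge0 ?sqrtr_ge0// addr_ge0// mulr_ge0.
have hQ : mean_le Pr (fun w => enorm (emp_err P F (fun j => s j w) x) ^+ 2) (Q ^+ 2).
  rewrite expr_div_n sqr_sqrtr//.
  exact: (mean_le_emp_err model M0 iids Xx (noise_sqr model Xx Xxs)).
have B4 : mean_le Pr (fun w => b3 (search_point X F ah theta lam s x w))
    ((c + v * ((1 + L * ah) * D + ah * Q)) ^+ 2 / M%:R).
  rewrite [X in mean_le _ _ X]mulrC /b3; under eq_fun do rewrite mulrC.
  apply: mean_leZ => //.
  exact: (mean_le_search_dist model lam ah01 theta01 iids Xx sol p0 v0 Q0 hQ).
have h := mean_le_next_point model ah01 theta01 lam0 M0 iid Xx sol pm lam6 B1 B2 B3 B4.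
apply: (mean_le_le h); rewrite lerD2l -mulrA ler_wpM2l ?sqr_ge0//.
(* In [v * (ah * Q)], the part with [S] uses [v <= L2] and the part with [L2 * D] uses [v <= q]; the
   bound of [L2 * ah / Num.sqrt M%:R] by [G] absorbs both. *)
have hv : c + v * ((1 + L * ah) * D + ah * Q) <= (1 + G) * c + (1 + L * ah + G) * (q * D).
  have vL : v <= L2 by rewrite ge_min lexx.
  have vq : v <= q by rewrite ge_min lexx orbT.
  have g0 : 0 <= ah / Num.sqrt M%:R by rewrite divr_ge0 ?sqrtr_ge0// ltW.
  have e1 : v * (ah * Q) = v * (ah / Num.sqrt M%:R) * S + L2 * (ah / Num.sqrt M%:R) * (v * D).
    by rewrite /Q; move: (Num.sqrt _)^-1 => m; ring.
  have e2 : L2 * (ah / Num.sqrt M%:R) <= G by rewrite mulrA.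
  have G0 : 0 <= G by apply: le_trans e2; rewrite mulr_ge0.
  have i1 : v * (ah / Num.sqrt M%:R) * S <= G * c.
    apply: ler_pM => //; first by rewrite mulr_ge0.
    by apply: le_trans e2; rewrite ler_wpM2r.
  have i2 : L2 * (ah / Num.sqrt M%:R) * (v * D) <= G * (q * D).
    apply: ler_pM => //; [by rewrite mulr_ge0 | by rewrite mulr_ge0 |].
    by rewrite ler_wpM2r.
  have i3 : v * ((1 + L * ah) * D) <= (1 + L * ah) * (q * D).
    rewrite mulrCA ler_wpM2l//; first by rewrite addr_ge0// mulr_ge0// ltW.
    by rewrite ler_wpM2r.
  rewrite mulrDr e1 !addrA.
  apply: le_trans (lerD (lerD (lerD (lexx c) i3) i1) i2) _.
  by rewrite le_eqVlt; apply/orP; left; apply/eqP; ring.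
have hs : (c + v * ((1 + L * ah) * D + ah * Q)) ^+ 2 <= ((1 + G) * c + (1 + L * ah + G) * (q * D)) ^+ 2.
  by apply: sqr_ler => //; rewrite addr_ge0// mulr_ge0// addr_ge0// mulr_ge0 ?(ltW ah0)// addr_ge0 ?mulr_ge0 ?(ltW ah0).
move: hs lam6; rewrite -/D; move: ((c + v * _) ^+ 2) (lam ^+ 2) => A l hs l6.
rewrite (_ : _ + _ = ((7 - 6 * l) * (c + q * D) ^+ 2 + 6 * A) / M%:R); last first.
  by move: M%:R^-1 => m; ring.
rewrite ler_wpM2r//; move: hs; move: (1 + G) (1 + L * ah + G) => g k hs.
have i1 := sqr_ge0 (c - q * D); have i2 := sqr_ge0 (g * c - k * (q * D)).
have i3 : 0 <= (7 - 6 * l) * (c - q * D) ^+ 2 by rewrite mulr_ge0// subr_ge0; lra.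
(* By [2 a^2 + 2 b^2 = (a + b)^2 + (a - b)^2], with weight [7 - 6 * l] for the first sample's two
   errors and 6 for the second sample's, the target exceeds the bound by a sum of squares. This
   explains the shape of [C2_general] and [C2bar_general]. *)
have -> : 2 * c ^+ 2 * (6 * g ^+ 2 + 7 - 6 * l) + 2 * (6 * k ^+ 2 + 7 - 6 * l) * q ^+ 2 * D ^+ 2 =
   ((7 - 6 * l) * (c + q * D) ^+ 2 + 6 * (g * c + k * (q * D)) ^+ 2) +
   ((7 - 6 * l) * (c - q * D) ^+ 2 + 6 * (g * c - k * (q * D)) ^+ 2) by ring.
lra.
Qed.

End Step.

End TrialErrorSteps.

Lemma mean_le_finite {R : realType} {dW : measure_display} {W : measurableType dW}
    (Pr : probability W R) (f : W -> R) :
  measurable_fun setT f -> (forall w, 0 <= f w) -> (\int[Pr]_w (f w)%:E < +oo)%E ->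
  exists c, mean_le Pr f c.
Proof.
move=> mf f0 fin; exists (fine (\int[Pr]_w (f w)%:E)%E); split => //.
by rewrite fineK// ge0_fin_numE// integral_ge0// => w _; rewrite lee_fin.
Qed.

Lemma compact_enorm_bounded {R : realType} {d : nat} (X : set 'rV[R]_d) : compact X ->
  exists B, forall u v, X u -> X v -> enorm (u - v) <= B.
Proof.
move=> Xc.
have [[z Xz]|X0] := pselect (exists z, X z); last first.
  by exists 0 => u v Xu; case: X0; exists u.
have /compact_bounded[B [_ hB]] : compact ((fun y => enorm (z - y)) @` X).
  by apply: continuous_compact => //; apply: continuous_subspaceT; exact: enorm_dist_continuous.
have hB1 y : X y -> enorm (z - y) <= B + 1.
  have B1 : B < B + 1 by rewrite ltrDl.
  move=> Xy; have /= := hB (B + 1) B1 (enorm (z - y)).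
  rewrite ger0_norm ?enorm_ge0//; apply; last by exists y.
exists ((B + 1) + (B + 1)) => u v Xu Xv.
apply: le_trans (ler_enorm_dist z u v) _.
by apply: lerD; [rewrite enorm_sym|]; exact: hB1.
Qed.

Section Assumptions.
Context {R : realType} {d : nat} {dXi : measure_display} {Xi : measurableType dXi}.
Variables (P : probability Xi R) (X : set 'rV[R]_d).
Variables (F : Xi -> 'rV[R]_d -> 'rV[R]_d) (Lip : Xi -> R) (a : nat).
Hypotheses (X0 : X !=set0) (Xcl : closed X) (Xcvx : convex_set X).
Hypotheses (mF : random_operator X F) (htl : heavy_tailed_lipschitz P X F a Lip).

Let measurable_opX x n : X x -> measurable_fun setT (fun s => enorm (F s x) ^+ n).
Proof.
move=> Xx; apply: measurable_funX; apply: measurable_enorm.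
exact: (vmeas_op Xcl mF (s := id) (x := fun=> x)).
Qed.

Lemma heavy_tailed_moments :
  (exists c, mean_le P (fun s => Lip s ^+ (2 * a)) c) /\
  exists2 x, X x & exists c, mean_le P (fun s => enorm (F s x) ^+ (2 * a)) c.
Proof.
have [[mLip Lip0] _ [x Xx hx] hL] := htl; split.
  apply: mean_le_finite hL; first exact: measurable_funX.
  by move=> s; rewrite exprn_ge0.
exists x => //; apply: mean_le_finite hx; first exact: measurable_opX.
by move=> s; rewrite exprn_ge0// enorm_ge0.
Qed.

Lemma heavy_tailed_model : (a = 1%N \/ a = 2%N) -> square_integrable_model P X F Lip.
Proof.
move=> a12; have [[mLip Lip0] aeL _ _] := htl.
have [[c hc] [x Xx [c' hc']]] := heavy_tailed_moments.
have sq (f : Xi -> R) b : measurable_fun setT f -> mean_le P (fun s => f s ^+ (2 * a)) b ->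
    exists b', mean_le P (fun s => f s ^+ 2) b'.
  move=> mf; case: a12 => -> h; first by exists b.
  exists (1 + b); apply: (mean_leW (mean_leD (mean_le_cst P ler01) h)).
  - exact: measurable_funX.
  - by move=> s; exact: sqr_ge0.
  move=> s; rewrite (pow4E (f s)); have := sqr_ge0 (f s); move: (f s ^+ 2) => y y0; nra.
split => //; first exact: sq hc.
exists x => //; apply: sq hc'.
by have := measurable_opX 1 Xx; under eq_fun do rewrite expr1.
Qed.

Lemma heavy_tailed_search_moments : (a = 1%N /\ compact X) \/ a = 2%N ->
  search_moments P X F Lip.
Proof.
case=> [[_ Xc]|a2]; [by left; exact: compact_enorm_bounded | right].
by have := heavy_tailed_moments; rewrite a2.
Qed.

End Assumptions.

(** * Conclusions for the generated iterates *)

Section Conclusions.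
Context {R : realType} {d : nat} {dXi : measure_display} {Xi : measurableType dXi}.
Variables (P : probability Xi R) (X : set 'rV[R]_d).
Variables (F : Xi -> 'rV[R]_d -> 'rV[R]_d) (Lip : Xi -> R).
Hypothesis model : square_integrable_model P X F Lip.
Hypothesis sm : search_moments P X F Lip.
Variables (ah theta lam : R).
Hypotheses (ah01 : 0 < ah <= 1) (theta01 : 0 < theta < 1) (lam0 : 0 < lam).
Hypothesis lam6 : 6 * lam ^+ 2 < 1.
Variable x0 : 'rV[R]_d.
Hypothesis Xx0 : X x0.
Context {dW : measure_display} {W : measurableType dW}.
Variables (Pr : probability W R) (Nk : nat -> nat) (xi eta : forall k, 'I_(Nk k) -> W -> Xi).
Hypotheses (Nk0 : forall k, (0 < Nk k)%N) (iid : iid_sample P Pr (all_draws xi eta)).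
Variable S : R.
Hypothesis Nk_sum : forall n, \sum_(k < n) (Nk k)%:R^-1 <= S.
Variable xs : 'rV[R]_d.

Let T := mean_op P F.

Hypotheses (sol : solutions X T xs) (pm : pseudo_monotone X T).

Let x := iterate X F ah theta lam x0 xi eta.
Let gen := generated X F ah theta lam x0 xi eta.
Let stop := stops X F ah theta lam x0 xi eta.
Let r := residual X T.

Let mgen k : measurable (gen k) :=
  history_measurable iid (history_generated model lam ah01 theta01 Xx0 (k := k)).

Lemma stops_or_generated w : (exists k, stop k w) \/ forall k, gen k w.
Proof.
have [|h] := pselect (exists k, stop k w); [by left | right].
suff : forall k, ~ stop_test X F ah theta lam x0 xi eta k w by move=> ns k i _; exact: ns.
by elim/ltn_ind => k IH sk; apply: h; exists k; split.
Qed.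

Lemma stops_solution k (A : set W) : history xi eta k A ->
  (\forall w \ae Pr, A w -> stop k w) -> \forall w \ae Pr, A w -> solutions X T (x k w).
Proof.
move=> hA As; apply: (stopped_solution model ah01 theta01 Xx0 Nk0 iid hA).
by apply: filterS As => w h /h [].
Qed.

(** The iterates continue past the stopping test, so the unrestricted means dominate those over
    [gen k]. *)
Lemma generated_residual_cvg0 :
  (\int[Pr]_(w in gen k) (r (x k w) ^+ 2)%:E)%E @[k --> \oo] --> 0%E.
Proof.
have [_ rle _ _] := iterate_moments model sm ah01 theta01 lam0 lam6 Xx0 Nk0 iid Nk_sum sol pm.
have rcv := mean_residual_cvg0 model sm ah01 theta01 lam0 lam6 Xx0 Nk0 iid Nk_sum sol pm.
pose m k := mean Pr (fun w => \1_(gen k) w * r (x k w) ^+ 2).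
have hm k : mean_le Pr (fun w => \1_(gen k) w * r (x k w) ^+ 2) (mean Pr (fun w => r (x k w) ^+ 2)).
  have [c hc] := rle k; have [mr _ _] := hc.
  apply: (mean_leW (mean_leP hc)).
  - by apply: measurable_funM => //; exact: measurable_indic.
  - by move=> w; rewrite mulr_ge0 ?sqr_ge0// indicE.
  - by move=> w; rewrite indicE; case: (_ \in _); rewrite ?mul1r// mul0r sqr_ge0.
rewrite (_ : (fun k => _) = EFin \o m); last first.
  by apply/funext => k /=; rewrite integral_indicM// (mean_leE (hm k)).
apply: cvg_EFin; first by apply: nearW => k.
apply: (squeeze_cvgr _ (cvg_cst 0) rcv); apply: nearW => k /=.
rewrite (mean_le_mean (hm k)) andbT; apply: mean_ge0 => w.
by rewrite mulr_ge0 ?sqr_ge0// indicE.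
Qed.

Lemma generated_mean_le (f g : W -> R) B k : measurable_fun setT f -> (forall w, 0 <= f w) ->
  (forall w, f w <= g w) -> mean_le Pr g B -> (\int[Pr]_(w in gen k) (f w)%:E <= B%:E)%E.
Proof.
move=> mf f0 fg hg; rewrite integral_indicM//.
suff [_ _] : mean_le Pr (fun w => \1_(gen k) w * f w) B by [].
apply: (mean_leW hg).
- by apply: measurable_funM => //; exact: measurable_indic.
- by move=> w; rewrite mulr_ge0// indicE.
- move=> w; apply: le_trans (fg w); rewrite indicE.
  by case: (_ \in _); rewrite ?mul1r// mul0r.
Qed.

Lemma generated_L2_bounded : exists B, forall k,
  (\int[Pr]_(w in gen k) (enorm (x k w) ^+ 2)%:E <= B%:E)%E.
Proof.
have [[B hB] _ _ _] := iterate_moments model sm ah01 theta01 lam0 lam6 Xx0 Nk0 iid Nk_sum sol pm.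
exists (2 * B + 2 * enorm xs ^+ 2) => k.
have c0 : 0 <= 2 * enorm xs ^+ 2 by rewrite mulr_ge0// sqr_ge0.
apply: (generated_mean_le _ _ _ _ (mean_leD (mean_leZ (ler0n R 2) (hB k)) (mean_le_cst Pr c0))).
- by apply: measurable_funX; apply: measurable_enorm; exact: (vmeas_iterateT model lam ah01 theta01 Xx0 iid).
- by move=> w; exact: sqr_ge0.
- by move=> w; have := enormD_sqr (x k w - xs) xs; rewrite subrK.
Qed.

Lemma iterate_alternative : \forall w \ae Pr,
  (exists k, stop k w) \/
  [/\ forall k, gen k w, exists B, forall k, enorm (x k w) <= B,
      dist_to (x k w) (solutions X T) @[k --> \oo] --> (0 : R),
      r (x k w) @[k --> \oo] --> (0 : R) &
      cluster (x k w @[k --> \oo]) `<=` solutions X T].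
Proof.
apply: filterS (iterate_limits model sm ah01 theta01 lam0 lam6 Xx0 Nk0 iid Nk_sum sol pm).
by move=> w [h1 h2 h3 h4]; have [|hg] := stops_or_generated w; [left | right].
Qed.

Let K := Lnorm_lip P Lip 2.
Let rate_factor k : R :=
  k.+1%:R^-1 * (2 * K ^+ 2 / ((1 - 6 * lam ^+ 2) * Num.min (lam * theta) ah ^+ 2)).

Variable J : R.
Hypotheses (J0 : 0 < J)
  (hJ : forall k, (\int[Pr]_(w in gen k) (enorm (x k w - xs) ^+ 2)%:E <= J%:E)%E).

Let hJm k : mean_le Pr (fun w => \1_(gen k) w * enorm (x k w - xs) ^+ 2) J.
Proof.
split; last by rewrite -integral_indicM.
  apply: measurable_funM; first exact: measurable_indic.
  apply: measurable_funX; apply: measurable_enorm; apply: vmeasB; last exact: vmeas_cst.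
  exact: (vmeas_iterateT model lam ah01 theta01 Xx0 iid).
by move=> w; rewrite mulr_ge0 ?sqr_ge0// indicE.
Qed.

Let rle k : exists c, mean_le Pr (fun w => r (x k w) ^+ 2) c.
Proof.
by have [_ rle _ _] := iterate_moments model sm ah01 theta01 lam0 lam6 Xx0 Nk0 iid Nk_sum sol pm.
Qed.

Lemma rate_general (C4 c2 c3 : R) : 0 < C4 -> 0 < c2 -> 0 < c3 ->
  (exists c, mean_le P (fun s => Lip s ^+ 4) c) ->
  (exists2 y, X y & exists c, mean_le P (fun s => enorm (F s y) ^+ 4) c) ->
  let Lb := Lbar4 P Lip ah C4 c2 c3 in
  trial_error_bound P X F ah (fun y ys =>
    c1 P Lip ah C4 * sigma P F 4 ys + Lb * enorm (y - ys)) ->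
  forall k, (\big[mine/+oo]_(i < k.+1) \int[Pr]_(w in gen i) (r (x i w) ^+ 2)%:E <=
    (rate_factor k * (enorm (x0 - xs) ^+ 2 +
      (C2_general P Lip ah lam C4 Nk * (ah * sigma P F 4 xs) ^+ 2 +
       C2bar_general P Lip ah lam Nk * (ah * Lb) ^+ 2 * J) * S))%:E)%E.
Proof.
move=> C40 c20 c30 hL4 hF4 Lb teb k; have [Xxs _] := sol.
have L21 : 1 <= Lq P Lip 2 := Lq_ge1 model.
have L0 : 0 <= Lmean P Lip := Lmean_ge0 model.
have ah0 : 0 < ah by case/andP: ah01.
have N40 : 0 <= Lnorm_lip P Lip 4 by rewrite fine_ge0// Lnorm_ge0.
have Gam1 : 1 <= Gam P Lip ah.
  by rewrite /Gam -addrA lerDl addr_ge0// mulr_ge0 ?(ltW ah0)// mulr_ge0.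
have c11 : 1 <= c1 P Lip ah C4.
  rewrite /c1; have : 0 <= C4 * Gam P Lip ah by rewrite mulr_ge0 ?(ltW C40)// (le_trans ler01).
  by lra.
have Lb0 : 0 <= Lb.
  rewrite /Lb /Lbar4 /c4 !addr_ge0// mulr_ge0 ?(ltW c20) ?(ltW c30)// ?(le_trans ler01 L21)//.
    by rewrite mulr_ge0 ?(ltW C40)// (le_trans ler01).
  by rewrite /Lq addr_ge0.
(* The trial bound involves the fourth-moment deviation, while the direct noise bound involves the
   second. Lyapunov's inequality compares them, and [c11] then gives the domination asked for by
   [next_point_linear]. *)
have [s0 s24] : 0 <= sigma P F 4 xs /\ sigma P F 2 xs <= sigma P F 4 xs.
  have [_ [c hc]] := noise_pow4 model hL4 hF4 Xxs.
  have mn : measurable_fun setT (fun s => enorm (noise P F xs s)).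
    by apply: measurable_enorm; exact: (vmeas_noise model).
  have [s40 h4] := mean_le_Lnm (q := 4) isT mn (fun s => enorm_ge0 _) (hc _ Xxs).
  split => //; apply: (mean_le_Lnm_le (q := 2)) => //.
    by move=> s; exact: enorm_ge0.
  apply: mean_le_root; [exact: sqr_ge0 | exact: measurable_funX | by move=> s; exact: sqr_ge0 |].
  by rewrite -pow4E; under eq_fun do rewrite -pow4E.
pose G := G2 P Lip ah Nk.
have hG j : Lq P Lip 2 * ah / Num.sqrt (Nk j)%:R <= G.
  apply: ub_le_sup; last by exists j.
  exists (Lq P Lip 2 * ah) => _ [i _ <-].
  have p0 : 0 <= Lq P Lip 2 * ah by rewrite mulr_ge0 ?(ltW ah0)// (le_trans ler01).
  have n1 : 1 <= (Nk i)%:R :> R by rewrite ler1n.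
  have r1 : 1 <= Num.sqrt (Nk i)%:R :> R by rewrite -[leLHS]sqrtr1 ler_wsqrtr.
  by rewrite ler_piMr// invf_le1// (lt_le_trans ltr01).
have sp : sigma P F 2 xs <= c1 P Lip ah C4 * sigma P F 4 xs.
  by apply: (le_trans s24); rewrite ler_peMl.
have lamC : 0 <= 7 - 6 * lam ^+ 2 by move: lam6; move: (lam ^+ 2) => l l6; lra.
have sqC (y : R) : 0 <= 6 * y ^+ 2 + 7 - 6 * lam ^+ 2.
  by rewrite -addrA addr_ge0// mulr_ge0// sqr_ge0.
apply: (mean_residual_rate model ah01 theta01 lam0 lam6 Xx0 iid Nk_sum) => //.
- by rewrite mulr_ge0 ?sqr_ge0// mulr_ge0// mulr_ge0// sqr_ge0.
- by rewrite mulr_ge0 ?sqr_ge0// mulr_ge0.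
- exact: ltW.
move=> j y Xy.
apply: (mean_le_le (next_point_linear (p := fun ys => c1 P Lip ah C4 * sigma P F 4 ys) model ah01 theta01 lam0 (ltW lam6) (Nk0 j)
  (iid_present iid j) Xy sol pm sp Lb0 (hG j) teb)).
rewrite /C2_general /C2bar_general -/G lerD2l le_eqVlt; apply/orP; left; apply/eqP.
by move: (enorm _) (sigma _ _ _ _) (c1 _ _ _ _) (Lmean _ _) (_^-1) => e s c l n; ring.
Qed.

Lemma rate_compact (d2 : R) : 0 < d2 -> compact X -> diameter X ^+ 2 <= J ->
  let Ls := Lstar P Lip d2 in
  trial_error_bound P X F ah (fun _ ys => sigma P F 2 ys + Ls * diameter X) ->
  forall k, (\big[mine/+oo]_(i < k.+1) \int[Pr]_(w in gen i) (r (x i w) ^+ 2)%:E <=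
    (rate_factor k * (enorm (x0 - xs) ^+ 2 +
      (C2_compact lam * (ah * sigma P F 2 xs) ^+ 2 +
       C2_compact lam * (ah * Num.max (Lq P Lip 2) Ls) ^+ 2 * J) * S))%:E)%E.
Proof.
move=> d20 Xc dJ Ls teb k; have [Xxs _] := sol.
have L21 : 1 <= Lq P Lip 2 := Lq_ge1 model.
have ah0 : 0 < ah by case/andP: ah01.
have Ls0 : 0 <= Ls.
  by rewrite /Ls /Lstar addr_ge0// mulr_ge0 ?(ltW d20)// (le_trans ler01).
have diam0 : 0 <= diameter X.
  have [B hB] := compact_enorm_bounded Xc.
  apply: ub_le_sup; first by exists B => _ [[u v] [Xu Xv] <-]; exact: hB.
  by exists (xs, xs) => //=; rewrite subrr enorm0.
have [s0 _] := sigma2_mean model Xxs.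
have q0 : 0 <= Ls * diameter X by rewrite mulr_ge0.
(* The compact one-step bound has no term in the distance. The diameter enters as a constant, which
   [dJ] replaces by [J] at the end, with [Ls] below the maximum. *)
pose u := ah ^+ 2 * (C2_compact lam * (sigma P F 2 xs ^+ 2 + (Ls * diameter X) ^+ 2)).
have C0 : 0 <= C2_compact lam.
  by rewrite /C2_compact; move: lam6; move: (lam ^+ 2) => l l6; lra.
have u0 : 0 <= u by rewrite mulr_ge0 ?sqr_ge0// mulr_ge0// addr_ge0 ?sqr_ge0.
have S0 : 0 <= S by have := Nk_sum 0; rewrite big_ord0.
have step j y : X y -> mean_le Pr (fun w =>
    enorm (next_point X F ah theta lam (@xi j) (@eta j) y w w - xs) ^+ 2
    + residual_gain P X F Lip ah theta lam y)
    (enorm (y - xs) ^+ 2 + (u + 0 * enorm (y - xs) ^+ 2) / (Nk j)%:R).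
  move=> Xy; rewrite mul0r addr0.
  exact: (next_point_bounded (p := sigma P F 2) model ah01 theta01 lam0 (ltW lam6) (Nk0 j)
    (iid_present iid j) Xy sol pm s0 q0 teb).
have h := mean_residual_rate model ah01 theta01 lam0 lam6 Xx0 iid Nk_sum
  u0 (lexx 0) (ltW J0) step hJm rle k.
apply: (le_trans h); rewrite lee_fin mul0r addr0 ler_wpM2l//.
  rewrite mulr_ge0// ?invr_ge0// divr_ge0// mulr_ge0 ?sqr_ge0//.
  by rewrite subr_ge0 ltW.
rewrite lerD2l ler_wpM2r// /u.
have i1 : (Ls * diameter X) ^+ 2 <= Num.max (Lq P Lip 2) Ls ^+ 2 * J.
  rewrite exprMn ler_pM ?sqr_ge0// sqr_ler// le_max lexx orbT//.
rewrite [leRHS](_ : _ = ah ^+ 2 * (C2_compact lam * (sigma P F 2 xs ^+ 2 +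
    Num.max (Lq P Lip 2) Ls ^+ 2 * J))); last first.
  by move: (C2_compact _) (sigma _ _ _ _) (Num.max _ _) => c s l; ring.
by rewrite ler_wpM2l ?sqr_ge0// ler_wpM2l// lerD2l.
Qed.

End Conclusions.

Theorem theorem4p11 (R : realType) (d : nat)
    (dXi : measure_display) (Xi : measurableType dXi) (P : probability Xi R)
    (dW : measure_display) (W : measurableType dW) (Pr : probability W R)
    (X : set 'rV[R]_d) (F : Xi -> 'rV[R]_d -> 'rV[R]_d)
    (Lip : Xi -> R) (a : nat)
    (ah theta lam : R) (x0 : 'rV[R]_d) (N : nat) (b mu : R)
    (xi eta : forall k, 'I_(sample_size N b mu k) -> W -> Xi) :
  X !=set0 -> closed X -> convex_set X ->
  random_operator X F ->
  (a = 1%N /\ compact X) \/ a = 2%N ->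
  heavy_tailed_lipschitz P X F a Lip ->
  let T := mean_op P F in
  let Xstar := solutions X T in
  Xstar !=set0 ->
  pseudo_monotone X T ->
  X x0 -> 0 < ah <= 1 -> 0 < theta < 1 -> 0 < lam < (Num.sqrt 6)^-1 ->
  (0 < N)%N -> 0 < b -> 2 < mu ->
  iid_sample P Pr (all_draws xi eta) ->
  let x := iterate X F ah theta lam x0 xi eta in
  let gen := generated X F ah theta lam x0 xi eta in
  let stop := stops X F ah theta lam x0 xi eta in
  let r := residual X T in
  let Nk := sample_size N b mu in
  [/\
   [/\ (forall (k : nat) (A : set W), history xi eta k A ->
          (\forall w \ae Pr, A w -> stop k w) ->
          \forall w \ae Pr, A w -> Xstar (x k w)),
       (\forall w \ae Pr,
          (exists k, stop k w) \/
          [/\ forall k, gen k w,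
              exists B : R, forall k, enorm (x k w) <= B,
              dist_to (x k w) Xstar @[k --> \oo] --> (0 : R),
              r (x k w) @[k --> \oo] --> (0 : R) &
              cluster (x k w @[k --> \oo]) `<=` Xstar]) &
       (\int[Pr]_(w in gen k) (r (x k w) ^+ 2)%:E)%E @[k --> \oo] --> 0%E],
   (exists B : R, forall k,
      (\int[Pr]_(w in gen k) (enorm (x k w) ^+ 2)%:E <= B%:E)%E) &
   forall xs : 'rV[R]_d, Xstar xs -> forall J : R, 0 < J ->
   (forall k,
      (\int[Pr]_(w in gen k) (enorm (x k w - xs) ^+ 2)%:E <= J%:E)%E) ->
   let rate C Cbar Ltil := forall k : nat,
      (\big[mine/+oo]_(i < k.+1) \int[Pr]_(w in gen i) (r (x i w) ^+ 2)%:E <=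
       (rate_bound P Lip ah theta lam N b mu (enorm (x0 - xs)) C Cbar
          (sigma P F (2 * a) xs) Ltil J k)%:E)%E in
   (a = 2%N -> forall K C4 c2 c3 : R,
      0 < K -> 0 < C4 -> BDG_constant d 4 C4 -> 0 < c2 -> 0 < c3 ->
      c2 <= K * (dim_const d * Gam P Lip ah) ->
      c3 <= K * (2 * Gam P Lip ah) ->
      let Lb := Lbar4 P Lip ah C4 c2 c3 in
      trial_error_bound P X F ah (fun y ys =>
        c1 P Lip ah C4 * sigma P F 4 ys + Lb * enorm (y - ys)) ->
      rate (C2_general P Lip ah lam C4 Nk) (C2bar_general P Lip ah lam Nk) Lb)
   /\
   (a = 1%N -> diameter X ^+ 2 <= J -> forall K d2 : R,
      0 < K -> 0 < d2 -> d2 <= K * dim_const d ->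
      let Ls := Lstar P Lip d2 in
      trial_error_bound P X F ah (fun _ ys =>
        sigma P F 2 ys + Ls * diameter X) ->
      rate (C2_compact lam) (C2_compact lam) (Num.max (Lq P Lip 2) Ls))].
Proof.
move=> X0 Xcl Xcvx mF a12 htl T Xstar [xs0 sol0] pm Xx0 ah01 theta01 /andP[lam0 lam6']
  N0 b0 mu2 iid x gen stop r Nk.
have lam6 : 6 * lam ^+ 2 < 1.
  have s60 : 0 < Num.sqrt 6 :> R by rewrite sqrtr_gt0.
  have h : lam * Num.sqrt 6 < 1 by rewrite -ltr_pdivlMr// div1r.
  have -> : 6 * lam ^+ 2 = (lam * Num.sqrt 6) ^+ 2 by rewrite exprMn sqr_sqrtr// mulrC.
  by rewrite expr_lt1// mulr_ge0// ltW.
have a12' : a = 1%N \/ a = 2%N by case: a12 => [[]|]; [left | right].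
have model := heavy_tailed_model X0 Xcl Xcvx mF htl a12'.
have sm := heavy_tailed_search_moments Xcl mF htl a12.
have Nk0 := sample_size_gt0 b mu N0.
(* This bound on the sum of the inverse sample sizes is the inverse of the denominator in
   [rate_bound], so the rates match it by conversion. *)
have NkS := sample_size_sum N0 b0 mu2.
split.
- split.
  + exact: (stops_solution model ah01 theta01 Xx0 Nk0 iid).
  + exact: (iterate_alternative model sm ah01 theta01 lam0 lam6 Xx0 Nk0 iid NkS sol0 pm).
  + exact: (generated_residual_cvg0 model sm ah01 theta01 lam0 lam6 Xx0 Nk0 iid NkS sol0 pm).
- exact: (generated_L2_bounded model sm ah01 theta01 lam0 lam6 Xx0 Nk0 iid NkS sol0 pm).
move=> xs sol J J0 hJ rate; split.
  move=> a2 K C4 c2 c3 _ C40 _ c20 c30 _ _ Lb teb k; rewrite a2.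
  have [hL hF] := heavy_tailed_moments Xcl mF htl; rewrite a2 in hL hF.
  exact: (rate_general model sm ah01 theta01 lam0 lam6 Xx0 Nk0 iid NkS sol pm J0 hJ C40 c20 c30 hL hF teb).
move=> a1 dJ K d2 _ d20 _ Ls teb k; rewrite a1.
have Xc : compact X by case: a12 => [[]|a2] //; rewrite a2 in a1.
exact: (rate_compact model sm ah01 theta01 lam0 lam6 Xx0 Nk0 iid NkS sol pm J0 hJ d20 Xc dJ teb).
Qed.
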